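(* Let $X_t^\omega$ be the particle position at time $t$ in the Lévy-Lorentz gas with environment $\omega$. Assume that $\mu:=\mathbb{E}[\Delta_1]<+\infty$. The following holds for $\mathbb{P}$-a.e. $\omega$: for all $q>0$, as $t\uparrow+\infty$, $$E\big[|X_t^\omega|^q\big]\sim\sqrt{\frac{(2\mu)^q}{\pi}}\,\Gamma\bigg(\frac{q+1}{2}\bigg)\,t^{\frac{q}{2}}.$$
   Context: The Lévy-Lorentz gas. Environment: on a probability space $(\Omega,\mathscr{F},\mathbb{P})$ (expectation $\mathbb{E}$) let $\omega=\{\omega_r\}_{r\in\mathbb{Z}}$ be random scatterer positions on $\mathbb{R}$ in ascending order with $\omega_0:=0$, such that the distances $\Delta_r^\omega:=\omega_r-\omega_{r-1}$, $r\in\mathbb{Z}$, form a bilateral sequence of i.i.d. positive random variables; $\mu:=\mathbb{E}[\Delta_1]$. Velocities: on a probability space $(\mathcal{S},\mathfrak{S},P)$ (expectation $E$) let $V_1,V_2,\ldots$ be i.i.d. with $P[V_n=1]=P[V_n=-1]=1/2$, and let $S_n:=\sum_{k=1}^nV_k$, $S_0:=0$ (simple symmetric random walk). Collision times: $T_n^\omega:=\sum_{k=1}^n|\omega_{S_k}-\omega_{S_{k-1}}|$, $T_0^\omega:=0$. Particle position: $X_t^\omega:=\omega_{S_{n-1}}+V_n(t-T_{n-1}^\omega)$ for $t\in[T_{n-1}^\omega,T_n^\omega)$, $n\ge 1$ (for $\mathbb{P}$-a.e. $\omega$, $P$-almost surely $T_n^\omega\to+\infty$, so $X_t^\omega$ is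 $P$-almost surely defined for all $t$). $\Gamma$ is the Euler gamma function. $f(t)\sim g(t)$ means $\lim_{t\uparrow+\infty}f(t)/g(t)=1$. *)

(* Defs.v *)
From HB Require Import structures.
From mathcomp Require Import all_boot all_order all_algebra.
From mathcomp Require Import all_classical all_reals all_analysis.

Set Implicit Arguments.
Unset Strict Implicit.
Unset Printing Implicit Defensive.

Import Order.TTheory GRing.Theory Num.Theory.
Import numFieldNormedType.Exports.

Local Open Scope classical_set_scope.
Local Open Scope ring_scope.

HB.instance Definition _ := isPointed.Build int 0.

HB.instance Definition _ := @isMeasurable.Build default_measure_display
  int discrete_measurable discrete_measurable0
  discrete_measurableC discrete_measurableU.

Section iid.
Context {d d' : measure_display} {T : measurableType d}
  {T' : measurableType d'} {R : realType} (P : probability T R).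
Context {I : eqType}.
Implicit Type X : I -> T -> T'.

Definition mutually_independent X : Prop :=
  forall (J : seq I) (A : I -> set T'), uniq J ->
    (forall i, measurable (A i)) ->
    P (\bigcap_(i in [set` J]) (X i @^-1` A i)) =
    (\prod_(i <- J) P (X i @^-1` A i))%E.

Definition identically_distributed X : Prop :=
  forall (i j : I) (A : set T'), measurable A ->
    P (X i @^-1` A) = P (X j @^-1` A).

End iid.

Definition spacing {T : Type} {R : realType} (omega : int -> T -> R) (r : int)
    : T -> R :=
  omega r \- omega (r - 1).

(* The dynamics for a fixed realization x of the scatterers and a fixed
   realization v of the velocities.  Velocities are indexed from 0: v k is the
   velocity V_(k+1) used on the k-th flight, between collisions k and k+1. *)
Section dynamics.
Context {R : realType}.
Variables (x : int -> R) (v : nat -> int).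

Definition walk (n : nat) : int := \sum_(0 <= k < n) v k.

Definition collision_time (n : nat) : R :=
  \sum_(0 <= k < n) `|x (walk k.+1) - x (walk k)|.

(* Collision times are nondecreasing, so at most one n satisfies the condition.
   The default 0 is used only for t < 0 or when the collision times stay
   bounded by t. *)
Definition flight_index (t : R) : nat :=
  xget 0%N [set n | collision_time n <= t < collision_time n.+1].

Definition position (t : R) : R :=
  let n := flight_index t in
  x (walk n) + (v n)%:~R * (t - collision_time n).

End dynamics.

(* The integral formula, meaningful for s > 0. *)
Definition Gamma {R : realType} (s : R) : R :=
  \int[@lebesgue_measure R]_(x in `]0%R, +oo[) (x `^ (s - 1) * expR (- x)).

(* Main.v *)
Require Import Defs.
From HB Require Import structures.
From mathcomp Require Import all_boot all_order all_algebra.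
From mathcomp Require Import all_classical all_reals all_analysis.
From mathcomp Require Import measurable_realfun ring lra zify.

Set Implicit Arguments.
Unset Strict Implicit.
Unset Printing Implicit Defensive.

Import Order.TTheory GRing.Theory Num.Theory.
Import numFieldNormedType.Exports.

Local Open Scope classical_set_scope.
Local Open Scope ring_scope.

(** Almost every environment satisfies the strong law of large numbers on both
    sides of the origin ([strong_law]): [x s = mu * s + o(s)]. From there on the
    environment is a fixed increasing sequence [x] with this property, and only
    the velocities are random.

    Two facts are proved about such an environment. The first is that at a
    large time [t] the particle is close to [mu * walk v m], where [m] is an even
    number near [t / mu] ([position_close]). Write [y s = x s - mu * s]. A
    discrete Ito formula ([collision_time_ito]) expresses the deviation of the
    [n]-th collision time from [mu * n] as a corrector, which is [o(s ^ 2)] at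
    the site [s], plus a martingale with increments [-2 * v k * y (walk v k)];
    both are [o(n)] in mean ([collision_time_lln]). Hence the number of
    collisions before [t] is [m + o(t)], by the maximal inequality the walk moves
    by [o(sqrt t)] during the [o(t)] steps in question, and linearity of [x]
    transfers this to the position.

    The second fact is that every even moment of the position at time [t]
    divided by [sqrt t] stays bounded ([stopped_moment], [position_moment]).
    Spacings need not have moments beyond the first, so this cannot be read off
    moments of the collision times. Instead, a Lyapunov function [G] of
    order [|s| ^ (2 * k + 2)] is chosen so that [G - T * s ^ (2 * k)], taken
    along the walk and its collision times [T], is a supermartingale; it is
    stopped at the first collision after [t], where [T] exceeds [t] by at most
    [O(|s|)].

    Closeness in probability and bounded higher moments together give
    [E |X_t| ^ q = mu ^ q * E |walk v m| ^ q + o(t ^ (q / 2))] ([moment_close]).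
    The moments of the simple random walk are computed from the binomial weights
    relative to the central one: these lie between explicit Gaussians
    ([rel_weight_le], [rel_weight_ge]), so the moments are quotients of Riemann
    sums, which converge to Gaussian integrals ([even_walk_moment_cvg]), and a
    substitution turns these into values of the Gamma function.

    All averages over the velocities are finite averages over fair coins
    ([avg]) until [expected_position_close], which passes to the given
    probability space by monotone convergence in the number of velocities
    drawn. *)

(** * Averages over finitely many fair coins *)

Definition upd (v : nat -> int) (n : nat) (a : int) : nat -> int :=
  fun k => if k == n then a else v k.

Section coin_average.
Context {R : realType}.
Implicit Types (F G : (nat -> int) -> R) (u v : nat -> int).

(** The conditional expectation of [F] given the first [k] tosses of [u], when [F]
    depends on the first [k + j] tosses only: the next [j] are averaged out. *)
Fixpoint avg (k j : nat) F u : R :=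
  if j is j'.+1 then
    (avg k.+1 j' F (upd u k 1) + avg k.+1 j' F (upd u k (- 1))) / 2
  else F u.

(** The sequences that [avg k j _ u] ranges over. *)
Definition tosses (k j : nat) u v : Prop :=
  (forall i, (i < k)%N -> v i = u i) /\
  (forall i, (k <= i < k + j)%N -> v i = 1 \/ v i = -1).

Definition prefix_fun T (k : nat) (F : (nat -> int) -> T) : Prop :=
  forall u v, (forall i, (i < k)%N -> u i = v i) -> F u = F v.

Lemma tosses_upd k j u v a : a = 1 \/ a = -1 ->
  tosses k.+1 j (upd u k a) v -> tosses k j.+1 u v.
Proof.
move=> ha [h1 h2]; split=> i hi.
  by rewrite h1 ?ltnS 1?ltnW // /upd; case: eqP => // e; lia.
have [e|ne] := eqVneq i k; first by rewrite e h1 // /upd eqxx.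
by apply: h2; lia.
Qed.

Lemma avg_le k j F G u : (forall v, tosses k j u v -> F v <= G v) ->
  avg k j F u <= avg k j G u.
Proof.
elim: j k u => [|j IH] k u h /=; first by apply: h; split=> i; lia.
rewrite ler_pM2r ?invr_gt0 //; apply: lerD; apply: IH => v hv; apply: h.
  by apply: tosses_upd hv; left.
by apply: tosses_upd hv; right.
Qed.

Lemma eq_avg k j F G u : (forall v, tosses k j u v -> F v = G v) ->
  avg k j F u = avg k j G u.
Proof.
by move=> h; apply/eqP; rewrite eq_le !avg_le // => v /h ->.
Qed.

Lemma avgD k j F G u : avg k j (fun v => F v + G v) u = avg k j F u + avg k j G u.
Proof. by elim: j k u => [|j IH] k u //=; rewrite !IH; field. Qed.

Lemma avgZ k j c F u : avg k j (fun v => c * F v) u = c * avg k j F u.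
Proof. by elim: j k u => [|j IH] k u //=; rewrite !IH; field. Qed.

Lemma avgB k j F G u : avg k j (fun v => F v - G v) u = avg k j F u - avg k j G u.
Proof. by elim: j k u => [|j IH] k u //=; rewrite !IH; field. Qed.

Lemma avg_prefix k j F u : prefix_fun k F -> avg k j F u = F u.
Proof.
elim: j k u => [|j IH] k u hF //=.
have hF' : prefix_fun k.+1 F by move=> v w h; apply: hF => i ik; apply: h; lia.
rewrite !IH // (hF (upd u k 1) u) ?(hF (upd u k (- 1)) u); first by field.
  by move=> i ik; rewrite /upd; case: eqP => //; lia.
by move=> i ik; rewrite /upd; case: eqP => //; lia.
Qed.

Lemma avg_cst k j c u : avg k j (fun=> c) u = c.
Proof. exact: (@avg_prefix k j (fun=> c)). Qed.

Lemma avg_bool_le1 k j (b : (nat -> int) -> bool) u :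
  avg k j (fun v => (b v)%:R) u <= 1.
Proof. by rewrite -[leRHS](avg_cst k j _ u); apply: avg_le => v _; case: (b v). Qed.

(** The tower property of conditional expectations. *)
Lemma avg_tower k j l F u :
  avg k (j + l) F u = avg k j (fun v => avg (k + j) l F v) u.
Proof.
elim: j k u => [|j IH] k u; first by rewrite /= addn0.
by rewrite addSn /= !IH !addSnnS.
Qed.

Lemma avg_last n F u : avg 0 n.+1 F u =
  avg 0 n (fun v => (F (upd v n 1) + F (upd v n (- 1))) / 2) u.
Proof. by rewrite -addn1 avg_tower. Qed.

Lemma avg_widen n N F u : (n <= N)%N -> prefix_fun n F -> avg 0 N F u = avg 0 n F u.
Proof.
move=> nN hF; rewrite -(subnKC nN) avg_tower; apply: eq_avg => v _.
by rewrite add0n avg_prefix.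
Qed.

Lemma ler_norm_avg k j F u : `|avg k j F u| <= avg k j (fun v => `|F v|) u.
Proof.
rewrite ler_norml; apply/andP; split.
  rewrite -mulN1r -avgZ; apply: avg_le => v _.
  by rewrite mulN1r lerNl ler_normr lexx orbT.
by apply: avg_le => v _; rewrite ler_norm.
Qed.

Lemma avg_markov k j F (a : R) u : 0 < a -> (forall v, 0 <= F v) ->
  avg k j (fun v => (a <= F v)%R%:R) u <= avg k j F u / a.
Proof.
move=> a0 F0; rewrite mulrC -avgZ; apply: avg_le => v _.
case: (leP a) => h /=; last by rewrite mulr0n mulr_ge0 ?invr_ge0 ?(ltW a0).
by rewrite mulr1n mulrC ler_pdivlMr // mul1r.
Qed.

End coin_average.

(** * The simple random walk *)

Section walk_facts.
Context {R : realType}.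
Implicit Types (u v : nat -> int) (n : nat).

Lemma walk0 v : walk v 0 = 0.
Proof. by rewrite /walk big_geq. Qed.

Lemma walkS v n : walk v n.+1 = walk v n + v n.
Proof. by rewrite /walk big_nat_recr. Qed.

Lemma prefix_walk n : prefix_fun n (walk^~ n).
Proof. by move=> u v h; rewrite /walk; apply: eq_big_nat => i /andP[_]; exact: h. Qed.

Lemma walk_upd v n m a : (m <= n)%N -> walk (upd v n a) m = walk v m.
Proof.
move=> mn; apply: prefix_walk => i im; rewrite /upd; case: eqP => //; lia.
Qed.

Lemma walk_updS v n a : walk (upd v n a) n.+1 = walk v n + a.
Proof. by rewrite walkS walk_upd // /upd eqxx. Qed.

Lemma walk_sqr n u : avg 0 n (fun v => ((walk v n)%:~R : R) ^+ 2) u = n%:R.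
Proof.
elim: n => [|n IH]; first by rewrite /= walk0 expr0n.
transitivity (avg 0 n (fun v => ((walk v n)%:~R : R) ^+ 2 + 1) u); last first.
  by rewrite avgD avg_cst IH natr1.
rewrite avg_last; apply: eq_avg => v _ /=.
by rewrite !walk_updS !intrD; field.
Qed.

Definition leaves (c : int) (a : R) k j v : bool :=
  has (fun i => a < `|(walk v i - c)%:~R|) (iota k j.+1).

(** Kolmogorov's maximal inequality, by conditioning on the first step: as long
    as the walk is in the window, the bound at the present site is the mean of
    the bounds at the two next sites. *)
Lemma avg_leaves (c : int) (a : R) k j u : 0 < a ->
  avg k j (fun v => (leaves c a k j v)%:R) u
  <= ((walk u k - c)%:~R ^+ 2 + j%:R) / a ^+ 2.
Proof.
move=> a0; elim: j k u => [|j IH] k u; rewrite ler_pdivlMr ?exprn_gt0 //.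
  rewrite /= /leaves /= orbF addr0; case: ltP => h; last first.
    by rewrite mul0r sqr_ge0.
  by rewrite mul1r -[leRHS]real_normK ?num_real // lerXn2r ?nnegrE ?(ltW a0) ?(ltW h).
have [h|h] := ltP a `|(walk u k - c)%:~R|.
  apply: (@le_trans _ _ (1 * a ^+ 2)).
    by rewrite ler_wpM2r ?sqr_ge0 // avg_bool_le1.
  rewrite mul1r (@le_trans _ _ ((walk u k - c)%:~R ^+ 2)) ?lerDl //.
  by rewrite -[leRHS]real_normK ?num_real // lerXn2r ?nnegrE ?(ltW a0) ?(ltW h).
rewrite (@eq_avg _ _ _ _ (fun v => (leaves c a k.+1 j v)%:R)); last first.
  move=> v [hv _]; rewrite /leaves /= (@prefix_walk _ v u) //.
  by rewrite ltNge h.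
move: (IH k.+1 (upd u k 1)) (IH k.+1 (upd u k (-1))) => /=.
rewrite !walk_updS !ler_pdivlMr ?exprn_gt0 // => h1 h2.
rewrite -(ler_pM2r (ltr0Sn R 1)).
move: h1 h2; rewrite -[j.+1]addn1 natrD !intrD !intrN.
set A := avg _ _ _ _; set B := avg _ _ _ _; set w : R := (walk u k)%:~R.
set cc : R := c%:~R.
move=> h1 h2; have := lerD h1 h2; rewrite !mulrDl ?mulVf; nra.
Qed.

Lemma prefix_leaves (a : R) k j :
  prefix_fun (k + j) (fun v => leaves (walk v k) a k j v).
Proof.
move=> v w hvw; rewrite /leaves.
have -> : walk v k = walk w k by apply: prefix_walk => i hi; apply: hvw; lia.
apply: eq_in_has => i; rewrite mem_iota => hi.
suff -> : walk v i = walk w i by [].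
by apply: prefix_walk => i' hi'; apply: hvw; lia.
Qed.

Lemma avg_leaves_walk (a : R) k j u : 0 < a ->
  avg 0 (k + j) (fun v => (leaves (walk v k) a k j v)%:R) u <= j%:R / a ^+ 2.
Proof.
move=> a0; rewrite avg_tower -[leRHS](avg_cst 0 k _ u); apply: avg_le => v _.
rewrite add0n (@eq_avg _ _ _ _ (fun w => (leaves (walk v k) a k j w)%:R)); last first.
  by move=> w [hw _]; rewrite (@prefix_walk k w v).
by apply: le_trans (avg_leaves _ _ _ _ a0) _; rewrite subrr expr0n /= add0r.
Qed.

End walk_facts.

(** * Collision times in a fixed environment *)

Section zsum.
Context {R : realType}.
Implicit Types (g : int -> R) (s : int).

(** The discrete primitive of [g] on both sides of 0, normalized at 0. *)
Definition zsum g s : R :=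
  match s with
  | Posz n => \sum_(0 <= i < n) g i%:Z
  | Negz n => - \sum_(0 <= i < n.+1) g (- (i.+1)%:Z)
  end.

Lemma zsumS g s : zsum g (s + 1) = zsum g s + g s.
Proof.
case: s => [n|[|n]].
- by rewrite -PoszD addn1 /= big_nat_recr.
- by rewrite (_ : Negz 0 + 1 = 0) // /= big_geq // big_nat1 NegzE addNr.
- rewrite (_ : Negz n.+1 + 1 = Negz n); last by rewrite !NegzE; lia.
  by rewrite /= [in RHS]big_nat_recr //= opprD NegzE subrK.
Qed.

Lemma zsum_bound g s (B : R) : (forall i : int, `|i| <= `|s| -> `|g i| <= B) ->
  `|zsum g s| <= `|s|%:~R * B.
Proof.
move=> h; suff H : forall (n : nat) (e : nat -> int),
    (forall i, (i < n)%N -> `|e i| <= `|s|) ->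
    `|\sum_(0 <= i < n) g (e i)| <= n%:R * B.
  case: s h H => n h H /=.
    by apply: (H n (fun i => i%:Z)) => i ? ; lia.
  rewrite normrN; apply: le_trans (H _ (fun i => - (i.+1)%:Z) _) _.
    by move=> i ?; lia.
  by rewrite NegzE normrN.
move=> n e he; rewrite big_mkord; apply: le_trans (ler_norm_sum _ _ _) _.
apply: le_trans (ler_sum _ (fun (i : 'I_n) _ => h (e i) (he i (ltn_ord i)))) _.
by rewrite sumr_const card_ord mulr_natl.
Qed.

End zsum.

Section environment.
Context {R : realType}.
Context (x : int -> R) (mu : R) (x_lt : forall s, x s < x (s + 1)).
Implicit Types (u v : nat -> int) (n : nat) (s : int).

Local Notation T := (collision_time x).
Local Notation y s := (x s - mu * s%:~R).

Lemma flightE s (a : int) : a = 1 \/ a = -1 ->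
  `|x (s + a) - x s| = a%:~R * (x (s + a) - x s).
Proof.
case=> ->; first by rewrite mul1r gtr0_norm // subr_gt0.
rewrite mulN1r ltr0_norm // subr_lt0.
by have := x_lt (s - 1); rewrite subrK.
Qed.

Lemma collision_timeS v n :
  T v n.+1 = T v n + `|x (walk v n + v n) - x (walk v n)|.
Proof. by rewrite /collision_time big_nat_recr //= walkS. Qed.

Lemma collision_time0 v : T v 0 = 0.
Proof. by rewrite /collision_time big_geq. Qed.

Lemma collision_time_le v : {homo T v : m n / (m <= n)%N >-> m <= n}.
Proof.
apply: homo_leq => [//|? ? ?|n]; first exact: le_trans.
by rewrite collision_timeS lerDl.
Qed.

Lemma collision_time_ge0 v n : 0 <= T v n.
Proof. by rewrite -(collision_time0 v) collision_time_le. Qed.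

Lemma prefix_collision_time n : prefix_fun n (T^~ n).
Proof.
move=> u v h; rewrite /collision_time; apply: eq_big_nat => k /andP[_ kn].
by rewrite !(@prefix_walk _ u v) // => i ik; apply: h; lia.
Qed.

Lemma collision_time_upd v n m a : (m <= n)%N -> T (upd v n a) m = T v m.
Proof.
move=> mn; apply: prefix_collision_time => i im; rewrite /upd.
by case: eqP => //; lia.
Qed.

Lemma collision_time_updS v n a :
  T (upd v n a) n.+1 = T v n + `|x (walk v n + a) - x (walk v n)|.
Proof.
by rewrite collision_timeS walk_upd // collision_time_upd // /upd eqxx.
Qed.

(** Half the second difference of the corrector at [s] is
    [(y (s + 1) - y (s - 1)) / 2], the mean excess over [mu] of the two flights
    that leave [s]. *)
Definition corrector : int -> R := zsum (fun s => y s + y (s + 1)).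

Definition mart v n : R := \sum_(0 <= k < n) (v k)%:~R * y (walk v k).

Lemma mart_upd v n m a : (m <= n)%N -> mart (upd v n a) m = mart v m.
Proof.
move=> mn; apply: eq_big_nat => k /andP[_ km].
by rewrite walk_upd ?(leq_trans (ltnW km)) // /upd; case: eqP => //; lia.
Qed.

(** Discrete Ito formula: as [(v k) ^+ 2 = 1], the excess of the k-th flight
    is [v k * (y' - y) = v k * (y' + y) - 2 * v k * y], where [y] and [y'] are
    taken at its two ends, and the first term is the increment of the
    corrector. *)
Lemma collision_time_ito v n : (forall i, (i < n)%N -> v i = 1 \/ v i = -1) ->
  T v n - mu * n%:R = corrector (walk v n) - 2 * mart v n.
Proof.
elim: n => [|n IH] hv.
  by rewrite collision_time0 walk0 /mart /corrector /= !big_geq // !mulr0 subrr.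
have vn := hv n (ltnSn n).
have IH' := IH (fun i hi => hv i (ltnW hi)).
rewrite collision_timeS walkS flightE // /mart big_nat_recr //= -/(mart v n).
have c1 : corrector (walk v n + v n) = corrector (walk v n)
    + (v n)%:~R * (y (walk v n) + y (walk v n + v n)).
  case: vn => ->; first by rewrite /corrector zsumS mul1r.
  have := zsumS (fun s => y s + y (s + 1)) (walk v n - 1).
  rewrite subrK -/corrector => e; rewrite [X in _ = X + _]e; ring.
have v2 : (v n)%:~R * (v n)%:~R = 1 :> R.
  by case: vn => ->; rewrite -intrM.
rewrite c1 -natr1 !intrD.
transitivity (T v n - mu * n%:R - mu * ((v n)%:~R * (v n)%:~R)
  + (v n)%:~R * (x (walk v n + v n) - x (walk v n))); first by rewrite v2; ring.
by rewrite IH'; ring.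
Qed.

(** Increments of a martingale are orthogonal. *)
Lemma avg_mart_sqr n u : avg 0 n (fun v => mart v n ^+ 2) u =
  \sum_(0 <= k < n) avg 0 k (fun v => y (walk v k) ^+ 2) u.
Proof.
elim: n => [|n IH]; first by rewrite /= /mart !big_geq // expr0n.
rewrite big_nat_recr //= -IH -avgD -/(avg 0 n.+1 _ u) avg_last.
apply: eq_avg => v _; rewrite /mart !big_nat_recr //=.
by rewrite -!/(mart _ n) !mart_upd // !walk_upd // /upd eqxx; field.
Qed.

Context (mu_gt0 : 0 < mu)
  (x_lin : forall e : R, 0 < e -> exists C : R, 0 <= C /\
     forall s, `|y s| <= e * `|s|%:~R + C).

(** Summing the sublinear [y] up to [s] gives [o(s ^ 2)]. *)
Lemma corrector_bound (e : R) : 0 < e -> exists C : R, 0 <= C /\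
  forall s, `|corrector s| <= e * (s%:~R) ^+ 2 + C.
Proof.
move=> e0; have [|C [C0 hC]] := x_lin (e := e / 4); first by rewrite divr_gt0.
have B0 : 0 <= e / 4 + 2 * C by rewrite addr_ge0 ?mulr_ge0 ?divr_ge0 ?(ltW e0).
exists ((e / 4 + 2 * C) ^+ 2 / e); split; first by rewrite divr_ge0 ?sqr_ge0 ?(ltW e0).
move=> s; set a : R := `|s|%:~R.
have a0 : 0 <= a by rewrite ler0z normr_ge0.
have -> : (s%:~R) ^+ 2 = a ^+ 2 :> R.
  by rewrite /a intr_norm real_normK ?num_real.
apply: (@le_trans _ _ (a * (e / 2 * a + (e / 4 + 2 * C)))).
  apply: zsum_bound => i hi.
  apply: le_trans (ler_normD _ _) _; apply: le_trans (lerD (hC _) (hC _)) _.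
  have h1 : `|i|%:~R <= a by rewrite ler_int.
  have h2 : `|i + 1|%:~R <= a + 1.
    by rewrite /a -[1]/(1%:~R) -intrD ler_int (le_trans (ler_normD _ _)) // lerD2r.
  nra.
have -> : a * (e / 2 * a + (e / 4 + 2 * C)) =
   e / 2 * a ^+ 2 + a * (e / 4 + 2 * C) by ring.
set B := e / 4 + 2 * C.
have : 0 <= (e * a - B) ^+ 2 by exact: sqr_ge0.
move=> h; have : a * B <= e / 2 * a ^+ 2 + B ^+ 2 / (2 * e).
  have -> : a * B = e / 2 * a ^+ 2 + B ^+ 2 / (2 * e) - (e * a - B) ^+ 2 / (2 * e).
    by field; rewrite gt_eqF.
  by rewrite lerBlDr lerDl divr_ge0 // mulr_ge0 // ltW.
have : B ^+ 2 / (2 * e) <= B ^+ 2 / e.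
  by rewrite ler_wpM2l ?sqr_ge0 // lef_pV2 ?posrE ?mulr_gt0 // ler_peMl ?(ltW e0) // ler1n.
lra.
Qed.

Lemma avg_y_sqr (e C : R) n u : 0 <= e -> 0 <= C -> (forall s, `|y s| <= e * `|s|%:~R + C) ->
  avg 0 n (fun v => y (walk v n) ^+ 2) u <= 2 * e ^+ 2 * n%:R + 2 * C ^+ 2.
Proof.
move=> e0 C0 hC; rewrite -(walk_sqr n u) -avgZ -(avg_cst 0 n (2 * C ^+ 2) u) -avgD.
apply: avg_le => v _; set s := walk v n.
rewrite -[leLHS]real_normK ?num_real //.
have -> : (s%:~R) ^+ 2 = `|s|%:~R ^+ 2 :> R.
  by rewrite intr_norm real_normK ?num_real.
have := hC s; set a : R := `|s|%:~R => ya.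
have a0 : 0 <= a by rewrite ler0z normr_ge0.
apply: (@le_trans _ _ ((e * a + C) ^+ 2)).
  by rewrite lerXn2r ?nnegrE ?addr_ge0 ?mulr_ge0.
have := sqr_ge0 (e * a - C); nra.
Qed.

(** In the Ito formula the corrector is [o(n)] in mean, because [walk v n] has
    variance [n], and the martingale has standard deviation [o(n)]. *)
Lemma collision_time_lln (e : R) : 0 < e -> exists C : R, 0 <= C /\
  forall n u, avg 0 n (fun v => `|T v n - mu * n%:R|) u <= e * n%:R + C.
Proof.
move=> e0; set d := e / 4; have d0 : 0 < d by rewrite divr_gt0.
have [D [D0 hD]] := corrector_bound d0.
have [C [C0 hC]] := x_lin d0.
exists (D + 2 * C ^+ 2 / d + d); split.
  by rewrite !addr_ge0 ?divr_ge0 ?mulr_ge0 ?sqr_ge0 // ltW.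
move=> n u; have n0 : 0 <= n%:R :> R by [].
(* The mean of the martingale [m] is controlled by [2 * |m| <= m ^ 2 / w + w];
   [w] is of the order of the standard deviation. *)
set w := d * n.+1%:R; have w0 : 0 < w by rewrite mulr_gt0.
have M : avg 0 n (fun v => mart v n ^+ 2) u <= n%:R * (2 * d ^+ 2 * n%:R + 2 * C ^+ 2).
  rewrite avg_mart_sqr big_mkord.
  apply: le_trans (_ : _ <= \sum_(i < n) (2 * d ^+ 2 * n%:R + 2 * C ^+ 2)) _.
    apply: ler_sum => i _; apply: le_trans (avg_y_sqr _ _ _ C0 hC) _; first exact: ltW.
    by rewrite lerD2r ler_wpM2l ?mulr_ge0 ?(ltW e0) // ler_nat ltnW.
  by rewrite sumr_const card_ord -[leLHS]mulr_natl.
apply: (@le_trans _ _ (avg 0 n (fun v => (d * (walk v n)%:~R ^+ 2 + D)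
    + (w^-1 * mart v n ^+ 2 + w)) u)).
  apply: avg_le => v [_ hv]; rewrite collision_time_ito; last first.
    by move=> i hi; apply: hv.
  apply: le_trans (ler_normB _ _) _; apply: lerD; first exact: hD.
  rewrite normrM ger0_norm // -[mart v n ^+ 2]real_normK ?num_real //.
  set m := `|_|; have := sqr_ge0 (m - w) => h.
  have -> : w^-1 * m ^+ 2 + w = (m ^+ 2 + w ^+ 2) / w by field; rewrite gt_eqF.
  rewrite ler_pdivlMr //; nra.
rewrite !avgD !avgZ !avg_cst walk_sqr.
have -> : e = 4 * d by rewrite /d; field.
have : w^-1 * avg 0 n (fun v => mart v n ^+ 2) u <= 2 * d * n%:R + 2 * C ^+ 2 / d.
  rewrite ler_pdivrMl //; apply: le_trans M _.
  have -> : w * (2 * d * n%:R + 2 * C ^+ 2 / d) =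
    (n%:R + 1) * (2 * d ^+ 2 * n%:R + 2 * C ^+ 2).
    by rewrite /w -natr1; field; rewrite gt_eqF.
  by rewrite ler_wpM2r ?lerDl // addr_ge0 ?mulr_ge0 ?(ltW e0) ?sqr_ge0.
rewrite /w -natr1; nra.
Qed.

End environment.

(** * Moments of the walk at a physical time *)

Section lyapunov.
Context {R : realType} (x : int -> R) (x_lt : forall s, x s < x (s + 1)) (k : nat).
Implicit Types (s : int) (n : nat).

Definition weight s : R := (s%:~R) ^+ k.*2.

Lemma weightE s : weight s = `|s|%:~R ^+ k.*2.
Proof.
by rewrite /weight -!muln2 mulnC !exprM intr_norm real_normK ?num_real.
Qed.

Lemma weight_ge0 s : 0 <= weight s.
Proof. by rewrite weightE exprn_ge0 // ler0z. Qed.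

Lemma weight_midpoint s : weight s *+ 2 <= weight (s + 1) + weight (s - 1).
Proof.
have H (a b c : R) m : 0 <= c -> 0 <= a -> 0 <= b -> 2 * c <= a + b ->
    2 * c ^+ m <= a ^+ m + b ^+ m.
  move=> c0 a0 b0 h; elim: m => [|m IH]; first by rewrite !expr0; lra.
  have am := exprn_ge0 m a0; have bm := exprn_ge0 m b0; have cm := exprn_ge0 m c0.
  have ab : 0 <= (a - b) * (a ^+ m - b ^+ m).
    have [ab|/ltW ab] := leP a b.
      by rewrite -mulrNN !opprB mulr_ge0 // subr_ge0 // lerXn2r.
    by rewrite mulr_ge0 // subr_ge0 // lerXn2r.
  rewrite !exprS; nra.
rewrite /weight -muln2 mulnC !exprM -mulr_natl; apply: H; rewrite ?sqr_ge0 //.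
by rewrite !intrD intrN; nra.
Qed.

(** Second primitive, to the right of 0, of the flight lengths weighted at the
    site of arrival. *)
Definition half_potential (z : int -> R) n : R :=
  \sum_(0 <= m < n) \sum_(0 <= i < m.+1) (z (i%:Z + 1) - z i%:Z) * weight (i%:Z + 1).

Definition mirror s : R := - x (- s).

(** The Lyapunov function. As flights have length [mu] on average, it is of order
    [|s| ^ (2 * k + 2)], which is [s ^ 2] times [weight s], and [s ^ 2] is the
    order of the time in which the walk reaches [s]. *)
Definition potential s : R :=
  match s with
  | Posz n => half_potential x n
  | Negz n => half_potential mirror n.+1
  end.

Lemma potentialN n : potential (- n%:Z) = half_potential mirror n.
Proof. by case: n => [|n]; rewrite -?NegzE //= /half_potential !big_geq. Qed.

Lemma mirror_lt s : mirror s < mirror (s + 1).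
Proof. by rewrite /mirror ltrN2 opprD; have := x_lt (- s - 1); rewrite subrK. Qed.

Lemma half_potential_diff2 (z : int -> R) n :
  half_potential z n.+2 + half_potential z n - half_potential z n.+1 *+ 2 =
  (z (n%:Z + 2) - z (n%:Z + 1)) * weight (n%:Z + 2).
Proof.
rewrite /half_potential !(big_nat_recr n.+1) //= !(big_nat_recr n) //=.
have -> : n.+1%:Z = n%:Z + 1 by lia.
have -> : (n%:Z + 1 + 1)%R = n%:Z + 2 by lia.
set A := \sum_(0 <= _ < n) _; set B := \sum_(0 <= _ < n) _; ring.
Qed.

(** Away from 0 the second difference is the term of the flight that moves away
    from the origin; at 0 both flights do. *)
Lemma potential_diff2 s :
  potential (s + 1) + potential (s - 1) - potential s *+ 2 <=
  (x (s + 1) - x s) * weight (s + 1) + (x s - x (s - 1)) * weight (s - 1).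
Proof.
have pos a : 0 <= (x (a + 1) - x a) by rewrite subr_ge0 ltW.
have posN a : 0 <= (x a - x (a - 1)) by have := pos (a - 1); rewrite subrK.
case: s => [[|n]|n].
- rewrite sub0r add0r (potentialN 1) /= /half_potential.
  rewrite !big_nat1 /= big_geq // mul0rn subr0 /mirror add0r oppr0 opprK addrC.
  have -> : weight (-1) = weight 1 by rewrite !weightE normrN.
  by rewrite -[x 0%Z]/(x 0); lra.
- have -> : n.+1%:Z + 1 = n.+2%:Z by lia.
  have -> : n.+1%:Z - 1 = n%:Z by lia.
  rewrite [leLHS]half_potential_diff2.
  have -> : n.+2%:Z = n%:Z + 2 by lia.
  have -> : n.+1%:Z = n%:Z + 1 by lia.
  by rewrite lerDl mulr_ge0 ?weight_ge0.
- rewrite NegzE.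
  have -> : - n.+1%:Z + 1 = - n%:Z by lia.
  have -> : - n.+1%:Z - 1 = - n.+2%:Z by lia.
  rewrite !potentialN [_ + half_potential _ n.+2]addrC half_potential_diff2.
  rewrite /mirror.
  have -> : - n.+2%:Z = - (n%:Z + 2) by lia.
  have -> : - n.+1%:Z = - (n%:Z + 1) by lia.
  have -> : weight (- (n%:Z + 2)) = weight (n%:Z + 2) by rewrite !weightE normrN.
  rewrite opprK addrC lerDr mulr_ge0 ?weight_ge0 //.
  by have := posN (- n%:Z); rewrite -opprD.
Qed.

Lemma half_potential_ge0 (z : int -> R) n : (forall s, z s < z (s + 1)) ->
  0 <= half_potential z n.
Proof.
move=> hz; apply: sumr_ge0 => m _; apply: sumr_ge0 => i _.
by rewrite mulr_ge0 ?weight_ge0 // subr_ge0 ltW.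
Qed.

(** Only the indices from [2 * m] to [4 * m] are kept in the outer sum, and in
    each inner sum only the flights between the sites [m] and [2 * m], where the
    weight is at least [m ^ (2 * k)]. *)
Lemma half_potential_low (z : int -> R) m n : (forall s, z s < z (s + 1)) ->
  (4 * m <= n)%N ->
  (2 * m)%:R * (m%:R ^+ k.*2 * (z (2 * m)%N%:Z - z m%:Z)) <= half_potential z n.
Proof.
move=> hz mn.
have pos i : 0 <= (z (i%:Z + 1) - z i%:Z) * weight (i%:Z + 1).
  by rewrite mulr_ge0 ?weight_ge0 // subr_ge0 ltW.
have a_low j : (2 * m <= j)%N ->
   m%:R ^+ k.*2 * (z (2 * m)%N%:Z - z m%:Z) <=
   \sum_(0 <= i < j.+1) (z (i%:Z + 1) - z i%:Z) * weight (i%:Z + 1).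
  move=> mj; rewrite (@big_cat_nat _ _ _ m) //=; last by lia.
  rewrite (@big_cat_nat _ _ _ (2 * m) m) //=; [|lia|lia].
  apply: ler_wpDl; first by apply: sumr_ge0.
  apply: ler_wpDr; first by apply: sumr_ge0.
  rewrite mulrC -(@telescope_sumr _ m (2 * m) (fun i => z i%:Z)); last by lia.
  rewrite mulr_suml; apply: ler_sum_nat => i /andP[mi _].
  have -> : i.+1%:Z = i%:Z + 1 by lia.
  rewrite ler_wpM2l ?subr_ge0 ?(ltW (hz _)) //.
  rewrite /weight -[m%:R]/((m%:Z)%:~R) lerXn2r ?nnegrE ?ler0z ?ler_int //; lia.
rewrite /half_potential (@big_cat_nat _ _ _ (2 * m)) //=; last by lia.
rewrite (@big_cat_nat _ _ _ (4 * m) (2 * m)) //=; last by lia.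
apply: ler_wpDl; first by apply: sumr_ge0 => ? _; apply: sumr_ge0.
apply: ler_wpDr; first by apply: sumr_ge0 => ? _; apply: sumr_ge0.
have -> : (2 * m)%:R = (4 * m - 2 * m)%N%:R :> R by congr (_%:R); lia.
rewrite mulr_natl -[X in _ *+ X]/(_ - _)%N -sumr_const_nat.
by apply: ler_sum_nat => i /andP[hi _]; apply: a_low.
Qed.

End lyapunov.

(** In [half_potential_low] take [m = n %/ 4]: the length between the sites [m]
    and [2 * m] is of order [m], and the whole bound of order [m ^ (2 * k + 2)]. *)
Lemma half_potential_growth {R : realType} (z : int -> R) (k : nat) (mu C : R) :
  (forall s, z s < z (s + 1)) -> 0 < mu -> 0 <= C ->
  (forall n : nat, `|z n%:Z - mu * n%:R| <= mu / 6 * n%:R + C) ->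
  exists c D : R, [/\ 0 < c, 0 <= D &
    forall n, c * n%:R ^+ k.*2.+2 <= half_potential k z n + D].
Proof.
move=> hz mu0 C0 hC.
(* The factor 8 comes from [n <= 8 * m]; from [n0] on, the additive error [C]
   is at most [mu * m / 8]. *)
set c := mu / 2 / 8 ^+ k.*2.+2.
have c0 : 0 < c by rewrite /c !divr_gt0.
set n0 := (4 * (Num.truncn (8 * C / mu)).+1)%N.
have D0 : 0 <= c * n0%:R ^+ k.*2.+2 by rewrite mulr_ge0 ?(ltW c0).
exists c, (c * n0%:R ^+ k.*2.+2); split => // n.
have [nn0|n0n] := leqP n n0.
  apply: ler_wpDl; first exact: half_potential_ge0.
  by rewrite ler_wpM2l ?(ltW c0) // lerXn2r ?nnegrE ?ler_nat.
apply: ler_wpDr => //; set m := (n %/ 4)%N.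
have m1 : ((Num.truncn (8 * C / mu)).+1 <= m)%N by rewrite leq_divRL //; lia.
have nm : (n <= 8 * m)%N by have := divn_eq n 4; rewrite -/m; have := ltn_pmod n (isT : 0 < 4)%N; lia.
have mC : 8 * C <= m%:R * mu.
  rewrite -ler_pdivrMr // (le_trans (ltW (truncnS_gt _))) // ler_nat //.
apply: le_trans (half_potential_low (m := m) _ hz _); last by rewrite mulnC leq_divM.
have h1 := hC (2 * m)%N; have h2 := hC m; move: h1 h2; rewrite !ler_norml.
move=> /andP[h1 _] /andP[_ h2].
have zz : m%:R * mu / 4 <= z (2 * m)%N%:Z - z m%:Z.
  by move: h1; rewrite natrM; lra.
apply: (@le_trans _ _ (mu / 2 * m%:R ^+ k.*2.+2)).
  rewrite /c -mulrA ler_wpM2l ?divr_ge0 ?(ltW mu0) // mulrC ler_pdivrMr ?exprn_gt0 //.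
  by rewrite -exprMn lerXn2r ?nnegrE ?mulr_ge0 // mulrC -natrM ler_nat.
have -> : mu / 2 * m%:R ^+ k.*2.+2 = (2 * m)%:R * (m%:R ^+ k.*2 * (m%:R * mu / 4)).
  by rewrite natrM !exprS; field.
by rewrite ler_wpM2l // ler_wpM2l ?exprn_ge0.
Qed.

Section stop.
Context {R : realType} (x : int -> R).

Local Notation T := (collision_time x).

(** The first collision after time [t], within the first [k + j]; the recursion is
    that of [avg], so that optional stopping is an induction. *)
Fixpoint stop (t : R) k j v : nat :=
  if j is j'.+1 then if t < T v k then k else stop t k.+1 j' v else k.

Lemma stopP t k j v :
  [/\ (k <= stop t k j v <= k + j)%N,
      forall i, (k <= i < stop t k j v)%N -> T v i <= t &
      (stop t k j v < k + j)%N -> t < T v (stop t k j v)].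
Proof.
elim: j k => [|j IH] k /=.
  by split=> [|i|]; rewrite ?addn0 ?leqnn ?ltnn //; lia.
case: ltP => h; first by split => // [|i]; lia.
have [h1 h2 h3] := IH k.+1; split; [lia| |by rewrite addnS -addSn].
move=> i hi; have [->//|ne] := eqVneq i k; apply: h2; lia.
Qed.

End stop.

Section moments.
Context {R : realType} (x : int -> R) (mu : R)
  (x_lt : forall s, x s < x (s + 1)) (mu_gt0 : 0 < mu)
  (x_lin : forall e : R, 0 < e -> exists C : R, 0 <= C /\
     forall s, `|x s - mu * s%:~R| <= e * `|s|%:~R + C).
Implicit Types (u v : nat -> int) (n : nat) (s : int).

Local Notation T := (collision_time x).

Lemma potential_growth (k : nat) : exists c D : R, [/\ 0 < c, 0 <= D &
  forall s, c * `|s|%:~R ^+ k.*2.+2 <= potential x k s + D].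
Proof.
have [|C [C0 hC]] := x_lin (e := mu / 6); first by rewrite divr_gt0.
have [|c1 [D1 [c10 D10 h1]]] := @half_potential_growth _ x k mu C x_lt mu_gt0 C0.
  by move=> n; exact: (hC n%:Z).
have [|c2 [D2 [c20 D20 h2]]] :=
    @half_potential_growth _ (mirror x) k mu C (mirror_lt x_lt) mu_gt0 C0.
  move=> n; have := hC (- n%:Z); rewrite (normrN n%:Z).
  suff -> : mirror x n - mu * n%:R = - (x (- n%:Z) - mu * (- n%:Z)%:~R).
    by rewrite normrN.
  by rewrite /mirror intrN; ring.
exists (Num.min c1 c2), (D1 + D2); split; first by rewrite lt_min c10.
  by rewrite addr_ge0.
have [l1 l2] : Num.min c1 c2 <= c1 /\ Num.min c1 c2 <= c2.
  by rewrite !ge_min !lexx orbT.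
move=> [n|n].
  rewrite ger0_norm //; apply: (@le_trans _ _ (c1 * n%:R ^+ k.*2.+2)).
    by rewrite ler_wpM2r ?exprn_ge0.
  by apply: le_trans (h1 n) _; rewrite lerD2l lerDl.
rewrite NegzE normrN ger0_norm // potentialN.
apply: (@le_trans _ _ (c2 * n.+1%:R ^+ k.*2.+2)).
  by rewrite ler_wpM2r ?exprn_ge0.
by apply: le_trans (h2 n.+1) _; rewrite lerD2l lerDr.
Qed.

Definition supmart (k : nat) (s : int) (t : R) : R :=
  potential x k s - t * weight k s.

(** One step of the walk adds to [potential], in mean, at most the flight time
    weighted at the arrival, while the midpoint convexity of [weight] makes
    the old part of [T * weight] grow. *)
Lemma supmart_step (k : nat) s (t : R) : 0 <= t ->
  (supmart k (s + 1) (t + `|x (s + 1) - x s|)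
   + supmart k (s - 1) (t + `|x (s - 1) - x s|)) / 2 <= supmart k s t.
Proof.
move=> t0; rewrite /supmart.
have := potential_diff2 x_lt k s; have := weight_midpoint (R := R) k s.
have -> : `|x (s + 1) - x s| = x (s + 1) - x s by rewrite gtr0_norm // subr_gt0.
have -> : `|x (s - 1) - x s| = x s - x (s - 1).
  rewrite distrC gtr0_norm // subr_gt0.
  by have := x_lt (s - 1); rewrite subrK.
move=> h1 h2; have := ler_wpM2l t0 h1.
by move: h2; rewrite ler_pdivrMr // !mulr2n; lra.
Qed.

(** Optional stopping, by conditioning on the first step. *)
Lemma avg_stopped (p : nat) (t : R) k j u :
  avg k j (fun v => supmart p (walk v (stop x t k j v)) (T v (stop x t k j v))) u
  <= supmart p (walk u k) (T u k).
Proof.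
elim: j k u => [|j IH] k u; first by [].
have [h|h] := ltP t (T u k).
  rewrite (@eq_avg _ _ _ _ (fun=> supmart p (walk u k) (T u k))) ?avg_cst //.
  move=> v [hv _] /=; rewrite (@prefix_collision_time _ x k v u) // h.
  by rewrite (@prefix_walk k v u) // (@prefix_collision_time _ x k v u).
rewrite (@eq_avg _ _ _ _ (fun v =>
    supmart p (walk v (stop x t k.+1 j v)) (T v (stop x t k.+1 j v)))); last first.
  move=> v [hv _] /=; rewrite (@prefix_collision_time _ x k v u) //.
  by rewrite ltNge h.
apply: le_trans (supmart_step p (walk u k) (collision_time_ge0 x u k)).
rewrite /= ler_pM2r ?invr_gt0 //; apply: lerD.
  by apply: le_trans (IH _ _) _; rewrite walk_updS collision_time_updS.
by apply: le_trans (IH _ _) _; rewrite walk_updS collision_time_updS.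
Qed.

Lemma position_growth : exists K : R, 0 < K /\
  forall s, `|x s| <= K * (`|s|%:~R + 1).
Proof.
have [C [C0 hC]] := x_lin mu_gt0.
exists (mu + mu + C); split; first by rewrite ltr_wpDr // addr_gt0.
move=> s; have := hC s; set a : R := `|s|%:~R.
have a0 : 0 <= a by rewrite ler0z.
have : `|mu * s%:~R| = mu * a by rewrite normrM gtr0_norm // /a intr_norm.
have := ler_normD (x s - mu * s%:~R) (mu * s%:~R); rewrite subrK.
by have := mulr_ge0 C0 a0; have := mu_gt0; lra.
Qed.

(** The overshoot is at most one flight, whose length is bounded linearly in the
    site where it ends. *)
Lemma stop_overshoot : exists K : R, 0 < K /\ forall t N u v, 0 <= t ->
  tosses 0 N u v ->
  T v (stop x t 0 N v) <= t + K * (`|walk v (stop x t 0 N v)|%:~R + 1).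
Proof.
have [K [K0 hK]] := position_growth; exists (K + K + K); split.
  by rewrite !addr_gt0.
move=> t N u v t0 [_ hv]; have [/andP[_ h1] h2 _] := stopP x t 0 N v.
move: h1 h2; case: (stop x t 0 N v) => [|n] h1 h2.
  by rewrite collision_time0 ler_wpDr // mulr_ge0 ?addr_ge0 ?ler0z // ltW.
rewrite collision_timeS walkS; apply: lerD; first by apply: h2; lia.
apply: le_trans (ler_normB _ _) _; apply: le_trans (lerD (hK _) (hK _)) _.
set a : R := `|walk v n + v n|%:~R.
have : `|walk v n|%:~R <= a + 1.
  rewrite /a -[1]/(1%:~R) -intrD ler_int -[X in `|X| <= _](addrK (v n)).
  apply: le_trans (ler_normB _ _) _; rewrite lerD2l.
  by case: (hv n) => [|->|->] //; lia.
have a0 : 0 <= a by rewrite ler0z.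
nra.
Qed.

(** As the supermartingale starts from 0, the potential at the stopping time is
    in mean at most the time multiplied by the weight. The potential is of order
    [|s| ^ (2 * k + 2)], the time is [t + O(|s|)] and the weight is
    [s ^ (2 * k)]: sites far beyond [sqrt t] contribute more to the potential
    than they are allowed. *)
Lemma stopped_moment (k : nat) : exists C : R, 0 <= C /\
  forall (t : R) N u, 1 <= t ->
  avg 0 N (fun v => `|walk v (stop x t 0 N v)|%:~R ^+ k.*2.+2) u <= C * t ^+ k.+1.
Proof.
have [c [D [c0 D0 hG]]] := potential_growth k.
have [K [K0 hK]] := stop_overshoot.
(* Beyond [L * sqrt t] the growth of the potential beats the time. *)
set L := 1 + 2 * (1 + 2 * K) / c.
have L1 : 1 <= L by rewrite lerDl divr_ge0 ?mulr_ge0 ?addr_ge0 ?mulr_ge0 // ltW.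
have Lc : 1 + 2 * K <= c / 2 * L.
  have -> : c / 2 * L = c / 2 + (1 + 2 * K) by rewrite /L; field; rewrite gt_eqF.
  by rewrite lerDr divr_ge0 // ltW.
have L0 : 0 <= L by exact: le_trans L1.
set C := (1 + K + K * L) * (L ^+ 2) ^+ k.
have C0 : 0 <= C.
  apply: mulr_ge0; last by rewrite exprn_ge0 ?sqr_ge0.
  by rewrite !addr_ge0 ?mulr_ge0 // ltW.
exists ((D + C) / (c / 2)); split.
  by rewrite divr_ge0 ?addr_ge0 ?divr_ge0 ?(ltW c0).
move=> t N u t1; have t0 : 0 <= t by lra.
rewrite mulrAC ler_pdivlMr ?divr_gt0 //.
rewrite mulrC -avgZ.
have tk1 : 1 <= t ^+ k.+1 by rewrite exprn_ege1.
apply: (@le_trans _ _ (avg 0 N (fun v =>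
   supmart k (walk v (stop x t 0 N v)) (T v (stop x t 0 N v)) + (D + C * t ^+ k.+1)) u)).
  apply: avg_le => v hv; set s := walk v _; have := hK t N u v t0 hv.
  rewrite -/s; set tau := T v _ => htau.
  rewrite /supmart weightE; have := hG s; set a : R := `|s|%:~R.
  have a0 : 0 <= a by rewrite ler0z.
  have ak : 0 <= a ^+ k.*2 by rewrite exprn_ge0.
  suff H : (t + K * (a + 1)) * a ^+ k.*2 <= c / 2 * a ^+ k.*2.+2 + C * t ^+ k.+1.
    have := ler_wpM2r ak htau; lra.
  have akE : a ^+ k.*2 = (a ^+ 2) ^+ k by rewrite -exprM -muln2 mulnC.
  have -> : a ^+ k.*2.+2 = a ^+ 2 * a ^+ k.*2 by rewrite -exprD.
  have LL : L <= L ^+ 2 by rewrite expr2 ler_peMr.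
  have LLt : L ^+ 2 <= L ^+ 2 * t by rewrite ler_peMr ?sqr_ge0.
  have Ltt : L ^+ 2 * t <= (L * t) ^+ 2.
    by rewrite exprMn [t ^+ 2]expr2 mulrA ler_peMr // mulr_ge0 ?sqr_ge0.
  have [big|small] := leP (L ^+ 2 * t) (a ^+ 2).
    apply: ler_wpDr; first by rewrite mulr_ge0 ?exprn_ge0.
    rewrite mulrA ler_wpM2r //.
    have aL : L <= a.
      by rewrite -(@ler_pXn2r _ 2) ?nnegrE // (le_trans LLt).
    have L_gt0 : 0 < L by exact: lt_le_trans L1.
    have h1 : t <= a ^+ 2 / L.
      by rewrite ler_pdivlMr // (le_trans _ big) // mulrC ler_wpM2r.
    apply: (@le_trans _ _ ((1 + 2 * K) * (a ^+ 2 / L))).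
      have h2 : 1 <= a ^+ 2 / L by lra.
      have h3 : a <= a ^+ 2 / L by rewrite ler_pdivlMr // expr2 ler_wpM2l.
      by have := ler_wpM2l (ltW K0) (lerD h3 h2); lra.
    rewrite mulrA ler_pdivrMr //.
    by have := ler_wpM2r (sqr_ge0 a) Lc; lra.
  apply: ler_wpDl; first by rewrite mulr_ge0 ?divr_ge0 ?(ltW c0) // mulr_ge0 ?sqr_ge0.
  have aLt : a <= L * t.
    by rewrite -(@ler_pXn2r _ 2) ?nnegrE ?mulr_ge0 // (le_trans (ltW small)).
  have -> : C * t ^+ k.+1 = ((1 + K + K * L) * t) * (L ^+ 2 * t) ^+ k.
    by rewrite /C [(_ * t) ^+ k]exprMn (exprS t); ring.
  rewrite akE; apply: ler_pM; rewrite ?exprn_ge0 ?sqr_ge0 //.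
  - by rewrite addr_ge0 ?mulr_ge0 ?addr_ge0 // ltW.
  - by have := ler_wpM2l (ltW K0) aLt; nra.
  - by rewrite lerXn2r ?nnegrE ?sqr_ge0 ?mulr_ge0 // ltW.
rewrite avgD avg_cst.
have e0 : supmart k 0 0 = 0.
  by rewrite /supmart mul0r subr0 /= /half_potential big_geq.
have := avg_stopped k t 0 N u; rewrite walk0 collision_time0 e0 => h.
have : D <= D * t ^+ k.+1 by rewrite ler_peMr.
lra.
Qed.

End moments.

(** * The particle position at a physical time *)

Section position.
Context {R : realType} (x : int -> R) (x_lt : forall s, x s < x (s + 1)).
Implicit Types (u v : nat -> int) (n N : nat) (s : int) (t : R).

Local Notation T := (collision_time x).

Lemma flight_index_eq v t n : T v n <= t < T v n.+1 -> flight_index x v t = n.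
Proof.
move=> /andP[h1 h2]; apply: xget_unique => [|m /andP[h3 h4]]; first by rewrite /= h1.
apply/eqP; rewrite eqn_leq; apply/andP; split; rewrite leqNgt; apply/negP => hlt.
  by have := le_lt_trans (le_trans (collision_time_le x v hlt) h3) h2; rewrite ltxx.
by have := le_lt_trans (le_trans (collision_time_le x v hlt) h1) h4; rewrite ltxx.
Qed.

Lemma stop_flight v t N : 0 <= t -> t < T v N -> exists n,
  [/\ (n < N)%N, stop x t 0 N v = n.+1 & T v n <= t < T v n.+1].
Proof.
move=> t0 tN; have [/andP[_ h1] h2 h3] := stopP x t 0 N v.
have h4 : t < T v (stop x t 0 N v).
  by move: h1; rewrite leq_eqVlt => /orP[/eqP ->//|]; exact: h3.
move: h1 h2 h4; case: (stop x t 0 N v) => [|n] h1 h2 h4.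
  by move: h4; rewrite collision_time0 ltNge t0.
by exists n; split => //; rewrite h4 h2 //=.
Qed.

(** A truncation of the position to a functional of the first [N] velocities, to
    which finite averages apply. *)
Definition drawn_position N t v : R :=
  if t < T v N then position x v t else 0.

Lemma prefix_drawn_position N t : 0 <= t -> prefix_fun N (drawn_position N t).
Proof.
move=> t0 u v huv; rewrite /drawn_position.
rewrite (@prefix_collision_time _ x N u v) //; case: ifPn => // tN.
have tN' := tN; rewrite -(@prefix_collision_time _ x N u v) // in tN'.
have [n [nN _ hn]] := stop_flight t0 tN.
have hu m : (m <= N)%N -> T u m = T v m.
  by move=> mN; apply: prefix_collision_time => i im; apply: huv; lia.
have hn' : T u n <= t < T u n.+1 by rewrite !hu // ltnW.
rewrite /position (flight_index_eq hn) (flight_index_eq hn') huv // hu; last by lia.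
by rewrite (@prefix_walk n u v) // => i im; apply: huv; lia.
Qed.

(** During a flight the particle stays between the two ends of the flight. *)
Lemma position_between v t n (c a : R) : v n = 1 \/ v n = -1 ->
  T v n <= t < T v n.+1 ->
  `|x (walk v n) - c| <= a -> `|x (walk v n.+1) - c| <= a ->
  `|position x v t - c| <= a.
Proof.
move=> vn ht; rewrite /position (flight_index_eq ht).
move: ht; rewrite collision_timeS walkS flightE // => /andP[h1 h2].
rewrite !ler_norml => /andP[h3 h4] /andP[h5 h6].
by move: h2 h5 h6; case: vn => ->; rewrite ?mulr1z ?mulrN1z => h2 h5 h6; apply/andP; split; lra.
Qed.

Context (mu : R) (mu_gt0 : 0 < mu)
  (x_lin : forall e : R, 0 < e -> exists C : R, 0 <= C /\
     forall s, `|x s - mu * s%:~R| <= e * `|s|%:~R + C).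

(** At time [t] the particle is within one flight of the site that the walk
    occupies at the first collision after [t]. *)
Lemma position_moment (k : nat) : exists C : R, 0 <= C /\
  forall t N u, 1 <= t ->
  avg 0 N (fun v => `|drawn_position N t v| ^+ k.*2.+2) u <= C * t ^+ k.+1.
Proof.
have [C [C0 hC]] := stopped_moment x_lt mu_gt0 x_lin k.
have [K [K0 hK]] := position_growth mu_gt0 x_lin.
pose P := k.*2.+2; have P0 : (P == 0)%N = false by [].
rewrite -/P in hC *; clearbody P.
set M := (3 * K) ^+ P; have M0 : 0 <= M by rewrite exprn_ge0 // mulr_ge0 // ltW.
exists (M * (C + 1)); split; first by rewrite mulr_ge0 // addr_ge0.
move=> t N u t1; have t0 : 0 <= t by exact: le_trans t1.
apply: (@le_trans _ _ (avg 0 N (fun v => M *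
    (`|walk v (stop x t 0 N v)|%:~R ^+ P + 1)) u)); last first.
  rewrite avgZ avgD avg_cst -mulrA ler_wpM2l // mulrDl mul1r lerD ?hC //.
  by rewrite exprn_ege1.
apply: avg_le => v [_ hv]; rewrite /drawn_position.
case: ifPn => tN; last first.
  by rewrite normr0 expr0n P0 mulr_ge0 // addr_ge0 // exprn_ge0 // ler0z.
have [n [nN -> hn]] := stop_flight t0 tN.
have vn : v n = 1 \/ v n = -1 by apply: hv.
set a : R := `|walk v n.+1|%:~R.
have a_int : a = 0 \/ 1 <= a.
  rewrite /a; case: (walk v n.+1) => [[|m]|m]; [by left|right|right].
    by rewrite -[1]/(1%:~R) ler_int.
  by rewrite -[1]/(1%:~R) ler_int.
have a0 : 0 <= a by rewrite ler0z.
have h : `|position x v t| <= K * (a + 2).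
  rewrite -[position _ _ _]subr0; apply: (@position_between v t n) => //; rewrite subr0.
    apply: le_trans (hK _) _; rewrite ler_wpM2l ?(ltW K0) //.
    have : `|walk v n|%:~R <= a + 1.
      rewrite /a -[1]/(1%:~R) -intrD ler_int walkS -[X in `|X| <= _](addrK (v n)).
      apply: le_trans (ler_normB _ _) _; rewrite lerD2l.
      by case: vn => ->.
    lra.
  apply: le_trans (hK _) _; rewrite ler_wpM2l ?(ltW K0) // -/a; lra.
apply: (@le_trans _ _ ((K * (a + 2)) ^+ P)).
  by rewrite lerXn2r ?nnegrE // mulr_ge0 ?addr_ge0 // ltW.
rewrite /M [3 * K]mulrC !exprMn -mulrA ler_wpM2l ?exprn_ge0 ?(ltW K0) //.
case: a_int => [->|a1].
  rewrite add0r expr0n P0 add0r mulr1 lerXn2r ?nnegrE //; lra.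
apply: (@le_trans _ _ ((3 * a) ^+ P)).
  rewrite lerXn2r ?nnegrE ?addr_ge0 ?mulr_ge0 //; lra.
by rewrite exprMn ler_wpM2l ?exprn_ge0 // lerDl.
Qed.

(** About [t / mu] collisions take place before time [t]; the number is taken
    even because the moments of the walk are computed at even times. *)
Definition steps t : nat := (2 * Num.truncn (t / (2 * mu)))%N.

Lemma steps_bounds t : 0 <= t -> t - 2 * mu < mu * (steps t)%:R <= t.
Proof.
move=> t0; have t20 : 0 <= t / (2 * mu) by rewrite divr_ge0 ?mulr_ge0 // ltW.
have := truncn_itv t20; rewrite /steps natrM -natr1.
set h := (Num.truncn _)%:R.
rewrite ler_pdivlMr ?mulr_gt0 // ltr_pdivrMr ?mulr_gt0 // => /andP[h1 h2].
apply/andP; split; lra.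
Qed.

(** Markov's inequality for the mean deviation in [collision_time_lln]. *)
Lemma collision_time_deviation (del eta : R) : 0 < del -> 0 < eta -> exists t1 : R, 0 < t1 /\
  forall t n u, t1 <= t -> mu * n%:R <= 2 * t ->
  avg 0 n (fun v => (del * t <= `|T v n - mu * n%:R|)%R%:R) u <= eta.
Proof.
move=> del0 eta0; set e := eta * del * mu / 4.
have e0 : 0 < e by rewrite divr_gt0 ?mulr_gt0.
have [C [C0 hC]] := collision_time_lln x_lt x_lin e0.
have C1 : 0 <= 2 * C / (eta * del) by rewrite divr_ge0 ?mulr_ge0 // ltW.
exists (1 + 2 * C / (eta * del)); split; first by rewrite ltr_pwDl.
move=> t n u tt1 nt; have t0 : 0 < t by apply: lt_le_trans tt1; rewrite ltr_pwDl.
have tC : 2 * C <= eta * del * t.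
  rewrite [leRHS]mulrC -ler_pdivrMr ?mulr_gt0 //.
  by apply: le_trans tt1; rewrite lerDr.
apply: le_trans (avg_markov 0 n u (mulr_gt0 del0 t0) _) _ => //.
rewrite ler_pdivrMr ?mulr_gt0 //; apply: le_trans (hC _ _) _.
have ed0 : 0 <= eta * del / 4 by rewrite divr_ge0 ?mulr_ge0 // ltW.
have -> : e * n%:R = eta * del / 4 * (mu * n%:R) by rewrite /e; ring.
have := ler_wpM2l ed0 nt; clear -tC; lra.
Qed.

(** The flight under way at time [t] has both ends among the sites visited from
    collision [m - h] to collision [m + h], which are all within [2 * a] of
    [walk v m]. *)
Lemma position_near (e C a t : R) m h N v : 0 < e -> e <= mu -> 0 <= a -> 0 <= t ->
  (forall s, `|x s - mu * s%:~R| <= e * `|s|%:~R + C) ->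
  (forall i, (i < N)%N -> v i = 1 \/ v i = -1) -> (h <= m)%N -> (m + h <= N)%N ->
  T v (m - h) <= t -> t < T v (m + h) ->
  ~~ leaves (walk v (m - h)) a (m - h) (2 * h) v ->
  `|drawn_position N t v - mu * (walk v m)%:~R| <=
  e * `|walk v m|%:~R + C + 4 * mu * a.
Proof.
move=> e0 e1 a0 t0 hC hv hm hmN mlo mhi stay.
have tN : t < T v N by apply: lt_le_trans mhi _; exact: collision_time_le.
have hi i : (m - h <= i <= m + h)%N -> `|(walk v i - walk v (m - h))%:~R| <= a.
  move=> hi; rewrite leNgt; apply/negP => hlt; move: stay; rewrite /leaves => /negP; apply.
  by apply/hasP; exists i; rewrite ?mem_iota //; clear -hi hm; lia.
have hx i : (m - h <= i <= m + h)%N -> `|x (walk v i) - mu * (walk v m)%:~R| <=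
    e * `|walk v m|%:~R + C + 4 * mu * a.
  move=> him; have := hi i him; have := hi m; rewrite leq_subr leq_addr => /(_ isT).
  rewrite !intrB; set si : R := (walk v i)%:~R; set sm : R := (walk v m)%:~R.
  set s0 : R := (walk v (m - h))%:~R => d1 d2.
  have dim : `|si - sm| <= 2 * a.
    have -> : si - sm = (si - s0) - (sm - s0) by ring.
    by apply: le_trans (ler_normB _ _) _; clear -d1 d2; lra.
  have := hC (walk v i); rewrite -/si => hy.
  have -> : x (walk v i) - mu * sm = (x (walk v i) - mu * si) + mu * (si - sm) by ring.
  apply: le_trans (ler_normD _ _) _; rewrite normrM (gtr0_norm mu_gt0) intr_norm.
  have si_le : `|walk v i|%:~R <= `|sm| + 2 * a.
    rewrite intr_norm -/si -[si](subrK sm) addrC.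
    by apply: le_trans (ler_normD _ _) _; rewrite lerD2l.
  have := ler_wpM2l (ltW e0) si_le; have := ler_wpM2l (ltW mu_gt0) dim.
  have : e * (2 * a) <= mu * (2 * a) by rewrite ler_wpM2r // mulr_ge0.
  by rewrite -/sm; clear -hy; lra.
rewrite /drawn_position tN.
have [n [nN _ hn]] := stop_flight t0 tN.
have [n1 n2] : (m - h <= n)%N /\ (n < m + h)%N.
  move: hn => /andP[hn1 hn2]; split.
    rewrite leqNgt; apply/negP => hlt.
    by have := lt_le_trans hn2 (le_trans (collision_time_le x v hlt) mlo); rewrite ltxx.
  rewrite ltnNge; apply/negP => hge.
  by have := lt_le_trans mhi (le_trans (collision_time_le x v hge) hn1); rewrite ltxx.
apply: (@position_between v t n) => //; first exact: hv.
  by apply: hx; rewrite n1 ltnW.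
by apply: hx; rewrite n2 leqW.
Qed.

(** With high probability the number of collisions before [t] differs from
    [steps t] by at most [h = d * t], by the law of large numbers for the
    collision times, and from [steps t - h] to [steps t + h] the walk moves by at
    most [a = al * sqrt t], by the maximal inequality. The environment is linear
    up to an error of [e] times the modulus of the walk, itself of order
    [sqrt t]. *)
Lemma position_close (ka eta : R) : 0 < ka -> 0 < eta -> exists t1 : R, 0 < t1 /\
  forall t N u, t1 <= t -> 2 * t / mu <= N%:R ->
  avg 0 N (fun v => (ka * Num.sqrt t <
     `|drawn_position N t v - mu * (walk v (steps t))%:~R|)%R%:R) u <= eta.
Proof.
move=> ka0 eta0; have mu0 := mu_gt0.
(* Four bad events get probability at most [eta / 4] each: a deviation [D] of the
   collision time at [m - h] or at [m + h], a displacement [L] by more than [a]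
   between these steps, and a large value [W] of the walk at [m]. Outside of
   them the distance is at most the sum of [ka * sqrt t / 2], by [W],
   [4 * mu * a = ka * sqrt t / 4], by [L], and [C <= ka * sqrt t / 4]. *)
set al := ka / (16 * mu); have al0 : 0 < al by rewrite divr_gt0 ?mulr_gt0.
set d := Num.min (eta * al ^+ 2 / 8) (2 * mu)^-1.
have d0 : 0 < d by rewrite lt_min divr_gt0 ?mulr_gt0 ?exprn_gt0 //= invr_gt0 mulr_gt0.
have d1 : d <= eta * al ^+ 2 / 8 by rewrite ge_min lexx.
have d2 : d <= (2 * mu)^-1 by rewrite ge_min lexx orbT.
set r := eta * mu * ka ^+ 2 / 16.
have r0 : 0 < r by rewrite divr_gt0 ?mulr_gt0 ?exprn_gt0.
set e := Num.min mu (Num.min 1 r).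
have e0 : 0 < e by rewrite !lt_min mu_gt0 ltr01.
have e1 : e <= mu by rewrite ge_min lexx.
have e2 : e ^+ 2 <= r.
  have e3 : e <= 1 by rewrite !ge_min lexx orbT.
  have e4 : e <= r by rewrite !ge_min lexx !orbT.
  by apply: le_trans e4; rewrite expr2 ler_piMl // ltW.
have [C [C0 hC]] := x_lin e0.
have [t2 [t20 ht2]] : exists t2 : R, 0 < t2 /\ forall t n u, t2 <= t -> mu * n%:R <= 2 * t ->
    avg 0 n (fun v => (mu * d / 4 * t <= `|T v n - mu * n%:R|)%R%:R) u <= eta / 4.
  by apply: collision_time_deviation; rewrite divr_gt0 ?mulr_gt0.
set t1 := 1 + 4 * mu + 5 / d + t2 + (4 * C / ka) ^+ 2.
have q1 : 0 <= 5 / d by rewrite divr_ge0 // ltW.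
have q3 : 0 <= (4 * C / ka) ^+ 2 by exact: sqr_ge0.
exists t1; split; first by rewrite /t1; lra.
move=> t N u; rewrite /t1 => tt1 tN.
have t0 : 0 < t by lra.
have td : 5 <= d * t by rewrite mulrC -ler_pdivrMr //; lra.
set rt := Num.sqrt t; have rt0 : 0 < rt by rewrite sqrtr_gt0.
have rt2 : rt ^+ 2 = t by rewrite sqr_sqrtr // ltW.
have tC : 4 * C <= ka * rt.
  rewrite [leRHS]mulrC -ler_pdivrMr //.
  rewrite -(@ler_pXn2r _ 2) ?nnegrE ?(ltW rt0) ?divr_ge0 ?mulr_ge0 // ?(ltW ka0) //.
  rewrite rt2; lra.
set m := steps t; have /andP[m1 m2] := steps_bounds (ltW t0); rewrite -/m in m1 m2.
set h := Num.truncn (d * t).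
have /andP[h1 h2] := truncn_itv (ltW (lt_le_trans (ltr0Sn R 4) td)).
rewrite -/h -natr1 in h1 h2.
have hm : (h <= m)%N.
  rewrite -(ler_nat R) -(ler_pM2l mu_gt0); apply: le_trans (ltW m1).
  apply: (@le_trans _ _ (mu * (d * t))); first by rewrite ler_pM2l.
  apply: (@le_trans _ _ (t / 2)); last by lra.
  have md : mu * d <= 2^-1.
    apply: le_trans (ler_wpM2l (ltW mu_gt0) d2) _.
    by rewrite invfM mulrCA divff ?gt_eqF // mulr1.
  by have := ler_wpM2r (ltW t0) md; lra.
have hmN : (m + h <= N)%N.
  rewrite -(ler_nat R); apply: le_trans tN; rewrite ler_pdivlMr // natrD mulrDl.
  have : mu * h%:R <= mu * m%:R by rewrite ler_pM2l // ler_nat.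
  lra.
pose D n v : bool := mu * d / 4 * t <= `|T v n - mu * n%:R|.
have PD n : (n <= m + h)%N -> avg 0 N (fun v => (D n v)%:R) u <= eta / 4.
  move=> nmh; have nN := leq_trans nmh hmN.
  rewrite (avg_widen _ nN); last first.
    by move=> v w hvw; rewrite /D (@prefix_collision_time _ x n v w).
  apply: ht2; first by lra.
  have : mu * n%:R <= mu * (m + h)%N%:R by rewrite ler_pM2l // ler_nat.
  have : mu * h%:R <= mu * m%:R by rewrite ler_pM2l // ler_nat.
  by rewrite natrD; clear -m2; lra.
set a := al * rt; have a0 : 0 < a by rewrite mulr_gt0.
pose L v : bool := leaves (walk v (m - h)) a (m - h) (2 * h) v.
have PL : avg 0 N (fun v => (L v)%:R) u <= eta / 4.
  have mhE : (m - h + 2 * h)%N = (m + h)%N by clear -hm; lia.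
  rewrite (avg_widen _ hmN); last first.
    by move=> v w hvw; rewrite /L (@prefix_leaves _ a _ _ v w) // mhE.
  rewrite -mhE; apply: le_trans (avg_leaves_walk _ _ _ a0) _.
  rewrite ler_pdivrMr ?exprn_gt0 //.
  rewrite /a exprMn rt2 natrM.
  have : d * t <= eta * al ^+ 2 / 8 * t by rewrite ler_wpM2r // ltW.
  lra.
pose W v : bool := (ka * rt / (2 * e)) ^+ 2 <= (walk v m)%:~R ^+ 2.
have PW : avg 0 N (fun v => (W v)%:R) u <= eta / 4.
  rewrite (@avg_widen _ m); first last.
  - by move=> v w hvw; rewrite /W (@prefix_walk m v w).
  - exact: leq_trans (leq_addr _ _) hmN.
  have w0 : 0 < (ka * rt / (2 * e)) ^+ 2 by rewrite exprn_gt0 // divr_gt0 ?mulr_gt0.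
  apply: le_trans (avg_markov 0 m u w0 _) _; first by move=> v; exact: sqr_ge0.
  rewrite walk_sqr ler_pdivrMr // expr_div_n !exprMn rt2 mulrA.
  rewrite ler_pdivlMr ?mulr_gt0 ?exprn_gt0 //.
  have : m%:R * (2 ^+ 2 * e ^+ 2) <= m%:R * (2 ^+ 2 * r).
    by rewrite ler_wpM2l // ler_wpM2l // exprn_ge0.
  have -> : m%:R * (2 ^+ 2 * r) = mu * m%:R * (eta / 4 * ka ^+ 2) by rewrite /r; field.
  have : mu * m%:R * (eta / 4 * ka ^+ 2) <= t * (eta / 4 * ka ^+ 2).
    by rewrite ler_wpM2r // mulr_ge0 ?sqr_ge0 // divr_ge0 // ltW.
  lra.
apply: (@le_trans _ _ (avg 0 N (fun v => (D (m - h)%N v)%:R + (D (m + h)%N v)%:R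
    + ((L v)%:R + (W v)%:R)) u)); last first.
  have := PD (m - h)%N; have := PD (m + h)%N; rewrite !avgD.
  by move=> /(_ (leqnn _)) p1 /(_ (leq_trans (leq_subr _ _) (leq_addr _ _))) p2; lra.
apply: avg_le => v [_ hv].
have [//|b1] := boolP (D (m - h)%N v); first by case: (_ < _); rewrite ?ler_wpDr ?addr_ge0.
have [//|b2] := boolP (D (m + h)%N v); first by case: (_ < _); rewrite ?addr_ge0 // add0r ler_wpDr ?addr_ge0.
have [//|b3] := boolP (L v); first by case: (_ < _); rewrite ?addr_ge0 // !add0r ler_wpDr.
have [//|b4] := boolP (W v); first by case: (_ < _); rewrite ?addr_ge0 // !add0r.
rewrite !addr0 (_ : (_ < _) = false) //; apply/negbTE; rewrite -leNgt.
have muh : mu * (d * t - 1) <= mu * h%:R.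
  by rewrite ler_pM2l // lerBlDr ltW.
have mudt : mu * 5 <= mu * (d * t) by rewrite ler_pM2l.
have mlo : T v (m - h) <= t.
  rewrite leNgt; apply/negP => hlt; move: b1; rewrite /D -ltNge ltr_norml => /andP[_].
  by rewrite natrB //; clear -hlt m2 muh mudt mu0; lra.
have mhi : t < T v (m + h).
  rewrite ltNge; apply/negP => hlt; move: b2; rewrite /D -ltNge ltr_norml => /andP[+ _].
  by rewrite natrD; clear -hlt m1 muh mudt mu0; lra.
apply: le_trans (position_near e0 e1 (ltW a0) (ltW t0) hC hv hm hmN mlo mhi b3) _.
have -> : 4 * mu * a = ka * rt / 4 by rewrite /a /al; field; rewrite gt_eqF.
have sm_le : e * `|walk v m|%:~R <= ka * rt / 2.
  have kr0 : 0 <= ka * rt / (2 * e) by rewrite divr_ge0 ?mulr_ge0 // ltW.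
  have : `|walk v m|%:~R <= ka * rt / (2 * e).
    rewrite intr_norm -(@ler_pXn2r _ 2) ?nnegrE // real_normK ?num_real // ltW //.
    by move: b4; rewrite /W -ltNge.
  by rewrite ler_pdivlMr ?mulr_gt0 //; clear; lra.
by clear -tC sm_le; lra.
Qed.

End position.

(** * Comparison of the moments *)

(** Large values are absorbed by the higher power [p], and on bounded values the
    power function is uniformly continuous. Taking means, two random variables
    that are close in probability and bounded in the moment of order [p] have
    close moments of order [q]. *)
Lemma powR_close {R : realType} (q d : R) (p : nat) :
  0 < q -> q < p%:R -> 0 < d -> exists ka K : R, [/\ 0 < ka, 0 <= K &
  forall a b, 0 <= a -> 0 <= b ->
    `|a `^ q - b `^ q| <= d * (1 + a ^+ p + b ^+ p) + K * (ka < `|a - b|)%R%:R].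
Proof.
move=> q0 qp d0; have pq : 0 < p%:R - q by rewrite subr_gt0.
(* Above [M] the [q]-th power is at most [d] times the [p]-th one. *)
set M := Num.max 1 (d^-1 `^ (p%:R - q)^-1).
have M1 : 1 <= M by rewrite le_max lexx.
have M0 : 0 < M by exact: lt_le_trans M1.
have big a : M <= a -> a `^ q <= d * a ^+ p.
  move=> Ma; have a0 : 0 < a by exact: lt_le_trans Ma.
  rewrite -powR_mulrn ?(ltW a0) // -[p%:R](subrK q) powRD; last first.
    by rewrite (gt_eqF a0) implybT.
  rewrite mulrA ler_peMl ?powR_ge0 //.
  have : (d^-1 `^ (p%:R - q)^-1) `^ (p%:R - q) <= a `^ (p%:R - q).
    apply: ge0_ler_powR; rewrite ?nnegrE ?powR_ge0 ?(ltW a0) ?(ltW pq) //.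
    by apply: le_trans Ma; rewrite le_max lexx orbT.
  rewrite -powRrM mulVf ?gt_eqF // powRr1 ?invr_ge0 ?(ltW d0) //.
  by rewrite -[_^-1]mul1r ler_pdivrMr // mulrC.
have Mq0 : 0 < M `^ q by exact: powR_gt0.
(* If [b <= a <= M] and the [q]-th powers differ by more than [d], then
   [b <= th `^ q^-1 * a] and [d `^ q^-1 < a]; this is the origin of [ka]. *)
set th := M `^ q / (M `^ q + d).
have th0 : 0 < th by rewrite divr_gt0 ?addr_gt0.
have th1 : th < 1 by rewrite ltr_pdivrMr ?addr_gt0 // mul1r ltrDl.
have q'0 : 0 < q^-1 by rewrite invr_gt0.
set ka := (1 - th `^ q^-1) * d `^ q^-1.
have thq : th `^ q^-1 < 1.
  have e1 : 1 `^ q^-1 = 1 :> R by rewrite powR1.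
  by rewrite -[ltRHS]e1 gt0_ltr_powR // nnegrE ltW.
have ka0 : 0 < ka by rewrite mulr_gt0 ?powR_gt0 // subr_gt0.
exists ka, (M `^ q); split; [by []|exact: ltW|].
have root z : 0 <= z -> (z `^ q) `^ q^-1 = z.
  by move=> z0; rewrite -powRrM divff ?gt_eqF // powRr1.
move=> a b; wlog ba : a b / b <= a => [H a0 b0|a0 b0].
  have [ab|ab] := leP b a; first exact: H.
  by rewrite distrC (distrC a) -addrA (addrC (a ^+ p)) addrA; apply: H => //; exact: ltW.
have bqaq : b `^ q <= a `^ q by rewrite ge0_ler_powR ?nnegrE // ltW.
have ap0 : 0 <= a ^+ p by rewrite exprn_ge0.
have bp0 : 0 <= b ^+ p by rewrite exprn_ge0.
have bq0 : 0 <= b `^ q by exact: powR_ge0.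
rewrite ger0_norm ?subr_ge0 //.
have [Ma|aM] := leP M a.
  apply: (@le_trans _ _ (d * a ^+ p)).
    by apply: le_trans (big _ Ma); rewrite gerBl.
  apply: ler_wpDr; first by rewrite mulr_ge0 // ltW.
  by rewrite ler_wpM2l ?(ltW d0) //; lra.
have aqM : a `^ q <= M `^ q by rewrite ge0_ler_powR ?nnegrE ?(ltW M0) // ltW.
have [le_d|gt_d] := leP (a `^ q - b `^ q) d.
  apply: le_trans le_d _; apply: ler_wpDr; first by rewrite mulr_ge0 // ltW.
  by rewrite ler_peMr ?(ltW d0) //; lra.
have -> : (ka < `|a - b|) = true.
  rewrite ger0_norm ?subr_ge0 //.
  have h1 : b <= th `^ q^-1 * a.
    have hq : b `^ q <= th * a `^ q.
      rewrite /th mulrAC ler_pdivlMr ?addr_gt0 //.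
      have h : (a `^ q - d) * (M `^ q + d) <= M `^ q * a `^ q.
        have := ler_wpM2l (ltW d0) aqM; have := mulr_ge0 (ltW d0) (ltW d0); lra.
      apply: le_trans h; rewrite ler_wpM2r ?addr_ge0 ?(ltW Mq0) ?(ltW d0) //; lra.
    rewrite -{1}(root _ b0) -{1}(root _ a0) -powRM ?powR_ge0 ?(ltW th0) //.
    have tha : 0 <= th * a `^ q by exact: mulr_ge0 (ltW th0) (powR_ge0 _ _).
    by rewrite ge0_ler_powR ?nnegrE ?(ltW q'0).
  have h2 : d `^ q^-1 < a.
    rewrite -(root _ a0); apply: gt0_ltr_powR; rewrite ?nnegrE ?powR_ge0 ?(ltW d0) //.
lra.
  have : ka < (1 - th `^ q^-1) * a by rewrite ltr_pM2l ?subr_gt0.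
  lra.
rewrite mulr1; apply: (@le_trans _ _ (a `^ q)); first by rewrite gerBl.
apply: ler_wpDl => //; rewrite mulr_ge0 ?(ltW d0) //; lra.
Qed.

(** In the environment [x s = s] the [n]-th collision takes place at time [n], so
    that stopping at the first collision after [n], within [n] steps, is stopping
    after [n] steps. *)
Lemma walk_moment_bound {R : realType} (k : nat) : exists C : R, 0 <= C /\
  forall n u, (0 < n)%N ->
  avg 0 n (fun v => `|walk v n|%:~R ^+ k.*2.+2) u <= C * n%:R ^+ k.+1.
Proof.
pose x (s : int) : R := s%:~R.
have x_lt s : x s < x (s + 1) by rewrite /x ltr_int ltrDl.
have [|C [C0 hC]] := @stopped_moment R x 1 x_lt ltr01 _ k.
  move=> e e0; exists 0; split => // s.
  by rewrite mul1r subrr normr0 addr0 mulr_ge0 ?(ltW e0) // ler0z.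
exists C; split => // n u n0; apply: le_trans (hC n%:R n u _); last by rewrite ler1n.
apply: avg_le => v [_ hv].
suff -> : stop x n%:R 0 n v = n by [].
have [/andP[_ h1] _ h3] := stopP x n%:R 0 n v.
have Tn m : (m <= n)%N -> collision_time x v m = m%:R.
  elim: m => [|m IH] mn; first by rewrite collision_time0.
  rewrite collision_timeS IH ?(ltnW mn) // -natr1 /x intrD addrAC subrr add0r.
  by case: (hv m) => [|->|->] //; rewrite ?normrN normr1.
apply/eqP; rewrite eqn_leq h1 leqNgt; apply/negP => hlt.
have := h3 hlt; rewrite Tn // ltr_nat => hgt.
by have := ltn_trans hlt hgt; rewrite ltnn.
Qed.

Section moment_comparison.
Context {R : realType} (x : int -> R) (x_lt : forall s, x s < x (s + 1)).
Context (mu : R) (mu_gt0 : 0 < mu)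
  (x_lin : forall e : R, 0 < e -> exists C : R, 0 <= C /\
     forall s, `|x s - mu * s%:~R| <= e * `|s|%:~R + C).

(** [powR_close] is applied to the position and to [mu * walk v (steps mu t)],
    both divided by [sqrt t]: their moments of order [p] are bounded, and they
    are close in probability. *)
Lemma moment_close (q eta : R) : 0 < q -> 0 < eta -> exists t1 : R, 0 < t1 /\
  forall t N u, t1 <= t -> 2 * t / mu <= N%:R ->
  avg 0 N (fun v => `| `|drawn_position x N t v| `^ q
     - `|mu * (walk v (steps mu t))%:~R| `^ q |) u <= eta * t `^ (q / 2).
Proof.
move=> q0 eta0; set k := Num.truncn q.
have [C1 [C10 hC1]] := position_moment x_lt mu_gt0 x_lin k.
have [C2 [C20 hC2]] := walk_moment_bound (R := R) k.
have qp : q < k.*2.+2%:R.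
  by apply: lt_le_trans (truncnS_gt _) _; rewrite ler_nat -/k; lia.
pose p := k.*2.+2; have pE : p = (2 * k.+1)%N by rewrite /p; lia.
rewrite -/p in hC1 hC2 qp; clearbody p.
(* [B] bounds the factor of [d] in the mean of [powR_close]. *)
set B := 1 + C1 + mu ^+ k.+1 * C2.
have B0 : 0 < B by rewrite /B -addrA ltr_pwDl // addr_ge0 // mulr_ge0 // exprn_ge0 // ltW.
have [ka [K [ka0 K0 hK]]] := powR_close q0 qp (divr_gt0 eta0 (mulr_gt0 (ltr0Sn R 1) B0)).
have K10 : 0 < 2 * (K + 1) by rewrite mulr_gt0 // ltr_wpDl.
have [t1 [t10 ht1]] := position_close x_lt mu_gt0 x_lin ka0 (divr_gt0 eta0 K10).
exists (t1 + 1 + 4 * mu); split; first by rewrite !addr_gt0 // mulr_gt0.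
move=> t N u tt1 tN; have mu0 := mu_gt0; have t0 : 0 < t by lra.
have t1' : 1 <= t by lra.
set m := steps mu t; have /andP[m1 m2] := steps_bounds mu_gt0 (ltW t0).
rewrite -/m in m1 m2.
have m0 : (0 < m)%N.
  by rewrite -(ltr_nat R) -(ltr_pM2l mu_gt0) mulr0; apply: lt_trans m1; lra.
have mN : (m <= N)%N.
  by rewrite -(ler_nat R); apply: le_trans tN; rewrite ler_pdivlMr //; lra.
set rt := Num.sqrt t; have rt0 : 0 < rt by rewrite sqrtr_gt0.
have rt2 : rt ^+ 2 = t by rewrite sqr_sqrtr // ltW.
have rtp : rt ^+ p = t ^+ k.+1 by rewrite pE exprM rt2.
have rtq : rt `^ q = t `^ (q / 2).
  by rewrite /rt -powR12_sqrt ?(ltW t0) // -powRrM mulrC.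
set tk := t ^+ k.+1 in rtp; have tk0 : 0 < tk by rewrite exprn_gt0.
set d := eta / (2 * B) in hK; have d0 : 0 < d by rewrite divr_gt0 ?mulr_gt0.
set X := fun v => drawn_position x N t v.
set Y := fun v : nat -> int => mu * (walk v m)%:~R : R.
apply: (@le_trans _ _ (avg 0 N (fun v => t `^ (q / 2) *
   (d * (1 + (tk^-1 * `|X v| ^+ p + tk^-1 * mu ^+ p * `|walk v m|%:~R ^+ p)) +
    K * (ka * Num.sqrt t < `|X v - Y v|)%R%:R)) u)).
  apply: avg_le => v _; rewrite -/(X v) -/(Y v).
  have scale (z : R) : `|z| `^ q = t `^ (q / 2) * (`|z| / rt) `^ q.
    by rewrite -rtq -powRM ?(ltW rt0) ?divr_ge0 ?(ltW rt0) // mulrC divfK ?gt_eqF.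
  rewrite (scale (X v)) (scale (Y v)) -mulrBr normrM ger0_norm ?powR_ge0 //.
  rewrite ler_wpM2l ?powR_ge0 //.
  apply: le_trans (hK _ _ (divr_ge0 _ (ltW rt0)) (divr_ge0 _ (ltW rt0))) _ => //.
  apply: lerD.
    rewrite ler_wpM2l ?(ltW d0) // -addrA lerD2l !expr_div_n rtp.
    rewrite /Y normrM gtr0_norm // exprMn -intr_norm.
    by rewrite mulrC [X in _ + X]mulrC mulrA.
  rewrite ler_wpM2l // -mulrBl normrM [`|rt^-1|]ger0_norm ?invr_ge0 ?(ltW rt0) //.
  rewrite ltr_pdivlMr // -/rt.
  case: ltP => [h|//]; rewrite (lt_le_trans h) //; exact: ler_dist_dist.
rewrite avgZ mulrC ler_wpM2r ?powR_ge0 //.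
rewrite avgD !avgZ avgD avg_cst avgD !avgZ.
have h1 : tk^-1 * avg 0 N (fun v => `|X v| ^+ p) u <= C1.
  by rewrite mulrC ler_pdivrMr // hC1.
have h2 : tk^-1 * mu ^+ p * avg 0 N (fun v => `|walk v m|%:~R ^+ p) u <= mu ^+ k.+1 * C2.
  rewrite (avg_widen _ mN); last by move=> v w hvw; rewrite (@prefix_walk m v w).
  rewrite -mulrA ler_pdivrMl //.
  apply: le_trans (ler_wpM2l _ (hC2 _ _ m0)) _; first by rewrite exprn_ge0 // ltW.
  have -> : mu ^+ p * (C2 * m%:R ^+ k.+1) = mu ^+ k.+1 * C2 * (mu * m%:R) ^+ k.+1.
    by rewrite pE mulnC exprM expr2 [(_ * m%:R) ^+ _]exprMn; ring.
  rewrite mulrC ler_wpM2r ?mulr_ge0 ?exprn_ge0 ?(ltW mu_gt0) //.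
  by rewrite /tk lerXn2r ?nnegrE ?mulr_ge0 ?(ltW mu_gt0) ?(ltW t0).
have h3 : K * avg 0 N (fun v => (ka * Num.sqrt t < `|X v - Y v|)%R%:R) u <= eta / 2.
  apply: (@le_trans _ _ (K * (eta / (2 * (K + 1))))).
    rewrite ler_wpM2l //; apply: ht1 => //; have := mu_gt0; lra.
  rewrite mulrA ler_pdivrMr // ; have := mulr_ge0 K0 (ltW eta0); lra.
have h4 : d * (1 + (C1 + mu ^+ k.+1 * C2)) = eta / 2.
  by rewrite addrA -/B /d; field; rewrite gt_eqF.
have := ler_wpM2l (ltW d0) (lerD h1 h2); lra.
Qed.

End moment_comparison.

(** * Moments of the simple random walk *)

Section binomial.
Context {R : realType}.
Implicit Types (n k : nat) (g : int -> R).

(** By Pascal's rule; a walk of [n] steps, [i] of them to the right, ends at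
    [2 * i - n]. *)
Lemma avg_binomial n g u : 2 ^+ n * avg 0 n (fun v => g (walk v n)) u =
  \sum_(0 <= i < n.+1) 'C(n, i)%:R * g ((2 * i)%N%:Z - n%:Z).
Proof.
elim: n g => [|n IH] g.
  by rewrite /= walk0 big_nat1 bin0.
rewrite avg_last.
rewrite (@eq_avg _ _ _ _ (fun v => 2^-1 * (fun s => g (s + 1) + g (s - 1)) (walk v n))); last first.
  by move=> v _; rewrite !walk_updS mulrC.
rewrite avgZ exprSr mulrA -(mulrA (2 ^+ n)) divff // mulr1 (IH (fun s => g (s + 1) + g (s - 1))).
under eq_bigr do rewrite mulrDr.
rewrite big_split /= [in RHS]big_nat_recl // [X in _ + X]big_nat_recl //.
rewrite big_nat_recr //= [in RHS]big_nat_recr //= !binn !bin0 !mul1r.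
under [X in _ = _ + (X + _)]eq_bigr do rewrite binS natrD mulrDl.
rewrite [in RHS]big_split /=.
have e1 : (2 * n)%N%:Z - n%:Z + 1 = (2 * n.+1)%N%:Z - n.+1%:Z by lia.
have e2 : (2 * 0)%N%:Z - n%:Z - 1 = (2 * 0)%N%:Z - n.+1%:Z by lia.
rewrite e1 e2.
have e3 : \sum_(0 <= i < n) 'C(n, i)%:R * g ((2 * i)%N%:Z - n%:Z + 1) =
   \sum_(0 <= i < n) 'C(n, i)%:R * g ((2 * i.+1)%N%:Z - n.+1%:Z).
  by apply: eq_bigr => i _; congr (_ * g _); lia.
have e4 : \sum_(0 <= i < n) 'C(n, i.+1)%:R * g ((2 * i.+1)%N%:Z - n%:Z - 1) =
   \sum_(0 <= i < n) 'C(n, i.+1)%:R * g ((2 * i.+1)%N%:Z - n.+1%:Z).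
  by apply: eq_bigr => i _; congr (_ * g _); lia.
by rewrite e3 e4; ring.
Qed.

(** The probability that the walk is at [2 * k] at time [2 * n], relative to
    that of a return to the origin. *)
Definition rel_weight n k : R := 'C(n.*2, n + k)%:R / 'C(n.*2, n)%:R.

Lemma central_bin_gt0 n : 0 < 'C(n.*2, n)%:R :> R.
Proof. by rewrite ltr0n bin_gt0 -addnn leq_addr. Qed.

Lemma rel_weight0 n : rel_weight n 0 = 1.
Proof. by rewrite /rel_weight addn0 divff // gt_eqF // central_bin_gt0. Qed.

Lemma rel_weight_ge0 n k : 0 <= rel_weight n k.
Proof. by rewrite divr_ge0. Qed.

Lemma rel_weightS n k : (k <= n)%N ->
  rel_weight n k.+1 * (n + k.+1)%:R = rel_weight n k * (n - k)%:R.
Proof.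
move=> kn; rewrite /rel_weight addnS mulrAC [RHS]mulrAC -!natrM.
by congr (_%:R / _); rewrite mulnC mul_bin_left mulnC; congr (_ * _)%N; lia.
Qed.

Lemma rel_weight_eq0 n k : (n < k)%N -> rel_weight n k = 0.
Proof. by move=> nk; rewrite /rel_weight bin_small ?mul0r // -addnn ltn_add2l. Qed.

Lemma even_binomial_sum n (g : nat -> R) :
  \sum_(0 <= i < n.*2.+1) 'C(n.*2, i)%:R * g `|(2 * i)%N%:Z - n.*2%:Z|%N =
  'C(n.*2, n)%:R * (g 0 + 2 * \sum_(1 <= k < n.+1) rel_weight n k * g (2 * k)%N).
Proof.
have c0 := central_bin_gt0 n.
have E k : 'C(n.*2, n)%:R * (rel_weight n k * g (2 * k)%N) = 'C(n.*2, n + k)%:R * g (2 * k)%N.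
  by rewrite /rel_weight mulrA mulrCA divff ?gt_eqF // mulr1.
rewrite mulrDr mulrCA big_distrr /=.
under [X in _ = _ + 2 * X]eq_bigr do rewrite E.
rewrite (@big_cat_nat _ _ _ n) //=; last by lia.
rewrite big_nat_rev /= add0n.
rewrite (@big_cat_nat _ _ _ n.+1 n n.*2.+1) //=; last by lia.
rewrite big_nat1.
have -> : `|(2 * n)%N%:Z - n.*2%:Z|%N = 0%N by lia.
have -> : \sum_(0 <= i < n) 'C(n.*2, n - i.+1)%:R
      * g `|(2 * (n - i.+1))%N%:Z - n.*2%:Z|%N =
    \sum_(1 <= k < n.+1) 'C(n.*2, n + k)%:R * g (2 * k)%N.
  rewrite big_add1 /=; apply: eq_big_nat => i /andP[_ i_n].
  congr (_%:R * g _); last by lia.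
  by rewrite -bin_sub; [congr 'C(_, _); lia|lia].
have -> : \sum_(n.+1 <= i < n.*2.+1) 'C(n.*2, i)%:R * g `|(2 * i)%N%:Z - n.*2%:Z|%N =
    \sum_(1 <= k < n.+1) 'C(n.*2, n + k)%:R * g (2 * k)%N.
  rewrite -[n.+1 in LHS]add1n -[n.*2.+1](_ : n.+1 + n = _)%N; last by lia.
  rewrite big_addn addnK; apply: eq_bigr => i _.
  by rewrite addnC; congr (_ * g _); lia.
ring.
Qed.

(** The total mass of the relative weights, in the denominator, is a sum of the
    same kind as the numerator, so that one limit theorem for Riemann sums covers
    both. *)
Lemma avg_even_walk n (g : nat -> R) u :
  avg 0 n.*2 (fun v => g `|walk v n.*2|%N) u =
  (g 0 + 2 * \sum_(1 <= k < n.+1) rel_weight n k * g (2 * k)%N) /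
  (1 + 2 * \sum_(1 <= k < n.+1) rel_weight n k).
Proof.
have c0 := central_bin_gt0 n.
have p0 : 0 < 2 ^+ n.*2 :> R by rewrite exprn_gt0.
have := avg_binomial n.*2 (fun s => g `|s|%N) u; rewrite even_binomial_sum => h.
have := avg_binomial n.*2 (fun=> 1) u; rewrite avg_cst mulr1.
rewrite (even_binomial_sum n (fun=> 1)).
under eq_bigr do rewrite mulr1.
set S := \sum_(_ <= _ < _) _; set S' := \sum_(_ <= _ < _) _ in h * => h1.
have w0 : 0 < 1 + 2 * S.
  by rewrite ltr_pwDl // mulr_ge0 // sumr_ge0 // => i _; exact: rel_weight_ge0.
apply: (mulfI (lt0r_neq0 p0)); rewrite h h1 -mulrA; congr (_ * _).
by rewrite mulrCA divff ?gt_eqF // mulr1.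
Qed.

(** The ratio of consecutive weights is
    [(n - k) / (n + k + 1) = 1 - (2 * k + 1) / (n + k + 1)], at most the
    exponential of [- (2 * k + 1) / (n + m)], and the numbers [2 * k + 1] add up
    to a square. *)
Lemma rel_weight_le n k m : (k <= m)%N -> (m <= n)%N -> (0 < n)%N ->
  rel_weight n k <= expR (- (k%:R ^+ 2 / (n + m)%:R)).
Proof.
move=> + mn n0; elim: k => [|k IH] km.
  by rewrite rel_weight0 expr0n /= mul0r oppr0 expR0.
have nk0 : 0 < (n + k.+1)%:R :> R by rewrite ltr0n; lia.
have -> : rel_weight n k.+1 = rel_weight n k * ((n - k)%:R / (n + k.+1)%:R).
  rewrite mulrA -rel_weightS; last by lia.
  by rewrite mulfK // gt_eqF.
have nm0 : 0 < (n + m)%:R :> R by rewrite ltr0n; lia.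
set N := (n + m)%:R in nm0 IH *.
have -> : - (k.+1%:R ^+ 2 / N) =
   - (k%:R ^+ 2 / N) + - ((2 * k).+1%:R / N) :> R.
  rewrite -opprD -mulrDl; congr (- (_ / _)).
  by rewrite -!natrX -natrD; congr _%:R; lia.
rewrite expRD; apply: ler_pM; rewrite ?rel_weight_ge0 ?divr_ge0 //.
  by apply: IH; lia.
apply: (@le_trans _ _ (1 + - ((2 * k).+1%:R / N))); last exact: expR_ge1Dx.
have -> : (n - k)%:R / (n + k.+1)%:R = 1 - (2 * k).+1%:R / (n + k.+1)%:R :> R.
  apply: (mulIf (lt0r_neq0 nk0)); rewrite mulrBl mul1r !divfK ?gt_eqF //.
  by rewrite -natrB; [congr _%:R; lia|lia].
rewrite lerD2l lerN2 ler_wpM2l // lef_pV2 ?posrE // ler_nat; lia.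
Qed.

(** As for [rel_weight_le], with the inverse ratios
    [1 + (2 * k + 1) / (n - k)]. *)
Lemma rel_weight_ge n k m : (k <= m)%N -> (m < n)%N ->
  expR (- (k%:R ^+ 2 / (n - m)%:R)) <= rel_weight n k.
Proof.
move=> + mn; elim: k => [|k IH] km.
  by rewrite rel_weight0 expr0n /= mul0r oppr0 expR0.
have nk0 : 0 < (n + k.+1)%:R :> R by rewrite ltr0n; lia.
have -> : rel_weight n k.+1 = rel_weight n k * ((n - k)%:R / (n + k.+1)%:R).
  rewrite mulrA -rel_weightS; last by lia.
  by rewrite mulfK // gt_eqF.
have nm0 : 0 < (n - m)%:R :> R by rewrite ltr0n; lia.
set N := (n - m)%:R in nm0 IH *.
have -> : - (k.+1%:R ^+ 2 / N) =
   - (k%:R ^+ 2 / N) + - ((2 * k).+1%:R / N) :> R.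
  rewrite -opprD -mulrDl; congr (- (_ / _)).
  by rewrite -!natrX -natrD; congr _%:R; lia.
rewrite expRD; apply: ler_pM; rewrite ?expR_ge0 //.
  by apply: IH; lia.
have nk1 : 0 < (n - k)%:R :> R by rewrite ltr0n; lia.
rewrite expRN -[leRHS]invf_div lef_pV2 ?posrE ?expR_gt0 ?divr_gt0 //.
apply: (@le_trans _ _ (1 + (2 * k).+1%:R / N)); last exact: expR_ge1Dx.
have -> : (n + k.+1)%:R / (n - k)%:R = 1 + (2 * k).+1%:R / (n - k)%:R :> R.
  apply: (mulIf (lt0r_neq0 nk1)); rewrite mulrDl mul1r !divfK ?gt_eqF //.
  by rewrite -natrD; congr _%:R; lia.
by rewrite lerD2l ler_wpM2l // lef_pV2 ?posrE // ler_nat; lia.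
Qed.

End binomial.

Section riemann_sum.
Context {R : realType}.
Local Notation mu := (@lebesgue_measure R).

Definition gauss_power (q x : R) : R := x `^ q * expR (- x ^+ 2).

(** The moment of the relative weights is the integral of a step function that
    takes the value [cell q n j] on the interval of abscissas
    [j / sqrt n <= x < (j + 1) / sqrt n]. *)
Definition cell (q : R) (n j : nat) : R :=
  (j.+1%:R / Num.sqrt n%:R) `^ q * rel_weight n j.+1.

Definition step_fun (q : R) (n : nat) (x : R) : R :=
  \sum_(0 <= j < n) cell q n j *
    \1_(`[j%:R / Num.sqrt n%:R, j.+1%:R / Num.sqrt n%:R[%classic : set R) x.

Lemma cell_ge0 q n j : 0 <= cell q n j.
Proof. by rewrite mulr_ge0 ?powR_ge0 ?rel_weight_ge0. Qed.

Lemma step_funE q n x : (0 < n)%N -> 0 <= x ->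
  step_fun q n x = cell q n (Num.truncn (x * Num.sqrt n%:R)).
Proof.
move=> n0 x0; set s : R := Num.sqrt n%:R; have s0 : 0 < s by rewrite sqrtr_gt0 ltr0n.
set j := Num.truncn _.
have xs0 : 0 <= x * s by rewrite mulr_ge0 // ltW.
have ind i : \1_(`[i%:R / s, i.+1%:R / s[%classic : set R) x = (i == j)%:R :> R.
  rewrite indicE mem_setE in_itv /= ler_pdivrMr // ltr_pdivlMr //.
  by rewrite eq_sym truncn_eq.
rewrite /step_fun; under eq_bigr do rewrite ind.
have [jn|nj] := ltnP j n.
  rewrite big_mkord (bigD1 (Ordinal jn)) //= eqxx mulr1 big1 ?addr0 // => i ij.
  by rewrite (_ : (_ == j) = false) ?mulr0 //; apply: contraNF ij => /eqP e; apply/eqP/val_inj.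
rewrite big1_seq ?/cell ?rel_weight_eq0 ?mulr0 //.
by move=> i; rewrite mem_index_iota => /andP[_ i_n]; rewrite (_ : (_ == _) = false) ?mulr0 //; lia.
Qed.

Lemma measurable_step_fun q n (D : set R) : measurable D -> measurable_fun D (step_fun q n).
Proof.
by move=> mD; apply: measurable_sum => j; apply: measurable_funM.
Qed.

Lemma integral_step_fun q n : (0 < n)%N ->
  (\int[mu]_(x in `]0%R, +oo[) (step_fun q n x)%:E =
  (\sum_(0 <= j < n) cell q n j / Num.sqrt n%:R)%:E)%E.
Proof.
move=> n0; set s : R := Num.sqrt n%:R; have s0 : 0 < s by rewrite sqrtr_gt0 ltr0n.
rewrite integral_itv_obnd_cbnd; last first.
  by apply/measurable_EFinP; apply: measurable_step_fun.
rewrite /step_fun; under eq_integral do rewrite -sumEFin.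
rewrite ge0_integral_sum //; last 2 first.
- by move=> i; apply/measurable_EFinP/measurable_funM => //; exact: measurable_funTS.
- by move=> i x _; rewrite lee_fin mulr_ge0 ?cell_ge0.
rewrite -sumEFin; apply: eq_bigr => j _.
under eq_integral do rewrite EFinM.
rewrite ge0_integralZl_EFin ?cell_ge0 //; last exact/measurable_EFinP.
rewrite integral_indic // setIidl; last first.
  move=> x /=; rewrite !in_itv /= andbT => /andP[+ _]; apply: le_trans.
  by rewrite divr_ge0 // ltW.
have js : j%:R / s < j.+1%:R / s by rewrite ltr_pM2r ?invr_gt0 // ltr_nat.
have E : mu (`[j%:R / s, j.+1%:R / s[%classic : set R) = (s^-1)%:E.
  rewrite lebesgue_measure_itv /= lte_fin js -EFinB -mulrBl -natr1.
  by rewrite addrAC subrr add0r mul1r.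
rewrite [in RHS]EFinM.
by congr (_ * _)%E.
Qed.

Lemma cvg_invr_sqrtn : (Num.sqrt n%:R)^-1 @[n --> \oo] --> (0 : R).
Proof.
apply/cvgrPdist_lt => e e0; near=> n.
have n0 : 0 < n%:R :> R by near: n; exact: nbhs_infty_gtr.
have s0 : 0 < Num.sqrt n%:R :> R by rewrite sqrtr_gt0.
rewrite sub0r normrN ger0_norm ?invr_ge0 ?(ltW s0) //.
rewrite -[e]invrK ltf_pV2 ?posrE ?invr_gt0 //.
rewrite -[ltLHS]ger0_norm ?invr_ge0 ?(ltW e0) // -sqrtr_sqr ltr_sqrt //.
by near: n; exact: nbhs_infty_gtr.
Unshelve. all: by end_near. Qed.

Lemma powR_continuous (q x : R) : 0 < x -> {for x, continuous (powR (R := R) ^~ q)}.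
Proof.
move=> x0; apply: differentiable_continuous; apply/derivable1_diffP.
by apply: derivable_powR; rewrite in_itv /= x0.
Qed.

(** At the right end [z] of the cell of [x], the relative weight lies between the
    two Gaussians of [rel_weight_ge] and [rel_weight_le] with [m = k = z * sqrt n];
    their exponents are [- z ^ 2 / (1 -+ z / sqrt n)]. *)
Lemma cvg_step_fun (q x : R) : 0 < x ->
  step_fun q n x @[n --> \oo] --> gauss_power q x.
Proof.
move=> x0; pose s n : R := Num.sqrt n%:R.
pose k n := (Num.truncn (x * s n)).+1.
pose z n : R := (k n)%:R / s n.
have cs : (s n)^-1 @[n --> \oo] --> (0 : R) by exact: cvg_invr_sqrtn.
have near_s : \forall n \near \oo, 0 < s n.
  by near=> n; rewrite sqrtr_gt0; near: n; exact: nbhs_infty_gtr.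
have zx n : 0 < s n -> x <= z n <= x + (s n)^-1.
  move=> s0; have /andP[h1 h2] := truncn_itv (ltW (mulr_gt0 x0 s0)).
  rewrite /z /k ler_pdivlMr // ler_pdivrMr // mulrDl mulVf ?gt_eqF // ltW //=.
  by rewrite -natr1 lerD2r.
have cz : z n @[n --> \oo] --> x.
  apply: (@squeeze_cvgr _ _ _ _ (fun=> x) (fun n => x + (s n)^-1)).
  - by near=> n; apply: zx; near: n.
  - exact: cvg_cst.
  - by rewrite -[X in _ --> X]addr0; apply: cvgD => //; exact: cvg_cst.
have czs : z n * (s n)^-1 @[n --> \oo] --> (0 : R).
  by rewrite -[X in _ --> X](mulr0 x); apply: cvgM.
have ce (e : R) : expR (- (z n ^+ 2 / (1 + e * (z n * (s n)^-1)))) @[n --> \oo]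
    --> expR (- x ^+ 2).
  apply: continuous_cvg; first exact: continuous_expR.
  apply: cvgN; rewrite -[X in _ --> X]divr1; apply: cvgM.
    by rewrite expr2; under eq_fun do rewrite expr2; apply: cvgM.
  apply: cvgV; first by rewrite oner_neq0.
  rewrite -[X in _ --> X]addr0 -[X in _ --> _ + X](mulr0 e).
  by apply: cvgD; [exact: cvg_cst|apply: cvgM => //; exact: cvg_cst].
have cw : rel_weight n (k n) @[n --> \oo] --> expR (- x ^+ 2).
  apply: (@squeeze_cvgr _ _ _ _ (fun n => expR (- (z n ^+ 2 / (1 + (-1) * (z n * (s n)^-1)))))
     (fun n => expR (- (z n ^+ 2 / (1 + 1 * (z n * (s n)^-1)))))) => //.
  near=> n.
  have s0 : 0 < s n by near: n.
  have ss : s n ^+ 2 = n%:R by rewrite sqr_sqrtr.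
  have n0 : (0 < n)%N by rewrite -(ltr_nat R) -ss exprn_gt0.
  have zs1 : z n * (s n)^-1 < 1 by near: n; exact: cvgr_lt czs _ ltr01.
  have kE : (k n)%:R = z n * s n by rewrite /z divfK ?gt_eqF.
  have zs : z n < s n by rewrite -[ltRHS]mul1r -ltr_pdivrMr.
  have kn : (k n < n)%N by rewrite -(ltr_nat R) kE -ss expr2 ltr_pM2r.
  have E e : z n ^+ 2 / (1 + e * (z n * (s n)^-1)) =
      (k n)%:R ^+ 2 / (n%:R + e * (k n)%:R).
    have -> : 1 + e * (z n * (s n)^-1) = (s n ^+ 2 + e * (z n * s n)) / s n ^+ 2.
      by field; rewrite gt_eqF.
    by rewrite invf_div [LHS]mulrA -exprMn -kE ss.
  have e1 : n%:R + (-1) * (k n)%:R = (n - k n)%:R :> R.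
    by rewrite mulN1r natrB // ltnW.
  have e2 : n%:R + 1 * (k n)%:R = (n + k n)%:R :> R by rewrite mul1r natrD.
  by rewrite !E e1 e2 rel_weight_ge // rel_weight_le // ltnW.
have cp : z n `^ q @[n --> \oo] --> x `^ q.
  apply: (@continuous_cvg _ _ _ _ _ _ (powR (R := R) ^~ q)) => //; exact: powR_continuous.
apply: (@cvg_trans _ ((z n `^ q * rel_weight n (k n)) @[n --> \oo])); last exact: cvgM.
apply: near_eq_cvg; near=> n; rewrite step_funE //; last exact: ltW.
near: n; exact: nbhs_infty_gt.
Unshelve. all: by end_near. Qed.

End riemann_sum.

Section gauss_moment.
Context {R : realType}.
Local Notation mu := (@lebesgue_measure R).

(** At the right end of the cell of [x], at most [x + 1], the power is bounded by
    an exponential and the relative weight by [expR (- x ^+ 2 / 2)]. *)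
Lemma step_fun_dom (q : R) : 0 <= q -> exists C : R, 0 <= C /\
  forall n x, (0 < n)%N -> 0 <= x -> step_fun q n x <= C * expR (- x).
Proof.
move=> q0; set p := (Num.truncn q).+1.
have qp : q <= p%:R by exact: ltW (truncnS_gt _).
exists (p`!%:R * expR 3); split; first by rewrite mulr_ge0 ?expR_ge0.
move=> n x n0 x0; rewrite step_funE //.
set s : R := Num.sqrt n%:R; have s0 : 0 < s by rewrite sqrtr_gt0 ltr0n.
have ss : s ^+ 2 = n%:R by rewrite sqr_sqrtr.
have s1 : 1 <= s by rewrite -sqrtr1 ler_sqrt ?ltr0n // ler1n.
have /andP[h1 h2] := truncn_itv (mulr_ge0 x0 (ltW s0)).
rewrite /cell -/s; set j := Num.truncn _ in h1 h2 *.
set z := j.+1%:R / s.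
have xz : x <= z by rewrite ler_pdivlMr // ltW.
have z0 : 0 <= z by exact: le_trans xz.
have zx : z <= x + 1.
  by rewrite ler_pdivrMr // mulrDl mul1r -natr1 lerD.
have [jn|nj] := ltnP j n; last first.
  by rewrite rel_weight_eq0 ?mulr0 ?mulr_ge0 ?expR_ge0 // ltnS.
have hw : rel_weight n j.+1 <= expR (- (x ^+ 2 / 2)).
  apply: le_trans (rel_weight_le jn (leqnn n) n0) _.
  rewrite ler_expR lerN2 ler_pdivlMr ?ltr0n ?addn_gt0 ?n0 //.
  have -> : (n + n)%:R = 2 * n%:R :> R by rewrite natrD; lra.
  rewrite mulrA divfK ?pnatr_eq0 // -ss -exprMn.
  by rewrite lerXn2r ?nnegrE ?mulr_ge0 ?(ltW s0) ?(ltW h2).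
have hp : z `^ q <= p`!%:R * expR (x + 1).
  have x1 : 0 <= x + 1 by lra.
  apply: (@le_trans _ _ ((x + 1) `^ q)); first by rewrite ge0_ler_powR.
  apply: (@le_trans _ _ ((x + 1) `^ p%:R)); first by rewrite ler_powR // lerDr.
  rewrite powR_mulrn // mulrC -ler_pdivrMr ?ltr0n ?fact_gt0 //.
  by apply: le_trans (expR_ge1Dxn (Num.truncn q) x1); rewrite lerDr.
apply: le_trans (ler_pM (powR_ge0 _ _) (rel_weight_ge0 _ _) hp hw) _.
rewrite -!mulrA ler_wpM2l // -!expRD ler_expR.
(* [x + 1 - x ^ 2 / 2 <= 3 - x] is [0 <= (x - 2) ^ 2]. *)
have := sqr_ge0 (x - 2); lra.
Qed.

Lemma integrable_expRN : mu.-integrable `]0%R, +oo[ (fun x : R => (expR (- x))%:E).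
Proof.
have := integrable_exponential_pdf (ltr01 : 0 < 1 :> R).
move=> /(@integrableS _ _ _ mu setT `]0, +oo[%classic) H.
have {}H := H measurableT ltac:(by []) ltac:(by []).
apply: eq_integrable H => // x; rewrite inE /= in_itv /= andbT => x0.
by rewrite exponential_pdfE ?(ltW x0) // mul1r mulN1r.
Qed.

(** Dominated convergence for the step functions. *)
Lemma gauss_power_cvg (q : R) : 0 <= q ->
  mu.-integrable `]0%R, +oo[ (fun x : R => (gauss_power q x)%:E) /\
  (\sum_(0 <= j < n) cell q n j / Num.sqrt n%:R) @[n --> \oo] -->
    \int[mu]_(x in `]0%R, +oo[) gauss_power q x.
Proof.
move=> q0; have [C [C0 hC]] := step_fun_dom q0.
have mD : measurable (`]0%R, +oo[%classic : set R) by [].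
have mgp (D : set R) : measurable_fun D (gauss_power q).
  apply: measurable_funTS; apply: measurable_funM; first exact: measurable_powR.
  apply: measurableT_comp => //; apply: measurableT_comp; first exact: oppr_measurable.
  exact: measurable_funX.
have [||||int_gp _ cvg_gp] := @dominated_convergence _ _ R mu `]0%R, +oo[ mD
  (fun n x => (step_fun q n.+1 x)%:E) (fun x => (gauss_power q x)%:E)
  (fun x => (C%:E * (expR (- x))%:E)%E)
  (fun n => measurableT_comp (@EFin_measurable _ _) (measurable_step_fun q n.+1 mD)).
- by apply/measurable_EFinP; exact: mgp.
- apply: aeW => x /=; rewrite in_itv /= andbT => x0.
  apply: cvg_EFin; first by near=> n.
  by rewrite (@cvg_shiftS _ (fun n => step_fun q n x)); exact: cvg_step_fun.
- by apply: integrableZl => //; exact: integrable_expRN.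
- apply: aeW => x n /=; rewrite in_itv /= andbT => x0.
  rewrite -EFinM lee_fin ger0_norm ?hC ?(ltW x0) //.
  by rewrite step_funE ?cell_ge0 // ltW.
split => //.
rewrite -(@cvg_shiftS _ (fun n => \sum_(0 <= j < n) cell q n j / Num.sqrt n%:R)).
have -> : (fun n => \sum_(0 <= j < n.+1) cell q n.+1 j / Num.sqrt n.+1%:R) =
    fine \o (fun n => \int[mu]_(x in `]0%R, +oo[) (step_fun q n.+1 x)%:E)%E.
  by apply/funext => n /=; rewrite integral_step_fun.
by apply: fine_cvg; rewrite /Rintegral fineK //; exact: integrable_fin_num.
Unshelve. all: by end_near. Qed.

End gauss_moment.

Section gamma.
Context {R : realType}.
Local Notation mu := (@lebesgue_measure R).

Definition gamma_fun (s x : R) : R := x `^ (s - 1) * expR (- x).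

(** The substitution of [x ^+ 2] for [x], on compact intervals away from the
    singularity at 0; the improper integrals are reached by exhaustion. *)
Lemma gamma_substitution (q a b : R) : 0 < q -> 0 < a -> a <= b ->
  (\int[mu]_(x in `[(a ^+ 2)%R, (b ^+ 2)%R]) (gamma_fun ((q + 1) / 2) x)%:E =
   \int[mu]_(x in `[a, b]) (2 * gauss_power q x)%:E)%E.
Proof.
move=> q0 a0 ab; pose F (x : R) := x ^+ 2.
have F' x : F^`()%classic x = 2 * x by rewrite exp_derive1 expr1.
have cF : continuous F by exact: exprn_continuous.
have cF' : continuous F^`()%classic.
  move=> x; rewrite (_ : F^`()%classic = fun x => 2 * x); last exact/funext.
  by apply: cvgM; [exact: cvg_cst|exact: cvg_id].
have ab_gt0 x : x \in `[a, b] -> 0 < x.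
  by rewrite in_itv /= => /andP[+ _]; exact: lt_le_trans.
rewrite (@integration_by_substitution_increasing _ F) //.
- apply: eq_integral => x; rewrite inE => /ab_gt0 x0.
  transitivity ((gamma_fun ((q + 1) / 2) (F x) * F^`()%classic x)%:E) => //.
  rewrite F' /gamma_fun /gauss_power /F; congr EFin.
  have -> : (x ^+ 2) `^ ((q + 1) / 2 - 1) = x `^ (q - 1).
    by rewrite -powR_mulrn ?(ltW x0) // -powRrM; congr (_ `^ _); field.
  rewrite -(mulr_powRB1 (ltW x0) q0); ring.
- move=> x y /ab_gt0 x0 /ab_gt0 y0 xy.
  by rewrite /F ltrXn2r // ?nnegrE ltW.
- by apply/cvg_ex; exists (F^`()%classic a); apply: cvg_at_right_filter; exact: cF'.
- by apply/cvg_ex; exists (F^`()%classic b); apply: cvg_at_left_filter; exact: cF'.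
- split.
  + by move=> x _; exact: exprn_derivable.
  + by apply: cvg_at_right_filter; exact: cF.
  + by apply: cvg_at_left_filter; exact: cF.
- apply: continuous_in_subspaceT => x; rewrite inE /= in_itv /= => /andP[ax _].
  have x0 : 0 < x by apply: lt_le_trans ax; rewrite exprn_gt0.
  apply: cvgM; first exact: powR_continuous.
  apply: continuous_comp; first exact: continuousN.
  exact: continuous_expR.
Qed.

Lemma bigcup_itv0y (a b : nat -> R) :
  (forall n, 0 < a n <= n.+1%:R^-1) -> (forall n, n.+1%:R <= b n) ->
  \bigcup_n `[a n, b n]%classic = `]0%R, +oo[%classic.
Proof.
move=> ha hb; apply/seteqP; split => x /=.
  move=> [n _] /=; rewrite !in_itv /= andbT => /andP[h _].
  by apply: lt_le_trans h; have /andP[] := ha n.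
rewrite in_itv /= andbT => x0.
pose n := maxn (Num.truncn x) (Num.truncn x^-1); exists n => //=.
rewrite in_itv /=; apply/andP; split.
  have /andP[_ h] := ha n; apply: le_trans h _.
  rewrite -[leRHS]invrK lef_pV2 ?posrE ?invr_gt0 ?ltr0n //.
  by apply: le_trans (ltW (truncnS_gt _)) _; rewrite ler_nat ltnS leq_maxr.
apply: le_trans (hb n); apply: le_trans (ltW (truncnS_gt _)) _.
by rewrite ler_nat ltnS leq_maxl.
Qed.

Lemma cvg_integral_itv0y (a b : nat -> R) (f : R -> R) :
  measurable_fun setT f -> (forall x, 0 <= f x) ->
  (forall n, 0 < a n <= n.+1%:R^-1) -> (forall n, n.+1%:R <= b n) ->
  {homo a : n m / (n <= m)%N >-> m <= n} -> {homo b : n m / (n <= m)%N >-> n <= m} ->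
  ((\int[mu]_(x in `[a n, b n]) (f x)%:E) @[n --> \oo] -->
    \int[mu]_(x in `]0%R, +oo[) (f x)%:E)%E.
Proof.
move=> mf f0 ha hb a_dec b_inc; rewrite -(bigcup_itv0y ha hb).
apply: ge0_nondecreasing_set_cvg_integral => //.
- move=> n m nm; apply/subsetPset => x /=; rewrite !in_itv /= => /andP[h1 h2].
  by rewrite (le_trans (a_dec _ _ nm)) // (le_trans h2) ?b_inc.
- by move=> n; apply/measurable_EFinP; exact: measurable_funTS.
- by move=> n x _; rewrite lee_fin.
Qed.

Lemma integral_gamma_gauss (q : R) : 0 < q ->
  (\int[mu]_(x in `]0%R, +oo[) (gamma_fun ((q + 1) / 2) x)%:E =
   \int[mu]_(x in `]0%R, +oo[) (2 * gauss_power q x)%:E)%E.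
Proof.
move=> q0.
have inv_dec : {homo (fun n => n.+1%:R^-1 : R) : n m / (n <= m)%N >-> m <= n}.
  by move=> n m nm; rewrite lef_pV2 ?posrE ?ltr0n // ler_nat ltnS.
have inv1 (n : nat) : 0 < (n.+1%:R^-1 : R) <= 1.
  by rewrite invr_gt0 ltr0n /= invf_le1 ?ltr0n // ler1n.
have mg s : measurable_fun setT (gamma_fun s).
  apply: measurable_funM; first exact: measurable_powR.
  by apply: measurableT_comp => //; exact: oppr_measurable.
have mgp : measurable_fun setT (fun x : R => 2 * gauss_power q x).
  apply: measurable_funM => //; apply: measurable_funM; first exact: measurable_powR.
  apply: measurableT_comp => //; apply: measurableT_comp; first exact: oppr_measurable.
  exact: measurable_funX.
have g0 s x : 0 <= gamma_fun s x by rewrite mulr_ge0 ?powR_ge0 ?expR_ge0.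
have gp0 x : 0 <= 2 * gauss_power q x by rewrite !mulr_ge0 ?powR_ge0 ?expR_ge0.
have c1 : ((\int[mu]_(x in `[(n.+1%:R^-1 ^+ 2)%R, (n.+1%:R ^+ 2)%R])
    (gamma_fun ((q + 1) / 2) x)%:E) @[n --> \oo] -->
    \int[mu]_(x in `]0%R, +oo[) (gamma_fun ((q + 1) / 2) x)%:E)%E.
  apply: cvg_integral_itv0y => // [n|n|n m nm|n m nm].
  - have /andP[i0 i1] := inv1 n; rewrite exprn_gt0 //= expr2 ler_piMl // ltW //.
  - by rewrite expr2 ler_peMl // ler1n.
  - by rewrite lerXn2r ?nnegrE ?invr_ge0 // inv_dec.
  - by rewrite lerXn2r ?nnegrE // ler_nat ltnS.
have c2 : ((\int[mu]_(x in `[(n.+1%:R^-1)%R, (n.+1%:R)%R])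
    (2 * gauss_power q x)%:E) @[n --> \oo] -->
    \int[mu]_(x in `]0%R, +oo[) (2 * gauss_power q x)%:E)%E.
  apply: cvg_integral_itv0y => // [n|n m nm].
  - by have /andP[-> _] := inv1 n; rewrite lexx.
  - by rewrite ler_nat ltnS.
suff E : (fun n => \int[mu]_(x in `[(n.+1%:R^-1 ^+ 2)%R, (n.+1%:R ^+ 2)%R])
    (gamma_fun ((q + 1) / 2) x)%:E)%E =
    (fun n => \int[mu]_(x in `[(n.+1%:R^-1)%R, (n.+1%:R)%R])
    (2 * gauss_power q x)%:E)%E.
  by rewrite E in c1; rewrite -(cvg_lim _ c1) // -(cvg_lim _ c2).
apply/funext => n; have /andP[i0 i1] := inv1 n.
by rewrite gamma_substitution // (le_trans i1) // ler1n.
Qed.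

Lemma Gamma_gauss (q : R) : 0 < q ->
  Gamma ((q + 1) / 2) = 2 * \int[mu]_(x in `]0%R, +oo[) gauss_power q x.
Proof.
move=> q0; have [int_gp _] := gauss_power_cvg (ltW q0).
by rewrite -RintegralZl // /Gamma /Rintegral integral_gamma_gauss.
Qed.

Lemma Gamma_gt0 (q : R) : 0 < q -> 0 < Gamma ((q + 1) / 2) :> R.
Proof.
move=> q0; have [int_gp _] := gauss_power_cvg (ltW q0).
rewrite Gamma_gauss // mulr_gt0 //.
have fin : (\int[mu]_(x in `]0%R, +oo[) (gauss_power q x)%:E)%E \is a fin_num.
  exact: integrable_fin_num.
rewrite /Rintegral -lte_fin fineK //.
apply: (@lt_le_trans _ _ (\int[mu]_(x in `[1%R, 2%R]) (cst (expR (- 4))%:E x))%E).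
  rewrite integral_cst //.
  apply: mule_gt0; first by rewrite lte_fin expR_gt0.
  have : (0 < mu (`[1%R, 2%R]%classic : set R))%E; last by [].
  by rewrite lebesgue_measure_itv /= lte_fin ltr1n /= -EFinB lte_fin subr_gt0 ltr1n.
apply: (@le_trans _ _ (\int[mu]_(x in `[1%R, 2%R]) (gauss_power q x)%:E)%E); last first.
  apply: ge0_subset_integral => //.
  - by have /integrableP[] := int_gp.
  - by move=> x _; rewrite lee_fin mulr_ge0 ?powR_ge0 ?expR_ge0.
  - by move=> x /=; rewrite !in_itv /= andbT => /andP[+ _]; apply: lt_le_trans.
apply: ge0_le_integral => //.
- by move=> x _; rewrite lee_fin expR_ge0.
- have /integrableP[h _] := int_gp; apply: measurable_funS h => //.
  by move=> x /=; rewrite !in_itv /= andbT => /andP[+ _]; apply: lt_le_trans.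
- move=> x /=; rewrite in_itv /= => /andP[x1 x2]; rewrite lee_fin /gauss_power.
  have : 1 <= x `^ q by rewrite -[leLHS](powRr0 x) ler_powR // ltW.
  have : expR (- 4) <= expR (- x ^+ 2).
    rewrite ler_expR lerN2; nra.
  have := expR_ge0 (- x ^+ 2 : R); nra.
Qed.

Lemma gauss_power0 : \int[mu]_(x in `]0%R, +oo[) gauss_power 0 x = Num.sqrt pi / 2.
Proof.
have [int_gp _] := gauss_power_cvg (lexx (0 : R)).
rewrite /Rintegral integral_itv_obnd_cbnd; last by have /integrableP[] := int_gp.
under eq_integral do rewrite /gauss_power powRr0 mul1r.
by rewrite integral0y_gauss.
Qed.

(** The Gaussian limit of the moments, along even times: the relative weights
    form a Riemann sum of [x `^ q * expR (- x ^+ 2)], and their total mass is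
    the case [q = 0]. *)
Lemma even_walk_moment_cvg (q : R) : 0 < q ->
  avg 0 n.*2 (fun v => `|(walk v n.*2)%:~R| `^ q) (fun=> 0) / Num.sqrt n%:R `^ q
    @[n --> \oo] --> 2 `^ q * Gamma ((q + 1) / 2) / Num.sqrt pi.
Proof.
move=> q0; have [_ cq] := gauss_power_cvg (ltW q0).
have [_ c0] := gauss_power_cvg (lexx (0 : R)).
rewrite gauss_power0 in c0.
have sp0 : 0 < Num.sqrt pi :> R by rewrite sqrtr_gt0 pi_gt0.
have -> : 2 `^ q * Gamma ((q + 1) / 2) / Num.sqrt pi =
    2 * (2 `^ q * \int[mu]_(x in `]0%R, +oo[) gauss_power q x) /
    (0 + 2 * (Num.sqrt pi / 2)) :> R.
  rewrite Gamma_gauss //; field; rewrite gt_eqF //.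
pose A (r : R) n := \sum_(0 <= j < n) cell r n j / Num.sqrt n%:R.
apply: (@cvg_trans _ ((2 * (2 `^ q * A q n) / ((Num.sqrt n%:R)^-1 + 2 * A 0 n)) @[n --> \oo])).
  apply: near_eq_cvg; near=> n.
  have n0 : (0 < n)%N by near: n; exact: nbhs_infty_gt.
  have s0 : 0 < Num.sqrt n%:R :> R by rewrite sqrtr_gt0 ltr0n.
  rewrite (@eq_avg _ _ _ _ (fun v => (fun i : nat => i%:R `^ q) `|walk v n.*2|%N)); last first.
    by move=> v _; rewrite /= natr_absz -intr_norm.
  rewrite (avg_even_walk n (fun i : nat => i%:R `^ q)) powR0 ?gt_eqF // add0r.
  have Aq : \sum_(1 <= k < n.+1) rel_weight n k * (2 * k)%N%:R `^ q =
      2 `^ q * Num.sqrt n%:R `^ q * Num.sqrt n%:R * A q n.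
    rewrite big_add1 /= /A big_distrr /=; apply: eq_bigr => i _.
    rewrite /cell natrM powRM // -[X in _ * (_ * X `^ q)](divfK (lt0r_neq0 s0)).
    rewrite powRM ?divr_ge0 ?(ltW s0) //; field; rewrite gt_eqF //.
  have A0 : \sum_(1 <= k < n.+1) rel_weight n k = Num.sqrt n%:R * A 0 n.
    rewrite big_add1 /= /A big_distrr /=; apply: eq_bigr => i _.
    rewrite /cell powRr0; field; rewrite gt_eqF //.
  rewrite Aq A0; have sq0 : 0 < Num.sqrt n%:R `^ q :> R by exact: powR_gt0.
  have A00 : 0 <= A 0 n.
    by apply: sumr_ge0 => i _; rewrite divr_ge0 ?cell_ge0 ?(ltW s0).
  have -> : 1 + 2 * (Num.sqrt n%:R * A 0 n) =
    Num.sqrt n%:R * ((Num.sqrt n%:R)^-1 + 2 * A 0 n) by field; rewrite gt_eqF.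
  have d0 : 0 < (Num.sqrt n%:R)^-1 + 2 * A 0 n.
    by rewrite ltr_pwDl ?invr_gt0 // mulr_ge0.
  move: d0; set D := _ + 2 * A 0 n; clearbody D => d0.
  move: sq0; set sq := _ `^ q; clearbody sq => sq0.
  by field; rewrite !gt_eqF.
apply: cvgM.
  by apply: cvgM; [exact: cvg_cst|apply: cvgM => //; exact: cvg_cst].
apply: cvgV; first by rewrite add0r mulf_neq0 // gt_eqF // divr_gt0.
apply: cvgD; first exact: cvg_invr_sqrtn.
by apply: cvgM => //; exact: cvg_cst.
Unshelve. all: by end_near. Qed.

End gamma.

(** * The strong law of large numbers *)

Section dyadic_truncation.
Context {R : realType}.
Implicit Types (x : R) (j : nat).

Definition trunc j x : R := if x <= 2 ^+ j then x else 0.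

Lemma trunc_ge0 j x : 0 <= x -> 0 <= trunc j x.
Proof. by rewrite /trunc; case: ifP. Qed.

Lemma trunc_le j x : 0 <= x -> trunc j x <= 2 ^+ j.
Proof. by rewrite /trunc; case: ifP => // _ _; rewrite exprn_ge0. Qed.

Lemma measurable_trunc j : measurable_fun setT (trunc j).
Proof.
apply: measurable_fun_ifT => //; first exact: measurable_fun_ler.
Qed.

(** A geometric sum; the bound by [2 ^+ J] carries the induction. *)
Lemma sum_pow2_lt x J : 0 <= x ->
  \sum_(0 <= j < J) 2 ^+ j * (2 ^+ j < x)%R%:R <= Num.min (2 ^+ J) (2 * x).
Proof.
move=> x0; elim: J => [|J IH].
  by rewrite big_geq // le_min ler01 mulr_ge0.
rewrite big_nat_recr //=; move: IH; rewrite !le_min exprS => /andP[h1 h2].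
have p0 : 0 < 2 ^+ J :> R by rewrite exprn_gt0.
case: ltP => h; rewrite ?mulr1 ?mulr0 ?addr0; apply/andP; split; lra.
Qed.

(** A geometric sum, times [x]; the subtracted term carries the induction. *)
Lemma sum_pow2_ge x J : 0 <= x ->
  x * (\sum_(0 <= j < J) 2 ^- j * (x <= 2 ^+ j)%R%:R) <= Num.max 0 (2 - 2 * x / 2 ^+ J).
Proof.
move=> x0; elim: J => [|J IH]; first by rewrite big_geq // mulr0 le_max lexx.
rewrite big_nat_recr //= mulrDr.
have p0 : 0 < 2 ^+ J :> R by rewrite exprn_gt0.
have -> : 2 * x / 2 ^+ J.+1 = x / 2 ^+ J by rewrite exprS; field; rewrite gt_eqF.
move: IH; rewrite -mulrA; set r := x / 2 ^+ J.
case: (leP x) => h; rewrite ?mulr1 ?mulr0 ?addr0.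
  have r1 : r <= 1 by rewrite ler_pdivrMr // mul1r.
  rewrite -/r !le_max => /orP[h1|h1]; apply/orP; right; lra.
have r1 : 1 < r by rewrite ltr_pdivlMr // mul1r.
by rewrite !le_max => /orP[h1|h1]; apply/orP; left; lra.
Qed.

(** What the truncation at level [2 ^+ j] of [a * 2 ^+ j] variables costs:
    a variance term and a tail term. *)
Definition trunc_cost (a j : nat) x : R :=
  2 ^- j * trunc j x ^+ 2 + a%:R * 2 ^+ j * (2 ^+ j < x)%R%:R.

Lemma trunc_cost_ge0 a j x : 0 <= trunc_cost a j x.
Proof.
apply: addr_ge0; last by rewrite !mulr_ge0 ?exprn_ge0.
by apply: mulr_ge0; rewrite ?sqr_ge0 // invr_ge0 exprn_ge0.
Qed.

(** Over all levels, both parts of the cost form geometric series that start or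
    end at the level of [x], hence are linear in [x]. *)
Lemma sum_trunc_cost a J x : 0 <= x ->
  \sum_(0 <= j < J) trunc_cost a j x <= (2 + 2 * a%:R) * x.
Proof.
move=> x0; rewrite big_split /= [leRHS]mulrDl; apply: lerD.
  apply: (@le_trans _ _ (x * (x * (\sum_(0 <= j < J) 2 ^- j * (x <= 2 ^+ j)%R%:R)))).
    rewrite !big_distrr /=; apply: ler_sum => j _; rewrite /trunc.
    set t := 2 ^- j; clearbody t; case: ifP => _; rewrite ?mulr1 ?mulr0 ?expr0n /= ?mulr0 //.
    by rewrite expr2 mulrCA (mulrC t).
  rewrite mulrC ler_wpM2r //; apply: le_trans (sum_pow2_ge J x0) _.
  by rewrite ge_max ler0n /= gerBl divr_ge0 ?mulr_ge0 ?exprn_ge0.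
under eq_bigr do rewrite -mulrA; rewrite -big_distrr /=.
have -> : 2 * a%:R * x = a%:R * (2 * x) by ring.
rewrite ler_wpM2l //.
by have := sum_pow2_lt J x0; rewrite le_min => /andP[].
Qed.

End dyadic_truncation.

Section pairwise_independent.
Context d (T : measurableType d) (R : realType) (P : probability T R).
Context (X : nat -> {RV P >-> R}).
Context (X_ge0 : forall i w, 0 <= X i w).
Context (X_indep : forall i j (A B : set R), i != j -> measurable A -> measurable B ->
  P (X i @^-1` A `&` X j @^-1` B) = (P (X i @^-1` A) * P (X j @^-1` B))%E).
Context (X_ident : forall i (A : set R), measurable A ->
  P (X i @^-1` A) = P (X 0%N @^-1` A)).

Lemma ident_integral (f : R -> R) i : measurable_fun setT f -> (forall x, 0 <= f x) ->
  (\int[P]_w (f (X i w))%:E = \int[P]_w (f (X 0%N w))%:E)%E.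
Proof.
move=> mf f0.
have mEf : measurable_fun setT (EFin \o f) by apply/measurable_EFinP.
have E k : (\int[P]_w (f (X k w))%:E = \int[distribution P (X k)]_x (f x)%:E)%E.
  by rewrite ge0_integral_distribution // => x; rewrite lee_fin.
rewrite !E; apply: eq_measure_integral => A mA _; exact: X_ident.
Qed.

(** The joint law of two independent variables is the product of their laws, by
    uniqueness of the product measure. *)
Lemma indep_integral (f g : R -> R) i j : i != j ->
  measurable_fun setT f -> (forall x, 0 <= f x) ->
  measurable_fun setT g -> (forall x, 0 <= g x) ->
  (\int[P]_w (f (X i w) * g (X j w))%:E =
   \int[P]_w (f (X i w))%:E * \int[P]_w (g (X j w))%:E)%E.
Proof.
move=> ij mf f0 mg g0.
have mZ : measurable_fun setT (fun w => (X i w, X j w)).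
  by apply: measurable_fun_pair.
pose Z : {RV P >-> (R * R)%type} := HB.pack (fun w => (X i w, X j w))
  (isMeasurableFun.Build _ _ _ _ _ mZ).
have mfg : measurable_fun setT (fun z : R * R => (f z.1 * g z.2)%:E).
  apply/measurable_EFinP; apply: measurable_funM.
    exact: measurableT_comp.
  exact: measurableT_comp.
have fg0 (z : R * R) : (0 <= (f z.1 * g z.2)%:E)%E by rewrite lee_fin mulr_ge0.
transitivity (\int[distribution P Z]_z (f z.1 * g z.2)%:E)%E.
  by rewrite ge0_integral_distribution.
transitivity (\int[(distribution P (X i) \x distribution P (X j))%E]_z (f z.1 * g z.2)%:E)%E.
  apply: eq_measure_integral => A mA _; apply/esym/product_measure_unique => //.
  by move=> B C mB mC; exact: X_indep.
rewrite fubini_tonelli1 //.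
have mEf : measurable_fun setT (EFin \o f) by apply/measurable_EFinP.
have mEg : measurable_fun setT (EFin \o g) by apply/measurable_EFinP.
have Ef : (\int[P]_w (f (X i w))%:E = \int[distribution P (X i)]_x (f x)%:E)%E.
  by rewrite ge0_integral_distribution // => x; rewrite lee_fin.
have Eg : (\int[P]_w (g (X j w))%:E = \int[distribution P (X j)]_x (g x)%:E)%E.
  by rewrite ge0_integral_distribution // => x; rewrite lee_fin.
rewrite Ef Eg -ge0_integralZr //; last 2 first.
- by move=> x _; rewrite lee_fin.
- by apply: integral_ge0 => x _; rewrite lee_fin.
apply: eq_integral => x _; rewrite /fubini_F /=.
under eq_integral do rewrite EFinM.
by rewrite ge0_integralZl ?lee_fin // => y _; rewrite lee_fin.
Qed.

Let trunc_X_measurable i j : measurable_fun setT (fun w => trunc j (X i w)).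
Proof. by apply: measurableT_comp => //; exact: measurable_trunc. Qed.

(* Precomposed with the positive part, the truncation is nonnegative on the whole
   line and its integrals can be transferred to the laws of the variables. *)
Let pos (x : R) := Num.max 0 x.

(** The second term counts the variables that are truncated: once the defect is
    less than 1, there is none. *)
Definition trunc_defect (m : R) (a j : nat) w : R :=
  ((\sum_(0 <= i < a * 2 ^ j) trunc j (X i w)) / (a * 2 ^ j)%:R - m) ^+ 2
  + \sum_(0 <= i < a * 2 ^ j) (2 ^+ j < X i w)%R%:R.

Lemma trunc_defect_ge0 m a j w : 0 <= trunc_defect m a j w.
Proof. by rewrite addr_ge0 ?sqr_ge0 // sumr_ge0. Qed.

Lemma measurable_tail i j : measurable_fun setT (fun w => (2 ^+ j < X i w)%R%:R : R).
Proof.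
rewrite (_ : (fun w => _) = (fun w => if 2 ^+ j < X i w then 1 else 0 : R)).
  by apply: measurable_fun_ifT => //; exact: measurable_fun_ltr.
by apply/funext => w; case: ifP.
Qed.

Lemma measurable_trunc_defect m a j : measurable_fun setT (trunc_defect m a j).
Proof.
apply: measurable_funD.
  apply: measurable_funX; apply: measurable_funB => //.
  apply: measurable_funM => //; apply: measurable_sum => i; exact: trunc_X_measurable.
apply: measurable_sum => i; exact: measurable_tail.
Qed.

Lemma measurable_trunc_cost a j : measurable_fun setT (fun w => trunc_cost a j (X 0%N w)).
Proof.
apply: measurable_funD; apply: measurable_funM => //; last exact: measurable_tail.
by apply: measurable_funX; exact: trunc_X_measurable.
Qed.

Definition trunc_mean j : R := fine (\int[P]_w (trunc j (X 0%N w))%:E)%E.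

Lemma trunc_integral_fin (f : R -> R) (c : R) : measurable_fun setT f ->
  (forall x, 0 <= f x <= c) -> (\int[P]_w (f (X 0%N w))%:E)%E \is a fin_num.
Proof.
move=> mf fc; rewrite ge0_fin_numE; last first.
  by apply: integral_ge0 => w _; rewrite lee_fin; have /andP[] := fc (X 0%N w).
apply: (@le_lt_trans _ _ (\int[P]_w (cst c%:E w))%E).
  apply: ge0_le_integral => //.
  - by move=> w _; rewrite lee_fin; have /andP[] := fc (X 0%N w).
  - by apply/measurable_EFinP; exact: measurableT_comp.
  - by move=> w _; rewrite lee_fin; have /andP[] := fc (X 0%N w).
by rewrite integral_cst //= probability_setT mule1 ltry.
Qed.

Let tr j x := trunc j (pos x).

Let mtr j : measurable_fun setT (tr j).
Proof.
apply: measurableT_comp; first exact: measurable_trunc.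
by apply: measurable_maxr.
Qed.

Let tr_bound j x : 0 <= tr j x <= 2 ^+ j.
Proof.
have p0 : 0 <= pos x by rewrite le_max lexx.
by rewrite trunc_ge0 ?trunc_le.
Qed.

Let trE j i w : trunc j (X i w) = tr j (X i w).
Proof. by rewrite /tr /pos max_r. Qed.

Lemma integral_trunc i j : (\int[P]_w (trunc j (X i w))%:E = (trunc_mean j)%:E)%E.
Proof.
rewrite /trunc_mean fineK; last first.
  under eq_integral do rewrite trE.
  exact: (trunc_integral_fin (mtr j) (tr_bound j)).
under eq_integral do rewrite trE; under [RHS]eq_integral do rewrite trE.
by apply: ident_integral => // x; have /andP[] := tr_bound j x.
Qed.

(** By pairwise independence the variance of the sum is at most the sum of the
    second moments, as in Chebyshev's inequality. *)
Lemma integral_trunc_defect a j : (0 < a)%N ->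
  (\int[P]_w (trunc_defect (trunc_mean j) a j w)%:E
   <= \int[P]_w (trunc_cost a j (X 0%N w))%:E)%E.
Proof.
move=> a0; set m := trunc_mean j; set N := (a * 2 ^ j)%N.
have N0 : (0 < N)%N by rewrite muln_gt0 a0 expn_gt0.
have NR : 0 < N%:R :> R by rewrite ltr0n.
have m0 : 0 <= m.
  by rewrite fine_ge0 // integral_ge0 // => w _; rewrite lee_fin trunc_ge0.
have tr0 x : 0 <= tr j x by have /andP[] := tr_bound j x.
have m2 : measurable_fun setT (fun x => tr j x ^+ 2) by exact: measurable_funX.
have sfin : (\int[P]_w (tr j (X 0%N w) ^+ 2)%:E)%E \is a fin_num.
  apply: (trunc_integral_fin (c := (2 ^+ j) ^+ 2) m2) => x.
  have /andP[h1 h2] := tr_bound j x.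
  by rewrite exprn_ge0 //= lerXn2r ?nnegrE ?exprn_ge0.
set s : R := fine (\int[P]_w (tr j (X 0%N w) ^+ 2)%:E)%E.
have s0 : 0 <= s by rewrite fine_ge0 // integral_ge0 // => w _; rewrite lee_fin sqr_ge0.
have sE i : (\int[P]_w (tr j (X i w) ^+ 2)%:E = s%:E)%E.
  rewrite /s fineK // -(@ident_integral (fun x => tr j x ^+ 2) i) // => x.
  exact: sqr_ge0.
have mE i : (\int[P]_w (tr j (X i w))%:E = m%:E)%E.
  by rewrite -(integral_trunc i j); apply: eq_integral => w _; rewrite trE.
have mX i : measurable_fun setT (fun w => tr j (X i w)) by exact: measurableT_comp.
pose S w := \sum_(0 <= i < N) tr j (X i w).
have S0 w : 0 <= S w by apply: sumr_ge0.
have mS : measurable_fun setT S by apply: measurable_sum.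
have intS : (\int[P]_w (S w)%:E = (N%:R * m)%:E)%E.
  under eq_integral do rewrite /S -sumEFin.
  rewrite ge0_integral_sum //; last 2 first.
  - by move=> i; exact/measurable_EFinP.
  - by move=> i w _; rewrite lee_fin.
  by under eq_bigr do rewrite mE; rewrite sumEFin big_const_nat subn0 iter_addr addr0 mulr_natl.
have intS2 : (\int[P]_w (S w ^+ 2)%:E <= (N%:R ^+ 2 * m ^+ 2 + N%:R * s)%:E)%E.
  have E w : (S w ^+ 2)%:E =
      (\sum_(0 <= i < N) \sum_(0 <= k < N) (tr j (X i w) * tr j (X k w))%:E)%E.
    rewrite expr2 /S big_distrlr /= -sumEFin; apply: eq_bigr => i _.
    by rewrite sumEFin.
  under eq_integral do rewrite E.
  have mXX i k : measurable_fun setT (fun w => (tr j (X i w) * tr j (X k w))%:E).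
    by apply/measurable_EFinP; apply: measurable_funM.
  rewrite ge0_integral_sum //; last 2 first.
  - by move=> i; apply: emeasurable_sum.
  - by move=> i w _; apply: sume_ge0 => k _; rewrite lee_fin mulr_ge0.
  apply: (@le_trans _ _ (\sum_(0 <= i < N) \sum_(0 <= k < N) (m ^+ 2 + (i == k)%:R * s)%:E)%E).
    apply: lee_sum => i _; rewrite ge0_integral_sum //; last first.
      by move=> k w _; rewrite lee_fin mulr_ge0.
    apply: lee_sum => k _; have [->|ik] := eqVneq i k.
      under eq_integral do rewrite -expr2.
      by rewrite sE lee_fin mul1r lerDr sqr_ge0.
    by rewrite (indep_integral ik (mtr j) tr0 (mtr j) tr0) !mE mul0r addr0 expr2 EFinM.
  under eq_bigr do rewrite sumEFin; rewrite sumEFin lee_fin.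
  rewrite big_nat; under eq_bigr => i /andP[_ iN].
    rewrite big_split /= big_const_nat subn0 iter_addr addr0 -big_distrl /=.
    rewrite big_mkord (bigD1 (Ordinal iN)) //= eqxx big1 ?addr0 ?mul1r; last first.
      by move=> k ki; rewrite (_ : (i == k) = false) //; apply: contraNF ki => /eqP e; apply/eqP/val_inj.
    over.
  rewrite -big_nat big_const_nat subn0 iter_addr addr0.
  rewrite -[X in X *+ N]/(_ + _) -mulr_natl -[m ^+ 2 *+ N]mulr_natl; nra.
have var : (\int[P]_w ((S w / N%:R - m) ^+ 2)%:E <= (s / N%:R)%:E)%E.
  have mV : measurable_fun setT (fun w => (S w / N%:R - m) ^+ 2).
    by apply: measurable_funX; apply: measurable_funB => //; apply: measurable_funM.
  (* The square is expanded with the negative term moved to the left, so that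
     all integrands are nonnegative. *)
  have h1 : (\int[P]_w ((S w / N%:R - m) ^+ 2)%:E + (2 * m ^+ 2)%:E =
      (N%:R ^- 2)%:E * \int[P]_w (S w ^+ 2)%:E + (m ^+ 2)%:E)%E.
    have -> : ((2 * m ^+ 2)%:E = \int[P]_w (2 * m / N%:R * S w)%:E)%E.
      under eq_integral do rewrite EFinM.
      rewrite ge0_integralZl_EFin ?intS -?EFinM //; last 3 first.
      - by move=> w _; rewrite lee_fin.
      - exact/measurable_EFinP.
      - by rewrite divr_ge0 ?mulr_ge0.
      by congr EFin; field; rewrite gt_eqF.
    have -> : ((m ^+ 2)%:E = \int[P]_w (cst (m ^+ 2)%:E w))%E.
      by rewrite integral_cst //= probability_setT mule1.
    rewrite -ge0_integralD //; last 4 first.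
    - by move=> w _; rewrite lee_fin sqr_ge0.
    - exact/measurable_EFinP.
    - by move=> w _; rewrite lee_fin mulr_ge0 ?divr_ge0 ?mulr_ge0.
    - by apply/measurable_EFinP; apply: measurable_funM.
    rewrite -ge0_integralZl_EFin //; last 2 first.
    - by move=> w _; rewrite lee_fin sqr_ge0.
    - by apply/measurable_EFinP; apply: measurable_funX.
    rewrite -ge0_integralD //; last 3 first.
    - by move=> w _; rewrite -EFinM lee_fin mulr_ge0 ?sqr_ge0 // invr_ge0 exprn_ge0.
    - by apply: measurable_funeM; apply/measurable_EFinP; apply: measurable_funX.
    - by move=> w _; rewrite lee_fin sqr_ge0.
    apply: eq_integral => w _; rewrite /= -EFinM -!EFinD; congr EFin.
    by field; rewrite gt_eqF.
  have : (\int[P]_w ((S w / N%:R - m) ^+ 2)%:E + (2 * m ^+ 2)%:E <=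
      (N%:R ^- 2 * (N%:R ^+ 2 * m ^+ 2 + N%:R * s) + m ^+ 2)%:E)%E.
    rewrite h1 EFinD leeD2r // EFinM lee_wpmul2l // lee_fin invr_ge0 exprn_ge0 //.
  rewrite -leeBrDr // -EFinB => /le_trans; apply; rewrite lee_fin.
  by rewrite le_eqVlt; apply/orP; left; apply/eqP; field; rewrite gt_eqF.
have mt i := measurable_tail i j.
rewrite /trunc_defect; under eq_integral do rewrite EFinD.
rewrite ge0_integralD //; last 4 first.
- by move=> w _; rewrite lee_fin sqr_ge0.
- apply/measurable_EFinP; apply: measurable_funX; apply: measurable_funB => //.
  apply: measurable_funM => //; apply: measurable_sum => i; exact: trunc_X_measurable.
- by move=> w _; rewrite lee_fin sumr_ge0.
- by apply/measurable_EFinP; apply: measurable_sum.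
rewrite /trunc_cost; under [leRHS]eq_integral do rewrite EFinD.
rewrite [leRHS]ge0_integralD //; last 3 first.
- by move=> w _; rewrite lee_fin mulr_ge0 ?sqr_ge0 // invr_ge0 exprn_ge0.
- by apply/measurable_EFinP; apply: measurable_funM => //; apply: measurable_funX.
- by apply/measurable_EFinP; apply: measurable_funM.
have Na : N%:R = a%:R * 2 ^+ j :> R by rewrite natrM natrX.
apply: leeD.
  rewrite -/N; under eq_integral => w _.
    under eq_bigr do rewrite trE; rewrite -/(S w); over.
  apply: le_trans var _.
  under eq_integral do rewrite EFinM trE.
  rewrite ge0_integralZl_EFin ?sE -?EFinM ?lee_fin //; last 2 first.
  - by move=> w _; rewrite lee_fin sqr_ge0.
  - by apply/measurable_EFinP; apply: measurable_funX.
  rewrite mulrC ler_wpM2r // Na lef_pV2 ?posrE ?mulr_gt0 ?ltr0n ?exprn_gt0 //.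
  by rewrite ler_peMl ?exprn_ge0 // ler1n.
rewrite -/N; under eq_integral do rewrite -sumEFin.
rewrite ge0_integral_sum //; last by move=> i; exact/measurable_EFinP.
have mtail : measurable_fun setT (fun x : R => (2 ^+ j < x)%R%:R : R).
  rewrite (_ : (fun x => _) = (fun x => if 2 ^+ j < x then 1 else 0 : R)).
    by apply: measurable_fun_ifT => //; exact: measurable_fun_ltr.
  by apply/funext => w; case: ifP.
under eq_bigr do rewrite (ident_integral _ mtail) //.
under [leRHS]eq_integral do rewrite EFinM.
rewrite ge0_integralZl_EFin //; last by apply/measurable_EFinP.
by rewrite -Na big_const_nat subn0 iter_addr addr0 mule_natl.
Qed.

End pairwise_independent.

(** Convergence along the subsequences [a * 2 ^ j], for every integer [a],
    suffices for a nondecreasing sequence: the times [a * 2 ^ j] with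
    [A <= a < 2 * A] are eventually spaced by ratios at most [1 + 1 / A]. *)
Lemma cvg_mean_dyadic {R : realType} (s : nat -> R) (mu : R) :
  {homo s : m n / (m <= n)%N >-> m <= n} -> (forall n, 0 <= s n) -> 0 <= mu ->
  (forall a, (0 < a)%N -> s (a * 2 ^ j)%N / (a * 2 ^ j)%:R @[j --> \oo] --> mu) ->
  s n / n%:R @[n --> \oo] --> mu.
Proof.
move=> s_inc s0 mu0 hs; apply/cvgrPdist_lt => e e0.
set d := Num.min 1 (e / 2); have d0 : 0 < d by rewrite lt_min ltr01 divr_gt0.
have d1 : d <= 1 by rewrite ge_min lexx.
have de : d <= e / 2 by rewrite ge_min lexx orbT.
set A := (Num.truncn (4 * (mu + 1) / e)).+1.
have hA : 4 * (mu + 1) / e < A%:R by exact: truncnS_gt.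
have near_a a : (0 < a)%N -> \forall j \near \oo, `|mu - s (a * 2 ^ j)%N / (a * 2 ^ j)%:R| < d.
  by move=> a0; have /cvgrPdist_lt := hs a a0; apply.
have near_A : \forall j \near \oo, forall a, (a < A.*2.+1)%N -> (0 < a)%N ->
    `|mu - s (a * 2 ^ j)%N / (a * 2 ^ j)%:R| < d.
  elim: (A.*2.+1) => [|B IH]; first by near=> j.
  near=> j => a; rewrite ltnS leq_eqVlt => /orP[/eqP -> B0|aB a0].
    move: B0; near: j; have [->|B0] := posnP B; first by near=> j.
    by apply: filterS (near_a B B0) => j h _.
  by move: a aB a0; near: j.
have [J _ hJ] := near_A.
exists (A * 2 ^ J)%N => // n /= hn.
have A0 : (0 < A)%N by [].
have nA0 : (0 < n %/ A)%N by rewrite divn_gt0 // (leq_trans _ hn) // leq_pmulr ?expn_gt0.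
set j := trunc_log 2 (n %/ A).
have /andP[j1 j2] := trunc_log_bounds (isT : 1 < 2)%N nA0; rewrite -/j in j1 j2.
have Jj : (J <= j)%N by rewrite trunc_log_max // leq_divRL // mulnC.
set a := (n %/ 2 ^ j)%N.
have p0 : (0 < 2 ^ j)%N by rewrite expn_gt0.
have Aa : (A <= a)%N by rewrite leq_divRL // mulnC -leq_divRL.
have a2A : (a < A.*2)%N.
  by rewrite ltn_divLR // -muln2 -mulnA -expnS mulnC -ltn_divLR.
have a0 : (0 < a)%N by exact: leq_trans Aa.
have h1 := hJ j Jj a (leqW a2A) a0.
have h2 := hJ j Jj a.+1 a2A isT.
have n1 : (a * 2 ^ j <= n)%N by exact: leq_divM.
have n2 : (n <= a.+1 * 2 ^ j)%N by apply/ltnW/ltn_ceil.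
have n0 : 0 < n%:R :> R by rewrite ltr0n (leq_trans _ n1) // muln_gt0 a0.
have N1 : a%:R * (2 ^ j)%:R <= n%:R :> R by rewrite -natrM ler_nat.
have N2 : n%:R <= (a%:R + 1) * (2 ^ j)%:R :> R by rewrite natr1 -natrM ler_nat.
have s1 := s_inc _ _ n1; have s2 := s_inc _ _ n2.
have ea : 4 * (mu + 1) <= e * a%:R.
  rewrite [leRHS]mulrC -ler_pdivrMr //; apply: le_trans (ltW hA) _; by rewrite ler_nat.
have P0 : 0 < (2 ^ j)%:R :> R by rewrite ltr0n.
have ap0 : 0 < a%:R * (2 ^ j)%:R :> R by rewrite mulr_gt0 ?ltr0n.
have ap1 : 0 < (a%:R + 1) * (2 ^ j)%:R :> R by rewrite mulr_gt0 // natr1 ltr0n.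
move: h1 h2; rewrite !natrM -natr1 !ltr_norml => /andP[_ h1] /andP[h2 _].
have {}h1 : (mu - d) * (a%:R * (2 ^ j)%:R) < s (a * 2 ^ j)%N.
  by rewrite -ltr_pdivlMr //; lra.
have {}h2 : s (a.+1 * 2 ^ j)%N < (mu + d) * ((a%:R + 1) * (2 ^ j)%:R).
  by rewrite -ltr_pdivrMr //; lra.
apply/andP; split.
  suff : s n / n%:R < mu + e by lra.
  rewrite ltr_pdivrMr //; apply: le_lt_trans s2 _; apply: lt_le_trans h2 _.
  apply: (@le_trans _ _ ((mu + e) * (a%:R * (2 ^ j)%:R))); last first.
    by rewrite ler_wpM2l //; lra.
  have : (mu + d) * (a%:R + 1) <= (mu + e) * a%:R.
    have := ler_wpM2r (ler0n R a) de; lra.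
  by move=> h; have := ler_wpM2r (ltW P0) h; lra.
suff : mu - e < s n / n%:R by lra.
rewrite ltr_pdivlMr //.
have [neg|pos] := ltP (mu - e) 0; first by apply: lt_le_trans (s0 n); rewrite pmulr_llt0.
apply: lt_le_trans s1; apply: le_lt_trans h1.
apply: (@le_trans _ _ ((mu - e) * ((a%:R + 1) * (2 ^ j)%:R))).
  by rewrite ler_wpM2l.
have : (mu - e) * (a%:R + 1) <= (mu - d) * a%:R.
  have := ler_wpM2r (ler0n R a) de; lra.
by move=> h; have := ler_wpM2r (ltW P0) h; lra.
Unshelve. all: by end_near. Qed.

Section strong_law_of_large_numbers.
Context d (T : measurableType d) (R : realType) (P : probability T R).
Context (X : nat -> {RV P >-> R}).
Context (X_ge0 : forall i w, 0 <= X i w).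
Context (X_indep : forall i j (A B : set R), i != j -> measurable A -> measurable B ->
  P (X i @^-1` A `&` X j @^-1` B) = (P (X i @^-1` A) * P (X j @^-1` B))%E).
Context (X_ident : forall i (A : set R), measurable A ->
  P (X i @^-1` A) = P (X 0%N @^-1` A)).
Context (X_int : (\int[P]_w (X 0%N w)%:E < +oo)%E).

Lemma trunc_mean_cvg : trunc_mean X j @[j --> \oo] -->
  fine (\int[P]_w (X 0%N w)%:E)%E.
Proof.
apply: fine_cvg; rewrite fineK; last first.
  by rewrite ge0_fin_numE // integral_ge0 // => w _; rewrite lee_fin.
have -> : (\int[P]_w (X 0%N w)%:E =
    \int[P]_w limn (fun j => (trunc j (X 0%N w))%:E))%E.
  apply: eq_integral => w _; apply/esym/cvg_lim => //.
  apply: cvg_near_cst; near=> j; rewrite /trunc ifT //.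
  near: j; exists (Num.truncn (X 0%N w)).+1 => // j /= hj.
  apply: le_trans (ltW (truncnS_gt _)) _; rewrite -natrX ler_nat.
  by apply: leq_trans hj _; exact/ltnW/ltn_expl.
apply: cvg_monotone_convergence => //.
- by move=> j; apply/measurable_EFinP; apply: measurableT_comp => //; exact: measurable_trunc.
- by move=> j w _; rewrite lee_fin trunc_ge0.
- move=> w _ j k jk; rewrite lee_fin /trunc; case: ifP => h; last by case: ifP.
  by rewrite ifT // (le_trans h) // ler_eXn2l // ltr1n.
Unshelve. all: by end_near. Qed.

(** The expectations of the defects are summable because the costs are, so that
    almost surely the defects themselves are. *)
Lemma ae_trunc_defect_cvg a : (0 < a)%N -> {ae P, forall w,
  trunc_defect X (trunc_mean X j) a j w @[j --> \oo] --> 0}.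
Proof.
move=> a0; pose g j w := (trunc_defect X (trunc_mean X j) a j w)%:E.
have mg j : measurable_fun setT (g j).
  by apply/measurable_EFinP; exact: measurable_trunc_defect.
have g0 j w : (0 <= g j w)%E by rewrite lee_fin trunc_defect_ge0.
have G0 w : (0 <= \sum_(j <oo) g j w)%E by apply: nneseries_ge0.
have intG : (\int[P]_w (\sum_(j <oo) g j w) < +oo)%E.
  rewrite integral_nneseries //.
  apply: (@le_lt_trans _ _ ((2 + 2 * a%:R)%:E * \int[P]_w (X 0%N w)%:E)%E); last first.
    by rewrite lte_mul_pinfty // lee_fin addr_ge0 // mulr_ge0.
  apply: lime_le; first by apply: is_cvg_nneseries => j _ _; exact: integral_ge0.
  near=> J.
  apply: (@le_trans _ _ (\sum_(0 <= j < J) \int[P]_w (trunc_cost a j (X 0%N w))%:E)%E).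
    apply: lee_sum => j _; exact: integral_trunc_defect.
  rewrite -ge0_integral_sum //; last 2 first.
  - by move=> j; apply/measurable_EFinP; exact: measurable_trunc_cost.
  - by move=> j w _; rewrite lee_fin trunc_cost_ge0.
  rewrite -ge0_integralZl_EFin ?addr_ge0 ?mulr_ge0 //; last 2 first.
  - by move=> w _; rewrite lee_fin.
  - by apply/measurable_EFinP.
  apply: ge0_le_integral => //.
  - by move=> w _; apply: sume_ge0 => j _; rewrite lee_fin trunc_cost_ge0.
  - by apply: emeasurable_sum => j; apply/measurable_EFinP; exact: measurable_trunc_cost.
  - by apply: measurable_funeM; apply/measurable_EFinP.
  - by move=> w _; rewrite sumEFin -EFinM lee_fin sum_trunc_cost.
have iG : P.-integrable setT (fun w => \sum_(j <oo) g j w)%E.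
  apply/integrableP; split; first exact: ge0_emeasurable_sum.
  by under eq_integral do rewrite gee0_abs //.
have := integrable_ae measurableT iG; apply: filterS => w /(_ I) fin.
apply: cvg_series_cvg_0; apply: nondecreasing_is_cvgn.
  by apply: nondecreasing_series => j _ _; exact: trunc_defect_ge0.
exists (fine (\sum_(j <oo) g j w)%E) => _ [J _ <-].
rewrite -lee_fin fineK // /series /= -sumEFin.
by apply: (nneseries_lim_ge J) => j _ _; exact: (g0 j w).
Unshelve. all: by end_near. Qed.

(** Etemadi's strong law of large numbers. Along [a * 2 ^ j] the truncated means
    converge to the mean and, once the defect is less than 1, no variable is
    truncated; the partial sums being monotone, [cvg_mean_dyadic] applies. *)
Lemma strong_law : {ae P, forall w,
  (\sum_(0 <= i < n) X i w) / n%:R @[n --> \oo] --> fine (\int[P]_w (X 0%N w)%:E)%E}.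
Proof.
have H : {ae P, forall w, forall a, (0 < a)%N ->
    trunc_defect X (trunc_mean X j) a j w @[j --> \oo] --> 0}.
  apply: ae_foralln => a; have [->|a0] := posnP a; first by apply: aeW.
  by apply: filterS (ae_trunc_defect_cvg a0) => w h _.
apply: filterS H => w hw; apply: cvg_mean_dyadic.
- move=> m n mn; rewrite (@big_cat_nat _ _ _ m 0 n) //= lerDl; exact: sumr_ge0.
- by move=> n; exact: sumr_ge0.
- by rewrite fine_ge0 // integral_ge0 // => v _; rewrite lee_fin.
move=> a a0; have {}hw := hw a a0.
pose Y j := (\sum_(0 <= i < a * 2 ^ j) trunc j (X i w)) / (a * 2 ^ j)%:R.
have cY : (Y j - trunc_mean X j) @[j --> \oo] --> (0 : R).
  apply/cvgrPdist_lt => e e0.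
  have /cvgrPdist_lt /(_ _ (exprn_gt0 2 e0)) := hw; apply: filterS => j.
  rewrite !sub0r !normrN ger0_norm ?trunc_defect_ge0 // => h.
  rewrite -(@ltr_pXn2r _ 2) ?nnegrE // ?(ltW e0) // real_normK ?num_real //.
  by apply: le_lt_trans h; rewrite lerDl sumr_ge0.
have : (Y j - trunc_mean X j + trunc_mean X j) @[j --> \oo] -->
    0 + fine (\int[P]_w (X 0%N w)%:E)%E by apply: cvgD => //; exact: trunc_mean_cvg.
rewrite add0r; apply: cvg_trans; apply: near_eq_cvg.
have /cvgrPdist_lt /(_ _ ltr01) := hw; apply: filterS => j.
rewrite sub0r normrN ger0_norm ?trunc_defect_ge0 // => h; rewrite subrK /Y.
congr (_ / _); apply: eq_big_nat => i /andP[_ ia]; rewrite /trunc; case: leP => // hi.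
suff : (1 : R) < 1 by rewrite ltxx.
apply: le_lt_trans h; apply: ler_wpDl; first exact: sqr_ge0.
rewrite big_mkord (bigD1 (Ordinal ia)) //= hi lerDl; exact: sumr_ge0.
Qed.

End strong_law_of_large_numbers.

(** * Expectations over the velocities *)

Section velocities.
Context (R : realType) (d' : measure_display) (S : measurableType d')
  (Q : probability S R) (V : nat -> {RV Q >-> int}).
Context (hVind : mutually_independent Q V)
  (hVp : forall n, Q (V n @^-1` [set 1]) = (2^-1)%:E)
  (hVm : forall n, Q (V n @^-1` [set -1]) = (2^-1)%:E).

Lemma measurable_velocity n (A : set int) : measurable (V n @^-1` A).
Proof. by rewrite -[X in measurable X]setTI; exact: measurable_funPT. Qed.

(** The velocities take countably many values, so any functional of the first
    [n] of them is measurable. *)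
Lemma measurable_prefix d (T : measurableType d) n (F : (nat -> int) -> T) :
  prefix_fun n F -> measurable_fun setT (fun s => F (V ^~ s)).
Proof.
move=> hF _ B mB; rewrite setTI.
rewrite (_ : _ @^-1` _ = \bigcup_(l in [set: seq int])
  (if `[< B (F (nth 0 l)) >] then \bigcap_i (V i @^-1` [set a | (i < n)%N -> a = nth 0 l i])
   else set0)).
  apply: countable_bigcupT_measurable => [|l]; first exact: countableP.
  case: ifP => _ //.
  by apply: bigcapT_measurable => i; exact: measurable_velocity.
have Fe l s : (forall i, (i < n)%N -> V i s = nth 0 l i) -> F (V ^~ s) = F (nth 0 l).
  exact: hF.
apply/seteqP; split => s /=.
  move=> Bs; exists (mkseq (V ^~ s) n) => //.
  have e i : (i < n)%N -> V i s = nth 0 (mkseq (V ^~ s) n) i.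
    by move=> i_n; rewrite nth_mkseq.
  rewrite ifT => [i _ /=|]; first exact: e.
  by apply/asboolP; rewrite -(Fe _ s).
move=> [l _]; case: ifP => // /asboolP Bl h.
by rewrite (Fe l) // => i i_n; exact: (h i).
Qed.

Definition cylinder k (u : nat -> int) : set S :=
  \bigcap_(i in [set` iota 0 k]) (V i @^-1` [set u i]).

Lemma measurable_cylinder k u : measurable (cylinder k u).
Proof.
apply: fin_bigcap_measurable; first exact: finite_seq.
by move=> i _; exact: measurable_velocity.
Qed.

Lemma cylinderP k u s : cylinder k u s <-> forall i, (i < k)%N -> V i s = u i.
Proof.
by split => h i; [move=> ik; apply: (h i)|move=> /= hi; apply: h; move: hi];
  rewrite /= mem_iota.
Qed.

Lemma probability_cylinder k u : (forall i, (i < k)%N -> u i = 1 \/ u i = -1) ->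
  Q (cylinder k u) = (2 ^- k)%:E.
Proof.
move=> hu; rewrite /cylinder (hVind (iota_uniq 0 k) (A := fun i => [set u i])) //.
transitivity (\prod_(i <- iota 0 k) (2^-1 : R)%:E)%E.
  apply: eq_big_seq => i; rewrite mem_iota => /= /hu [->|->]; [exact: hVp|exact: hVm].
suff H j : (\prod_(i <- iota j k) (2^-1 : R)%:E)%E = (2 ^- k)%:E by exact: H.
elim: k {hu} j => [|k IH] j /=; first by rewrite big_nil expr0 invr1.
by rewrite big_cons IH -EFinM exprS invfM.
Qed.

Definition stray k : set S := V k @^-1` ~` [set 1; -1].

Lemma probability_stray k : Q (stray k) = 0%E.
Proof.
have -> : stray k = ~` (V k @^-1` [set 1] `|` V k @^-1` [set -1]).
  by apply/seteqP; split => s /=.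
rewrite probability_setC; last by apply: measurableU; exact: measurable_velocity.
rewrite measureU; [|exact: measurable_velocity|exact: measurable_velocity|].
  transitivity (1 - ((2^-1 : R)%:E + (2^-1 : R)%:E))%E.
    by congr (1 - (_ + _))%E; [exact: hVp|exact: hVm].
  have -> : ((2^-1 : R)%:E + (2^-1 : R)%:E = 1)%E by rewrite -EFinD; congr EFin; lra.
  by rewrite subee.
by apply/seteqP; split => // s /= [-> ].
Qed.

(** Up to a null set a cylinder splits into two according to the next velocity,
    exactly as [avg] does. *)
Lemma integral_cylinder n k j (F : (nat -> int) -> R) u :
  prefix_fun n F -> (forall v, 0 <= F v) -> (k + j)%N = n ->
  (forall i, (i < k)%N -> u i = 1 \/ u i = -1) ->
  (\int[Q]_(s in cylinder k u) (F (V ^~ s))%:E = (2 ^- k * avg k j F u)%:E)%E.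
Proof.
move=> hF F0; have mF := measurable_prefix hF.
elim: j k u => [|j IH] k u kj hu.
  rewrite /= (eq_integral (cst (F u)%:E)); last first.
    move=> s; rewrite inE => /cylinderP hs /=; congr EFin; apply: hF => i.
    by rewrite -kj addn0; exact: hs.
  rewrite integral_cst; last exact: measurable_cylinder.
  transitivity ((F u)%:E * (2 ^- k)%:E)%E; last by rewrite -EFinM mulrC.
  by congr (_ * _)%E; exact: probability_cylinder.
have mEF (D : set S) : measurable_fun D (fun s => (F (V ^~ s))%:E).
  by apply/measurable_EFinP; exact: measurable_funTS.
have hu' a i : (a = 1 \/ a = -1) -> (i < k.+1)%N ->
    upd u k a i = 1 \/ upd u k a i = -1.
  move=> ha ik; rewrite /upd; case: eqP => // ne; apply: hu; lia.
rewrite (@ge0_negligible_integral _ _ _ _ _ (stray k)) //; last 4 first.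
- exact: measurable_velocity.
- exact: measurable_cylinder.
- by move=> s _; rewrite lee_fin.
- exact: probability_stray.
have -> : cylinder k u `\` stray k =
    cylinder k.+1 (upd u k 1) `|` cylinder k.+1 (upd u k (-1)).
  apply/seteqP; split => s.
    move=> [/cylinderP hs /contrapT [e|e]]; [left|right]; apply/cylinderP => i ik;
      rewrite /upd; have [->//|ne] := eqVneq i k; apply: hs; lia.
  have H a : cylinder k.+1 (upd u k a) s -> cylinder k u s /\ V k s = a.
    move=> /cylinderP hs; split; last by rewrite hs // /upd eqxx.
    apply/cylinderP => i ik; rewrite hs ?(leqW ik) // /upd.
    by have [e|//] := eqVneq i k; move: ik; rewrite e ltnn.
  by case=> /(H _) [h1 h2]; split => //; rewrite /stray /= h2; apply; [left|right].
rewrite ge0_integral_setU //; last 4 first.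
- exact: measurable_cylinder.
- exact: measurable_cylinder.
- by move=> s _; rewrite lee_fin.
- apply/disj_setPS => s [/cylinderP /(_ k (ltnSn k)) + /cylinderP /(_ k (ltnSn k))].
  by rewrite /upd eqxx => ->.
rewrite !IH; last first.
- by move=> i; apply: hu'; left.
- lia.
- by move=> i; apply: hu'; right.
- lia.
rewrite -EFinD /=; congr EFin; rewrite exprS invfM; field.
by rewrite expf_neq0.
Qed.

Lemma integral_prefix n (F : (nat -> int) -> R) u :
  prefix_fun n F -> (forall v, 0 <= F v) ->
  (\int[Q]_s (F (V ^~ s))%:E = (avg 0 n F u)%:E)%E.
Proof.
move=> hF F0; have := @integral_cylinder n 0 n F u hF F0 erefl.
rewrite expr0 invr1 mul1r => <- //; congr (integral _ _ _).
by apply/seteqP; split => // s _; apply/cylinderP.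
Qed.

End velocities.

Section expected_position.
Context (R : realType) (d' : measure_display) (S : measurableType d')
  (Q : probability S R) (V : nat -> {RV Q >-> int}).
Context (hVind : mutually_independent Q V)
  (hVp : forall n, Q (V n @^-1` [set 1]) = (2^-1)%:E)
  (hVm : forall n, Q (V n @^-1` [set -1]) = (2^-1)%:E).
Context (x : int -> R) (x_lt : forall s, x s < x (s + 1)).
Context (mu : R) (mu_gt0 : 0 < mu)
  (x_lin : forall e : R, 0 < e -> exists C : R, 0 <= C /\
     forall s, `|x s - mu * s%:~R| <= e * `|s|%:~R + C).

Local Notation T := (collision_time x).

Lemma drawn_position_cvg (t : R) (v : nat -> int) N : t < T v N ->
  forall M, (N <= M)%N -> drawn_position x M t v = position x v t.
Proof.
by move=> tN M NM; rewrite /drawn_position (lt_le_trans tN) // collision_time_le.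
Qed.

(** The position is a pointwise limit of functionals of finitely many velocities;
    where the collision times stay bounded by [t], the flight index is 0 by
    default. *)
Lemma measurable_position (t : R) : 0 <= t ->
  measurable_fun setT (fun s => position x (V ^~ s) t).
Proof.
move=> t0; pose g N (v : nat -> int) :=
  if t < T v N.+1 then drawn_position x N.+1 t v else x 0 + (v 0%N)%:~R * t.
apply: (@measurable_fun_cvg _ _ _ _ (fun N s => g N (V ^~ s))) => [N|s _].
  apply: (measurable_prefix V (n := N.+1)) => u v huv; rewrite /g.
  rewrite (@prefix_collision_time _ x N.+1 u v) // huv //.
  by rewrite (prefix_drawn_position x t0 huv).
apply: cvg_near_cst; have [[N tN]|never] := pselect (exists N, t < T (V ^~ s) N).
  exists N => // M /= NM; rewrite /g (lt_le_trans tN) ?collision_time_le 1?leqW //.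
  by rewrite (drawn_position_cvg tN) // leqW.
near=> N; rewrite /g ifF; last by apply/negbTE/negP => h; apply: never; exists N.+1.
rewrite /position.
have -> : flight_index x (V ^~ s) t = 0%N.
  by apply: xgetPN => n /= /andP[_ h]; apply: never; exists n.+1.
by rewrite walk0 collision_time0 subr0.
Unshelve. all: by end_near. Qed.

(** The event is contained in [T n <= t] for every [n], whose probability tends to
    0 by the law of large numbers for the collision times. *)
Lemma probability_stuck (t : R) : Q (\bigcap_N [set s | T (V ^~ s) N <= t]) = 0%E.
Proof.
have mT N : measurable [set s | T (V ^~ s) N <= t].
  rewrite -[X in measurable X]setTI.
  have mf := measurable_prefix V (@prefix_collision_time _ x N).
  by have := measurable_fun_ler mf (measurable_cst t); apply.
apply/eqP; rewrite eq_le measure_ge0 andbT; apply/lee_addgt0Pr => e e0; rewrite add0e.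
have e'0 : 0 < e * mu / 4 by rewrite divr_gt0 ?mulr_gt0.
have [C [C0 hC]] := collision_time_lln x_lt x_lin e'0.
set n := (Num.truncn (`|2 * t / mu| + 4 * C / (mu * e))).+1.
have hn : `|2 * t / mu| + 4 * C / (mu * e) < n%:R by exact: truncnS_gt.
have n0 : 0 < n%:R :> R by rewrite ltr0n.
have C40 : 0 <= 4 * C / (mu * e) by rewrite divr_ge0 ?mulr_ge0 ?(ltW e0) ?(ltW mu_gt0).
have n1 : 2 * t <= mu * n%:R.
  rewrite mulrC -ler_pdivrMl //; have := ler_norm (2 * t / mu); lra.
have n2 : 4 * C <= mu * e * n%:R.
  rewrite mulrC -ler_pdivrMl ?mulr_gt0 //; have := normr_ge0 (2 * t / mu); lra.
apply: (@le_trans _ _ (Q [set s | T (V ^~ s) n <= t])).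
  apply: le_measure; rewrite ?inE //; last by move=> s; exact.
  exact: bigcapT_measurable.
pose F v : R := (T v n <= t)%R%:R.
have hF : prefix_fun n F by move=> v w hvw; rewrite /F (@prefix_collision_time _ x n v w).
have -> : Q [set s | T (V ^~ s) n <= t] = (\int[Q]_s (F (V ^~ s))%:E)%E.
  rewrite -[LHS]mul1e -integral_cst //= integral_mkcond.
  apply: eq_integral => s _; rewrite patchE /F /=; case: ifPn; rewrite ?inE ?notin_setE /=.
    by move=> ->.
  by move/negP/negbTE => ->.
rewrite (integral_prefix hVind hVp hVm (fun=> 0) hF) ?lee_fin //.
apply: (@le_trans _ _ (avg 0 n (fun v => (mu * n%:R / 2 <= `|T v n - mu * n%:R|)%R%:R) (fun=> 0))).
  apply: avg_le => v _; rewrite /F; case: (leP (T v n)) => // h.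
  suff -> : mu * n%:R / 2 <= `|T v n - mu * n%:R| by [].
  rewrite distrC; apply: le_trans (ler_norm _); lra.
have mn : 0 < mu * n%:R / 2 by rewrite divr_gt0 ?mulr_gt0.
apply: le_trans (avg_markov 0 n _ mn _) _ => //.
rewrite ler_pdivrMr //; apply: le_trans (hC n _) _.
lra.
Qed.

Definition walk_moment_at (q : R) (m : nat) : R :=
  avg 0 m (fun v => `|(walk v m)%:~R| `^ q) (fun=> 0).

(** The expectation is the limit, as the number [N] of drawn velocities grows,
    of finite averages, to which the comparison of moments applies. *)
Lemma expected_position_close (q eta : R) : 0 < q -> 0 < eta -> exists t1 : R, 0 < t1 /\
  forall t : R, t1 <= t ->
  ((mu `^ q * walk_moment_at q (steps mu t) - eta * t `^ (q / 2))%:E <=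
    'E_Q[fun s => (`|position x (V ^~ s) t| `^ q)%R] <=
   (mu `^ q * walk_moment_at q (steps mu t) + eta * t `^ (q / 2))%:E)%E.
Proof.
move=> q0 eta0; have [t1 [t10 ht1]] := moment_close x_lt mu_gt0 x_lin q0 eta0.
exists t1; split => // t tt1; have t0 : 0 < t by exact: lt_le_trans t10 tt1.
set m := steps mu t; set M := mu `^ q * _.
pose g N v : R := if t < T v N then `|drawn_position x N t v| `^ q else 0.
have gE N v : g N v = `|drawn_position x N t v| `^ q.
  by rewrite /g /drawn_position; case: (t < T v N); rewrite // normr0 powR0 ?gt_eqF.
have g0 N v : 0 <= g N v by rewrite gE powR_ge0.
have pg N : prefix_fun N (g N).
  by move=> u v huv; rewrite !gE (prefix_drawn_position x (ltW t0) huv).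
have g_inc v : {homo (g^~ v) : n k / (n <= k)%N >-> n <= k}.
  move=> n k nk; rewrite /g; case: ifP => tn; last by case: ifP => // _; exact: powR_ge0.
  rewrite ifT ?(lt_le_trans tn) ?collision_time_le //.
  by rewrite (drawn_position_cvg tn) // (drawn_position_cvg tn).
have limE : ('E_Q[fun s => (`|position x (V ^~ s) t| `^ q)%R] =
    \int[Q]_s limn (fun N => (g N (V ^~ s))%:E))%E.
  rewrite unlock; apply: ge0_ae_eq_integral => //.
  - apply/measurable_EFinP.
    apply: (measurableT_comp (f := fun y : R => y `^ q)); first exact: measurable_powR.
    by apply: measurableT_comp => //; apply: measurable_position; exact: ltW.
  - apply: (emeasurable_fun_cvg (fun N s => (g N (V ^~ s))%:E)) => [N|s _].
      by apply/measurable_EFinP; exact: measurable_prefix.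
    by apply: ereal_nondecreasing_is_cvgn => n k nk; rewrite /= lee_fin g_inc.
  - move=> s _; apply: lime_ge.
      by apply: ereal_nondecreasing_is_cvgn => n k nk; rewrite /= lee_fin g_inc.
    by near=> N; rewrite lee_fin.
  exists (\bigcap_N [set s | T (V ^~ s) N <= t]); split.
  - apply: bigcapT_measurable => N; rewrite -[X in measurable X]setTI.
    have mf := measurable_prefix V (@prefix_collision_time _ x N).
    by have := measurable_fun_ler mf (measurable_cst t); apply.
  - exact: probability_stuck.
  move=> s /= hs N _ /=; rewrite leNgt; apply/negP => tN; apply: hs => _.
  apply/esym/cvg_lim => //; apply: cvg_near_cst; exists N => // k /= Nk.
  by rewrite gE (drawn_position_cvg tN).
have mcvg : ((\int[Q]_s (g N (V ^~ s))%:E) @[N --> \oo] -->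
    'E_Q[fun s => (`|position x (V ^~ s) t| `^ q)%R])%E.
  rewrite limE; apply: cvg_monotone_convergence => //.
  - by move=> N; apply/measurable_EFinP; exact: measurable_prefix.
  - by move=> N s _; rewrite lee_fin.
  - by move=> s _ n k nk; rewrite lee_fin g_inc.
have near_N : \forall N \near \oo,
    ((M - eta * t `^ (q / 2))%:E <= \int[Q]_s (g N (V ^~ s))%:E
      <= (M + eta * t `^ (q / 2))%:E)%E.
  near=> N.
  have tN : 2 * t / mu <= N%:R.
    by apply: ltW; near: N; exact: nbhs_infty_gtr.
  have mN : (m <= N)%N.
    rewrite -(ler_nat R); apply: le_trans tN; rewrite ler_pdivlMr //.
    by have /andP[_ h] := steps_bounds mu_gt0 (ltW t0); rewrite -/m in h; lra.
  rewrite (integral_prefix hVind hVp hVm (fun=> 0) (pg N)) // !lee_fin.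
  have -> : M = avg 0 N (fun v => `|mu * (walk v m)%:~R| `^ q) (fun=> 0).
    rewrite (avg_widen _ mN); last by move=> v w hvw; rewrite (@prefix_walk m v w).
    rewrite /M /walk_moment_at -avgZ; apply: eq_avg => v _.
    by rewrite normrM powRM // ger0_norm // ltW.
  have := ht1 t N (fun=> 0) tt1 tN; rewrite -/m => h.
  have := le_trans (ler_norm_avg _ _ _ _) h; rewrite avgB ler_norml.
  have -> : avg 0 N (g N) (fun=> 0) =
    avg 0 N (fun v => `|drawn_position x N t v| `^ q) (fun=> 0).
    by apply: eq_avg => v _; rewrite gE.
  by move=> /andP[h1 h2]; apply/andP; split; lra.
rewrite -(cvg_lim _ mcvg) //; apply/andP; split.
  by apply: lime_ge; [apply/cvg_ex; eexists; exact: mcvg|apply: filterS near_N => N /andP[]].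
by apply: lime_le; [apply/cvg_ex; eexists; exact: mcvg|apply: filterS near_N => N /andP[]].
Unshelve. all: by end_near. Qed.

End expected_position.

(** * Asymptotics of the moments *)

Section asymptotics.
Context {R : realType} (mu : R) (mu_gt0 : 0 < mu).

Definition moment_constant (q : R) : R :=
  Num.sqrt ((2 * mu) `^ q / pi) * Gamma ((q + 1) / 2).

Lemma moment_constant_gt0 q : 0 < q -> 0 < moment_constant q.
Proof.
move=> q0; rewrite mulr_gt0 ?Gamma_gt0 // sqrtr_gt0 divr_gt0 ?pi_gt0 //.
by rewrite powR_gt0 // mulr_gt0.
Qed.

Lemma truncn_cvg : Num.truncn (t / (2 * mu)) @[t --> +oo] --> \oo.
Proof.
suff H N : \forall t \near +oo, (N <= Num.truncn (t / (2 * mu)))%N.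
  by move=> A [N _ hN]; apply: filterS (H N) => t; exact: hN.
near=> t; have t0 : 0 < t by near: t; exact: nbhs_pinfty_gt.
rewrite truncn_ge_nat; last by rewrite divr_ge0 ?mulr_ge0 ?(ltW t0) // ltW.
rewrite ler_pdivlMr ?mulr_gt0 //; apply: ltW.
Unshelve. all: by end_near. Qed.

Lemma steps_ratio_cvg : (Num.truncn (t / (2 * mu)))%:R / t @[t --> +oo] --> (2 * mu)^-1.
Proof.
have m2 : 0 < 2 * mu by rewrite mulr_gt0.
apply/cvgrPdist_lt => e e0; near=> t.
have t0 : 0 < t by near: t; exact: nbhs_pinfty_gt.
have te : e^-1 < t by near: t; apply: nbhs_pinfty_gt; exact: num_real.
have /andP[h1 h2] := truncn_itv (ltW (divr_gt0 t0 m2)).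
have te1 : t^-1 < e by rewrite -[e]invrK ltf_pV2 ?posrE ?invr_gt0.
have {}h1 : (Num.truncn (t / (2 * mu)))%:R / t <= (2 * mu)^-1.
  by rewrite ler_pdivrMr // [leRHS]mulrC.
have {}h2 : (2 * mu)^-1 < (Num.truncn (t / (2 * mu)))%:R / t + t^-1.
  by rewrite -[X in _ + X]mul1r -mulrDl natr1 ltr_pdivlMr // [ltLHS]mulrC.
rewrite ger0_norm ?subr_ge0 //; lra.
Unshelve. all: by end_near. Qed.

(** With [steps mu t = 2 * n], the moment of the walk is asymptotically
    [2 ^ q * Gamma ((q + 1) / 2) / sqrt pi * n ^ (q / 2)], and [n / t] tends to
    [1 / (2 * mu)]. *)
Lemma walk_moment_steps_cvg q : 0 < q ->
  mu `^ q * walk_moment_at q (steps mu t) / t `^ (q / 2) @[t --> +oo] -->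
  moment_constant q.
Proof.
move=> q0; have m2 : 0 < 2 * mu by rewrite mulr_gt0.
pose n t := Num.truncn (t / (2 * mu)).
have c1 : walk_moment_at q (n t).*2 / Num.sqrt (n t)%:R `^ q @[t --> +oo] -->
    2 `^ q * Gamma ((q + 1) / 2) / Num.sqrt pi.
  exact: (cvg_comp _ _ truncn_cvg (even_walk_moment_cvg q0)).
have c2 : ((n t)%:R / t) `^ (q / 2) @[t --> +oo] --> (2 * mu)^-1 `^ (q / 2).
  apply: (@continuous_cvg _ _ _ _ _ _ (powR (R := R) ^~ (q / 2))).
    by apply: powR_continuous; rewrite invr_gt0.
  exact: steps_ratio_cvg.
have -> : moment_constant q = mu `^ q * ((2 `^ q * Gamma ((q + 1) / 2) / Num.sqrt pi)
    * (2 * mu)^-1 `^ (q / 2)).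
  have e1 : (2 * mu) `^ q = (2 * mu) `^ (q / 2) * (2 * mu) `^ (q / 2).
    rewrite -powRD; last by rewrite (gt_eqF m2) implybT.
    by congr (_ `^ _); field.
  have s0 : Num.sqrt pi != 0 :> R by rewrite gt_eqF // sqrtr_gt0 pi_gt0.
  have h0 : 0 < (2 * mu) `^ (q / 2) by exact: powR_gt0.
  rewrite /moment_constant e1 sqrtrM ?mulr_ge0 ?powR_ge0 // -expr2 sqrtr_sqr.
  rewrite ger0_norm ?powR_ge0 // sqrtrV ?pi_ge0 //.
  have -> : (2 * mu)^-1 `^ (q / 2) = ((2 * mu) `^ (q / 2))^-1.
    by rewrite -powR_inv1 ?(ltW m2) // -powRrM mulN1r powRN.
  have -> : mu `^ q * (2 `^ q * Gamma ((q + 1) / 2) / Num.sqrt pi * ((2 * mu) `^ (q / 2))^-1)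
     = (2 * mu) `^ q * (Gamma ((q + 1) / 2) / Num.sqrt pi * ((2 * mu) `^ (q / 2))^-1).
    by rewrite (powRM q) ?(ltW mu_gt0) //; ring.
  move: h0; rewrite e1; set h := _ `^ _; clearbody h => h0.
  by field; rewrite s0 gt_eqF.
apply: (@cvg_trans _ ((mu `^ q * ((walk_moment_at q (n t).*2 / Num.sqrt (n t)%:R `^ q)
   * ((n t)%:R / t) `^ (q / 2))) @[t --> +oo])); last first.
  by apply: cvgM; [exact: cvg_cst|exact: cvgM].
apply: near_eq_cvg; near=> t.
have t0 : 0 < t by near: t; exact: nbhs_pinfty_gt.
have n0 : 0 < (n t)%:R :> R.
  rewrite ltr0n; near: t; exact: (truncn_cvg (nbhs_infty_gt 0)).
rewrite /steps mul2n -/(n t) powRM ?invr_ge0 ?(ltW n0) ?(ltW t0) //.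
have -> : Num.sqrt (n t)%:R `^ q = (n t)%:R `^ (q / 2).
  by rewrite -powR12_sqrt ?(ltW n0) // -powRrM mulrC.
have -> : t^-1 `^ (q / 2) = (t `^ (q / 2))^-1.
  by rewrite -powR_inv1 ?(ltW t0) // -powRrM mulN1r powRN.
have p1 : 0 < (n t)%:R `^ (q / 2) by exact: powR_gt0.
have p2 : 0 < t `^ (q / 2) by exact: powR_gt0.
move: p1 p2; set a := _ `^ _; set b := t `^ _ => p1 p2.
by field; rewrite !gt_eqF.
Unshelve. all: by end_near. Qed.

(** Passing from two-sided bounds with arbitrarily small slopes to the ratio. *)
Lemma ratio_cvg1 (q : R) (E : R -> \bar R) : 0 < q ->
  (forall eta : R, 0 < eta -> exists t1 : R, 0 < t1 /\ forall t, t1 <= t ->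
    ((mu `^ q * walk_moment_at q (steps mu t) - eta * t `^ (q / 2))%:E <= E t <=
     (mu `^ q * walk_moment_at q (steps mu t) + eta * t `^ (q / 2))%:E)%E) ->
  (E t / (moment_constant q * t `^ (q / 2))%:E)%E @[t --> +oo] --> 1%E.
Proof.
move=> q0 hE; have c0 := moment_constant_gt0 q0.
set c := moment_constant q in c0 *.
have W := walk_moment_steps_cvg q0; rewrite -/c in W.
have fin : \forall t \near +oo, E t \is a fin_num.
  have [t1 [_ h]] := hE 1 ltr01; near=> t.
  have tt1 : t1 <= t by near: t; apply: nbhs_pinfty_ge; exact: num_real.
  have /andP[h1 h2] := h t tt1.
  by rewrite fin_numElt (lt_le_trans _ h1) ?ltNyr // (le_lt_trans h2) ?ltry.
have ratio : \forall t \near +oo,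
    (E t / (c * t `^ (q / 2))%:E)%E = (fine (E t) / (c * t `^ (q / 2)))%:E.
  near=> t; have t0 : 0 < t by near: t; exact: nbhs_pinfty_gt.
  have d0 : 0 < c * t `^ (q / 2) by exact: mulr_gt0 c0 (powR_gt0 _ t0).
  rewrite inver gt_eqF // EFinM fineK //; near: t; exact: fin.
suff lim_fine : fine (E t) / (c * t `^ (q / 2)) @[t --> +oo] --> (1 : R).
  apply: (@cvg_trans _ ((fine (E t) / (c * t `^ (q / 2)))%:E @[t --> +oo])).
    by apply: near_eq_cvg; apply: filterS ratio => t ->.
  by apply: cvg_EFin => //; near=> t.
apply/cvgrPdist_le => e e0.
have e2 : 0 < e * c / 2 by exact: divr_gt0 (mulr_gt0 e0 c0) (ltr0Sn R 1).
have [t1 [t10 h]] := hE _ e2.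
have := W; move=> /cvgrPdist_le /(_ _ e2) W'.
near=> t; have t0 : 0 < t by near: t; exact: nbhs_pinfty_gt.
have tt1 : t1 <= t by near: t; apply: nbhs_pinfty_ge; exact: num_real.
have fE : E t \is a fin_num by near: t; exact: fin.
have w : `|c - mu `^ q * walk_moment_at q (steps mu t) / t `^ (q / 2)| <= e * c / 2.
  by near: t; exact: W'.
have := h t tt1; rewrite -(fineK fE) !lee_fin; set r := fine (E t).
have b0 : 0 < t `^ (q / 2) by exact: powR_gt0.
move: w b0; set b := t `^ _; set A := mu `^ q * _; move=> w b0 /andP[r1 r2].
have w' : `|c * b - A| <= e * c / 2 * b.
  have -> : c * b - A = (c - A / b) * b by rewrite mulrBl divfK ?gt_eqF.
  by rewrite normrM (gtr0_norm b0) ler_wpM2r // ltW.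
have cb : 0 < c * b by exact: mulr_gt0 c0 b0.
have -> : 1 - r / (c * b) = (c * b - r) / (c * b) by rewrite mulrBl divff ?gt_eqF.
rewrite normrM [`|_^-1|]gtr0_norm ?invr_gt0 // ler_pdivrMr //.
move: w'; rewrite !ler_norml => /andP[w1 w2]; apply/andP; split; lra.
Unshelve. all: by end_near. Qed.

End asymptotics.

Section environment_lln.
Context {R : realType}.

(** From some rank [N] on the slope of the error is at most [e]; the constant [C]
    accounts for the ranks up to [N]. *)
Lemma mean_cvg_linear (a : nat -> R) (mu e : R) :
  a n / n%:R @[n --> \oo] --> mu -> 0 < e -> exists C : R, 0 <= C /\
  forall n, `|a n - mu * n%:R| <= e * n%:R + C.
Proof.
move=> /cvgrPdist_le h e0; have [N _ hN] := h e e0.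
exists (\sum_(0 <= i < N.+1) `|a i - mu * i%:R|); split; first exact: sumr_ge0.
move=> n; have [nN|Nn] := leqP n N.
  apply: ler_wpDl; first by rewrite mulr_ge0 // ltW.
  by rewrite big_mkord (bigD1 (Ordinal (nN : n < N.+1)%N)) //= lerDl sumr_ge0.
apply: ler_wpDr; first exact: sumr_ge0.
have n0 : 0 < n%:R :> R by rewrite ltr0n; lia.
have := hN n (ltnW Nn); rewrite /= distrC => hn.
have -> : a n - mu * n%:R = (a n / n%:R - mu) * n%:R by rewrite mulrBl divfK ?gt_eqF.
by rewrite normrM [`|n%:R|]gtr0_norm // ler_wpM2r.
Qed.

Lemma two_sided_linear (x : int -> R) (mu : R) : x 0 = 0 ->
  x n%:Z / n%:R @[n --> \oo] --> mu -> - x (- n%:Z) / n%:R @[n --> \oo] --> mu ->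
  forall e : R, 0 < e -> exists C : R, 0 <= C /\
     forall s, `|x s - mu * s%:~R| <= e * `|s|%:~R + C.
Proof.
move=> x0 hp hm e e0.
have [C [C0 hC]] := mean_cvg_linear hp e0.
have [D [D0 hD]] := mean_cvg_linear hm e0.
exists (C + D); split; first exact: addr_ge0.
move=> [n|n].
  by apply: le_trans (hC n) _; rewrite lerD2l lerDl.
rewrite NegzE normrN; apply: le_trans (_ : _ <= e * n.+1%:R + D) _; last first.
  by rewrite lerD2l lerDr.
suff -> : x (- n.+1%:Z) - mu * (- n.+1%:Z)%:~R = - (- x (- n.+1%:Z) - mu * n.+1%:R).
  by rewrite normrN.
by rewrite intrN; ring.
Qed.

End environment_lln.

(** A positive function with integral 0 would vanish almost everywhere. *)
Lemma integral_pos d (T : measurableType d) (R : realType) (P : probability T R)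
    (X : T -> R) : measurable_fun setT X -> (forall w, 0 < X w) ->
  (0 < \int[P]_w (X w)%:E)%E.
Proof.
move=> mX X0; rewrite lt0e integral_ge0 ?andbT; last by move=> w _; rewrite lee_fin ltW.
apply/negP => /eqP int0.
have [N [mN N0 hN]] : ae_eq P setT (EFin \o X) (cst 0%E).
  apply/ae_eq_integral_abs => //; first exact/measurable_EFinP.
  by rewrite -[RHS]int0; apply: eq_integral => w _ /=; rewrite gtr0_norm.
have NT : N = setT.
  apply/seteqP; split => // w _; apply: hN => /= /(_ I) [e].
  by have := X0 w; rewrite e ltxx.
have : P setT = 0%E by rewrite -NT; exact: N0.
by rewrite probability_setT => /eqP; rewrite onee_eq0.
Qed.

Theorem theorem6 (R : realType)
  (d : measure_display) (Omega : measurableType d) (P : probability Omega R)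
  (omega : int -> {RV P >-> R})
  (homega0 : forall w, omega 0 w = 0)
  (hpos : forall r w, 0 < spacing omega r w)
  (hind : mutually_independent P (spacing omega))
  (hdist : identically_distributed P (spacing omega))
  (d' : measure_display) (S : measurableType d') (Q : probability S R)
  (V : nat -> {RV Q >-> int})
  (hVind : mutually_independent Q V)
  (hVp : forall n, Q (V n @^-1` [set 1]) = (2^-1)%:E)
  (hVm : forall n, Q (V n @^-1` [set -1]) = (2^-1)%:E)
  (hmu : ('E_P[spacing omega 1] < +oo)%E) :
  {ae P, forall w, forall q : R, 0 < q ->
    ('E_Q[fun s => (`|position (omega ^~ w) (V ^~ s) t| `^ q)%R] /
      (Num.sqrt ((2 * fine 'E_P[spacing omega 1]) `^ q / pi)
        * Gamma ((q + 1) / 2) * t `^ (q / 2))%:E)%E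
    @[t --> +oo] --> 1%E}.
Proof.
(* The spacings as random variables, which are pairwise independent. *)
have mD r : measurable_fun setT (spacing omega r) by exact: measurable_funB.
pose D (r : int) : {RV P >-> R} :=
  HB.pack (spacing omega r) (isMeasurableFun.Build _ _ _ _ _ (mD r)).
have D_ge0 r w : 0 <= D r w by apply: ltW; exact: hpos.
have D_indep r r' (A B : set R) : r != r' -> measurable A -> measurable B ->
    P (D r @^-1` A `&` D r' @^-1` B) = (P (D r @^-1` A) * P (D r' @^-1` B))%E.
  move=> rr mA mB.
  have := hind [:: r; r'] (fun k => if k == r then A else B).
  have u2 : uniq [:: r; r'] by rewrite /= inE rr.
  move=> /(_ u2) h.
  have mAB (k : int) : measurable (if k == r then A else B) by case: ifP.
  move: (h mAB); rewrite !big_cons big_nil mule1 eqxx eq_sym (negbTE rr) => <-.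
  congr (P _); apply/seteqP; split => w /=.
    by move=> [wA wB] k; rewrite /= !inE => /orP[/eqP->|/eqP->]; rewrite ?eqxx // eq_sym (negbTE rr).
  move=> hw; split; first by have := hw r; rewrite /= !inE eqxx => /(_ isT).
  by have := hw r'; rewrite /= !inE eqxx orbT eq_sym (negbTE rr) => /(_ isT).
have D_ident r r' (A : set R) : measurable A -> P (D r @^-1` A) = P (D r' @^-1` A).
  exact: hdist.
set mu : R := fine 'E_P[spacing omega 1].
have muE r : (\int[P]_w (D r w)%:E = 'E_P[spacing omega 1])%E.
  rewrite unlock.
  have E k : (\int[P]_w (D k w)%:E = \int[distribution P (D k)]_y (Num.max 0 y)%:E)%E.
    rewrite ge0_integral_distribution; last first.
    - by move=> y; rewrite lee_fin le_max lexx.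
    - by apply/measurable_EFinP; exact: measurable_maxr.
    by apply: eq_integral => w _ /=; rewrite max_r // ltW.
  apply: etrans (E r) (etrans _ (esym (E 1))).
  by apply: eq_measure_integral => A mA _; exact: D_ident.
have mu_fin : ('E_P[spacing omega 1])%E \is a fin_num.
  rewrite -(muE 1) ge0_fin_numE; first by rewrite muE.
  by apply: integral_ge0 => w _; rewrite lee_fin.
have mu_gt0 : 0 < mu.
  rewrite -lte_fin fineK // -(muE 1); apply: integral_pos (hpos 1).
  exact: mD.
(* The strong law is applied on each side of the origin; the sums of spacings
   telescope to [omega n] and [- omega (- n)]. *)
have up := @strong_law _ _ _ P (fun n => D n.+1%:Z) (fun n => D_ge0 _).
have down := @strong_law _ _ _ P (fun n => D (- n%:Z)) (fun n => D_ge0 _).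
have {}up : {ae P, forall w, omega n%:Z w / n%:R @[n --> \oo] --> mu}.
  apply: filterS (up _ _ _) => [w||i A|].
  - rewrite muE -/mu; apply: cvg_trans; apply: near_eq_cvg; apply: nearW => n.
    congr (_ / _); elim: n => [|n IHn]; first by rewrite big_nil homega0.
    rewrite big_nat_recr //= IHn /spacing /= (_ : n.+1%:Z - 1 = n%:Z); last by clear; lia.
    by rewrite addrC subrK.
  - by move=> i j A B ij; apply: D_indep; apply: contra ij => /eqP [->].
  - exact: D_ident.
  - by rewrite muE.
have {}down : {ae P, forall w, - omega (- n%:Z) w / n%:R @[n --> \oo] --> mu}.
  apply: filterS (down _ _ _) => [w||i A|].
  - rewrite muE -/mu; apply: cvg_trans; apply: near_eq_cvg; apply: nearW => n.
    congr (_ / _); elim: n => [|n IHn]; first by rewrite big_nil homega0 oppr0.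
    rewrite big_nat_recr //= IHn /spacing /= addKr.
    by congr (- omega _ w); clear; lia.
  - by move=> i j A B ij; apply: D_indep; apply: contra ij => /eqP /oppr_inj [->].
  - exact: D_ident.
  - by rewrite muE.
(* From here on the environment [w] is fixed. *)
apply: filterS2 up down => w wu wd q q0.
have x_lt s : omega s w < omega (s + 1) w.
  by have := hpos (s + 1) w; rewrite /spacing /= addrK subr_gt0.
have x_lin := @two_sided_linear R (omega ^~ w) mu (homega0 w) wu wd.
apply: (@ratio_cvg1 R mu mu_gt0 q
  (fun t => 'E_Q[fun s => (`|position (omega ^~ w) (V ^~ s) t| `^ q)%R])%E q0).
move=> eta eta0.
exact: (expected_position_close hVind hVp hVm x_lt mu_gt0 x_lin q0 eta0).
Unshelve. all: by end_near. Qed.
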